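(* Let $l\ge 1$, let $\mathbf v=(v_1,\dots,v_l)\in\mathbb Z^l$ with $v_1\ge\dots\ge v_l$, and let $S$ be a standard symbol of multicharge $\mathbf v$ and size $n$. Write the associated canonical basis element as $$G(S)=\sum_{T\in\mathcal S_{\mathbf v}(n)}\alpha_{S,T}(q)\,T .$$ Assume that there is an integer $x$ that appears in every row of $S$. Then $x$ appears in every row of every symbol $T$ with $\alpha_{S,T}(q)\neq 0$. For a symbol $T\in\mathcal S_{\mathbf v}$ having $x$ in every row, let $T[x]\in\mathcal S_{\mathbf v^-}$, with $\mathbf v^-=(v_1-1,\dots,v_l-1)$, be the symbol obtained from $T$ by removing every entry $x$. Then $$G(S[x])=\sum_{T\in\mathcal S_{\mathbf v}(n)}\alpha_{S,T}(q)\,T[x],$$ where the sum is effectively over those $T$ with $\alpha_{S,T}(q)\ne 0$.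
   Context: Symbols. For $s\in\mathbb Z$, $\mathfrak B_s$ is the set of strictly increasing integer sequences $\beta=(\beta_j)_{j\le s}$ with $\beta_j=j$ for all sufficiently negative $j$; such a sequence is also viewed as the set of its values. A symbol of multicharge $\mathbf v=(v_1,\dots,v_l)$, $v_1\ge\dots\ge v_l$, is a tuple $S=(\beta^1,\dots,\beta^l)$ with $\beta^i=(\beta^i_j)_{j\le v_i}\in\mathfrak B_{v_i}$; $\beta^i$ is the $i$-th row (row 1 on top). Its size is $\sum_i\sum_{j\le v_i}(\beta^i_j-j)$. $\mathcal S_{\mathbf v}$ is the set of symbols of multicharge $\mathbf v$, $\mathcal S_{\mathbf v}(n)$ those of size $n$, and $\emptyset_{\mathbf v}$ the symbol of size $0$. $S$ is standard if $\beta^i_j\le\beta^{i+1}_j$ for all $1\le i<l$ and $j\le v_{i+1}$. Removal. When $x$ is removed from a row in $\mathfrak B_{v_i}$, the remaining values, in increasing order, are re-indexed by $j\le v_i-1$, giving an element of $\mathfrak B_{v_i-1}$. If $S$ is standard then $S[x]$ is again standard, so $G(S[x])$ makes sense. Fock space. $\mathcal F_{\mathbf v}$ is the $\mathbb Q(q)$-vector space with basis $\mathcal S_{\mathbf v}$. It is a $U_q(\mathfrak{gl}_\infty)$-module (the tensor product of the level-one modules $V(\Lambda_{v_1})\otimes\dots\otimes V(\Lambda_{v_l})$), in which, for $i\in\mathbb Z$, $$F_i\cdot S=\sum_{S'}q^{\#\{k>j\,:\,i\in\beta^k\}-\#\{k>j\,:\,i+1\in\beta^k\}}S',$$ the sum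 being over all symbols $S'$ obtained from $S=(\beta^1,\dots,\beta^l)$ by replacing, in a single row $j$, an entry $i$ by $i+1$ (this requires $i\in\beta^j$, $i+1\notin\beta^j$). For $a\ge 0$, $F_i^{(a)}=F_i^a/[a]!$ with $[r]=(q^r-q^{-r})/(q-q^{-1})$ and $[a]!=[a][a-1]\cdots[1]$. Canonical basis. $V_{\mathbf v}\subset\mathcal F_{\mathbf v}$ is the $U_q(\mathfrak{gl}_\infty)$-submodule generated by $\emptyset_{\mathbf v}$, i.e. the $\mathbb Q(q)$-span of all $F_{i_1}\cdots F_{i_m}\cdot\emptyset_{\mathbf v}$. The bar involution $u\mapsto\overline u$ of $V_{\mathbf v}$ is the unique $\mathbb Q$-linear map with $\overline{f(q)u}=f(q^{-1})\overline u$ for $f(q)\in\mathbb Q(q)$, $\overline{F_i u}=F_i\overline u$ and $\overline{\emptyset_{\mathbf v}}=\emptyset_{\mathbf v}$. Let $V_{\mathbf v}^{\mathbb Z}$ be the $\mathbb Z[q,q^{-1}]$-span of all $F_{i_1}^{(a_1)}\cdots F_{i_m}^{(a_m)}\cdot\emptyset_{\mathbf v}$, let $R\subset\mathbb Q(q)$ be the ring of rational functions regular at $q=0$, and $\mathcal F_{\mathbf v,R}$ the $R$-span of the symbols. For each standard symbol $S\in\mathcal S_{\mathbf v}$, $G(S)$ is the unique element of $V_{\mathbf v}^{\mathbb Z}$ with $\overline{G(S)}=G(S)$ and $G(S)\equiv S \bmod q\mathcal F_{\mathbf v,R}$ (existence and uniqueness are known); the $G(S)$ form a $\mathbb Q(q)$-basis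 of $V_{\mathbf v}$, the canonical basis. *)

(* Defs.v *)
From HB Require Import structures.
From mathcomp Require Import all_boot all_order all_algebra.
From mathcomp Require Import mathcomp_extra boolp classical_sets functions.
From mathcomp Require Import cardinality fsbigop finmap monalg.

Set Implicit Arguments.
Unset Strict Implicit.
Unset Printing Implicit Defensive.

Import Order.TTheory GRing.Theory Num.Theory.
Local Open Scope classical_set_scope.
Local Open Scope quotient_scope.
Local Open Scope ring_scope.

(** * The field Q(q) *)

Definition Qq : fieldType := {fraction {poly rat}}.

Definition polyQ (p : {poly rat}) : Qq := FracField.tofrac p.

Definition q : Qq := polyQ 'X.

(* [eval_qV p] is p(q^-1).  As q^-1 is transcendental over the rationals,
   [eval_qV d != 0] for d != 0, so that the value of [barQ f] does not depend on
   the representative of the fraction f. *)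
Definition eval_qV (p : {poly rat}) : Qq :=
  (map_poly (fun c : rat => polyQ c%:P) p).[q^-1].

Definition barQ (f : Qq) : Qq :=
  let r := repr (f : {fraction {poly rat}}) in
  eval_qV \n_r / eval_qV \d_r.

Definition laurentZ : set Qq :=
  [set f | exists (p : {poly int}) (m : nat),
     f = polyQ (map_poly (intr : int -> rat) p) * q ^- m].

Definition regular0 : set Qq :=
  [set f | exists p d : {poly rat}, d.[0] != 0 /\ f = polyQ p / polyQ d].

Definition qint (r : nat) : Qq := (q ^+ r - q ^- r) / (q - q^-1).

Definition qfact (a : nat) : Qq := \prod_(1 <= r < a.+1) qint r.

(** * Rows and symbols *)

(* A sequence (beta_j)_{j <= s} is stored from the top: f k = beta_{s - k}.
   Hence "strictly increasing in j" reads "strictly decreasing in k". *)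
Definition is_row (s : int) (f : nat -> int) : Prop :=
  (forall k k' : nat, (k < k')%N -> f k' < f k) /\
  (exists N : nat, forall k : nat, (N <= k)%N -> f k = s - k%:Z).

Record row_of (s : int) := Row {
  row_fun :> nat -> int;
  _ : `[< is_row s row_fun >] }.

HB.instance Definition _ (s : int) := [isSub for @row_fun s].
HB.instance Definition _ (s : int) := [Choice of row_of s by <:].

Lemma rowP (s : int) (b : row_of s) : is_row s b.
Proof. by case: b => f /= /asboolP. Qed.

(* [entry b j] is beta_j; it is meaningful only for j <= s. *)
Definition entry (s : int) (b : row_of s) (j : int) : int := b `|s - j|%N.

Definition mem_row (s : int) (b : row_of s) : pred int :=
  fun x => `[< exists k : nat, b k = x >].

Canonical row_predType (s : int) :=
  Eval hnf in PredType (@mem_row s : row_of s -> pred int).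

Lemma mem_rowP (s : int) (b : row_of s) (x : int) :
  reflect (exists2 j : int, j <= s & entry b j = x) (x \in b).
Proof.
apply: (iffP (asboolP _)) => [[k bk]|[j js bj]]; last by exists `|s - j|%N.
exists (s - k%:Z); first by rewrite gerBl.
by rewrite /entry subKr absz_nat.
Qed.

(* The default value of [insubd] is not used when i + 1 is not an entry of b,
   see [raise_entryE]. *)
Definition raise_entry (s : int) (b : row_of s) (i : int) : row_of s :=
  insubd b (fun k : nat => if b k == i then i + 1 else b k).

Lemma raise_entryE (s : int) (b : row_of s) (i : int) (k : nat) :
  i + 1 \notin b -> raise_entry b i k = if b k == i then i + 1 else b k.
Proof.
move=> ni1; have nb m : b m != i + 1.
  by apply: contra ni1 => /eqP bm; apply/asboolP; exists m.
have [bdecr [N bN]] := rowP b.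
rewrite /raise_entry insubdK //; apply/asboolP; split=> [m m' mm'|].
  have lt_b := bdecr _ _ mm'.
  case: eqP => [bi|_]; case: eqP => [bj|_] //.
  - by move: lt_b; rewrite bi bj ltxx.
  - by rewrite lt_neqAle eq_sym nb /= lezD1 -bi.
  - by rewrite ltzD1 ltW // -bj.
pose M := maxn N `|s - i|%N.+1; exists M => m Mm.
have Nm : (N <= m)%N := leq_trans (leq_maxl _ _) Mm.
rewrite bN //; case: eqP => // ei; exfalso.
have : (`|s - i| < m)%N by apply: leq_trans Mm; rewrite leq_maxr.
by rewrite -ei subKr absz_nat ltnn.
Qed.

(* Removing the entry x: the entries above x keep their distance to the top,
   those below x move up by one. *)
Definition remove_fun (x : int) (f : nat -> int) : nat -> int :=
  fun k => if x < f k then f k else f k.+1.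

Lemma remove_entry_proof (x s : int) (b : row_of s) :
  `[< is_row (s - 1) (remove_fun x b) >].
Proof.
have [bdecr [N bN]] := rowP b.
apply/asboolP; split=> [k k' kk'|].
  rewrite /remove_fun; have [xk'|xk'] := ltP x (b k');
    have [xk|xk] := ltP x (b k).
  - exact: bdecr.
  - have := lt_le_trans xk' (ltW (lt_le_trans (bdecr _ _ kk') xk)).
    by rewrite ltxx.
  - by apply: bdecr; rewrite ltnS ltnW.
  - exact: bdecr.
pose M := maxn N `|s - x|%N; exists M => k Mk.
have Nk : (N <= k)%N := leq_trans (leq_maxl _ _) Mk.
rewrite /remove_fun !bN ?(leqW Nk) // -[k.+1]addn1 PoszD opprD addrA.
have [xk|_] := ltP x (s - k%:Z); last by rewrite addrAC.
exfalso; move: xk; rewrite ltrBrDr -ltrBrDl ltNge.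
by rewrite (le_trans (lez_abs _)) // lez_nat (leq_trans _ Mk) // leq_maxr.
Qed.

Definition remove_entry (x s : int) (b : row_of s) : row_of (s - 1) :=
  Row (remove_entry_proof x b).

Lemma mem_remove_entry (x s : int) (b : row_of s) (y : int) :
  x \in b -> (y \in remove_entry x b) = (y \in b) && (y != x).
Proof.
move=> /asboolP[k0 bk0]; have [bdecr _] := rowP b.
apply/asboolP/andP => /= [[k]|[/asboolP[k bk] yx]]; rewrite /remove_fun.
  have [xk <-|kx <-] := ltP x (b k).
    by split; [apply/asboolP; exists k|rewrite gt_eqF].
  split; first by apply/asboolP; exists k.+1.
  by rewrite lt_eqF // (lt_le_trans _ kx) // bdecr.
have [xy|xy] := ltP x y; first by exists k; rewrite bk xy.
have k0k : (k0 < k)%N.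
  rewrite ltnNge; apply/negP; rewrite leq_eqVlt => /predU1P[kk0|/bdecr].
    by rewrite -bk -bk0 kk0 eqxx in yx.
  by rewrite bk bk0 ltNge xy.
case: k => // k in bk k0k *; exists k.
rewrite ltNge; suff -> : b k <= x by [].
by rewrite -bk0; move: k0k; rewrite ltnS leq_eqVlt => /predU1P[->|/bdecr/ltW].
Qed.

Section Symbols.

Variables (l : nat) (v : 'I_l -> int).

Definition symbol := forall i : 'I_l, row_of (v i).

HB.instance Definition _ := Choice.on symbol.

Lemma empty_proof (s : int) : `[< is_row s (fun k : nat => s - k%:Z) >].
Proof.
apply/asboolP; split=> [k k' kk'|]; last by exists 0%N.
by rewrite ltrD2l ltrN2 ltz_nat.
Qed.

Definition empty_symbol : symbol := fun i => Row (empty_proof (v i)).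

Definition symbol_size (S : symbol) : int :=
  \sum_(i < l) \sum_(j \in [set j : int | j <= v i]) (entry (S i) j - j).

Definition symbols_of_size (n : nat) : set symbol :=
  [set S | symbol_size S = n%:Z].

Definition standard (S : symbol) : Prop :=
  forall i i' : 'I_l, i' = i.+1 :> nat ->
  forall j : int, j <= v i' -> entry (S i) j <= entry (S i') j.

Definition raise_row (S : symbol) (j : 'I_l) (i : int) : symbol :=
  fun k => if k == j then raise_entry (S k) i else S k.

(** * The Fock space *)

Definition fock := {malg Qq[symbol]}.

Definition sym (S : symbol) : fock := << S >>.

(* Each S' arises from exactly one row j, so the sum over S' is a sum over j. *)
Definition F_symbol (i : int) (S : symbol) : fock :=
  \sum_(j < l | (i \in S j) && (i + 1 \notin S j))
    q ^ (#|[pred k : 'I_l | (j < k)%N && (i \in S k)]|%:Z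
         - #|[pred k : 'I_l | (j < k)%N && (i + 1 \in S k)]|%:Z)
      *: sym (raise_row S j i).

Definition F (i : int) (u : fock) : fock :=
  \sum_(S <- msupp u) u@_S *: F_symbol i S.

Definition Fdiv (i : int) (a : nat) (u : fock) : fock :=
  (qfact a)^-1 *: iter a (F i) u.

Definition qspan (A : set Qq) (X : set fock) : set fock :=
  [set u | exists s : seq (Qq * fock),
     (forall p, p \in s -> A p.1 /\ X p.2) /\ u = \sum_(p <- s) p.1 *: p.2].

Definition V : set fock :=
  qspan setT (range (fun s : seq int => foldr F (sym empty_symbol) s)).

Definition VZ : set fock :=
  qspan laurentZ (range (fun s : seq (int * nat) =>
    foldr (fun p => Fdiv p.1 p.2) (sym empty_symbol) s)).

Definition fockR : set fock := qspan regular0 (range sym).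

(* Only the values on V matter.  Q-linearity follows from additivity and
   semilinearity. *)
Definition is_bar (f : fock -> fock) : Prop :=
  [/\ forall u, V u -> V (f u),
      forall u w, V u -> V w -> f (u + w) = f u + f w,
      forall a u, V u -> f (a *: u) = barQ a *: f u,
      forall i u, V u -> f (F i u) = F i (f u)
    & f (sym empty_symbol) = sym empty_symbol].

Definition bar : fock -> fock :=
  @xget (fock -> fock)%type id [set f | is_bar f].

(** * The canonical basis *)

Definition is_canonical (S : symbol) (g : fock) : Prop :=
  [/\ VZ g, bar g = g & exists2 w, fockR w & g - sym S = q *: w].

(* The element satisfying [is_canonical S] exists and is unique when the
   multicharge is weakly decreasing and S is standard. *)
Definition G (S : symbol) : fock := xget 0 [set g | is_canonical S g].

Definition alpha (S T : symbol) : Qq := (G S)@_T.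

Definition in_every_row (x : int) (T : symbol) : Prop :=
  forall i : 'I_l, x \in T i.

End Symbols.

Arguments empty_symbol {l} v.
Arguments symbols_of_size {l} v n.

Definition multicharge_pred (l : nat) (v : 'I_l -> int) : 'I_l -> int :=
  fun i => v i - 1.

Definition remove_symbol (l : nat) (v : 'I_l -> int) (x : int) (T : symbol v) :
    symbol (multicharge_pred v) :=
  fun i => remove_entry x (T i).

(* Main.v *)
(* The bar involution extends from V_v to the whole Fock space as a semilinear map
   commuting with the F_i; it is built one row at a time from the Serre relations
   and is unitriangular. A bar-invariant element u of V_v^Z with coefficients in q R
   therefore vanishes; this gives the uniqueness of G(S), and its homogeneity with
   respect to the number of occurrences of each value, so that x occurs in every
   row of every T in G(S).

   Suppose that for a homogeneous u the columns i and i + 1 are such that no entry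
   i + 1 can be lowered to i. Then F_i^(k), for the maximal k, swaps the two columns,
   with inverse E_i^(k), and both preserve bar-invariance and integrality. Hence
   u is bar-invariant and integral if and only if the result of the swap is. A full
   column x can be swapped downwards until all columns below it are full, and the
   empty column of T[x] can be moved in the same way. When all columns up to x are
   full, moving the empty column of T[x] to the top, beyond all entries, gives the
   symbol T shifted by one, and the shift F_i -> F_(i-1) is harmless. So T -> T[x]
   preserves the properties characterizing the canonical basis, in both directions;
   if no canonical element existed for S, then none would exist for S[x], and both
   sides of the equality would be the default value 0. *)

From HB Require Import structures.
Require Import Defs.
From mathcomp Require Import all_boot all_order all_algebra.
From mathcomp Require Import boolp classical_sets fsbigop finmap monalg.
From mathcomp Require Import ring zify.
Import Order.TTheory GRing.Theory Num.Theory.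
Local Open Scope classical_set_scope.
Local Open Scope ring_scope.

Set Implicit Arguments.
Unset Strict Implicit.
Unset Printing Implicit Defensive.

(** The obstacle is [bar]: it is specified only on [V], where the words in the F_i satisfy many
    linear relations, so a definition on words would have to be compatible with all of them. On the
    whole Fock space a basis is available, and words are only used to determine the restriction to
    [V]. To make room for an induction on rows, F_i is studied on the first n rows; adding a row is
    the coproduct formula [Fn_ins].

    The column swap is an sl_2 fact. If E_i kills u of weight k, then E_i^(k) F_i^(k) u = u, because
    the only surviving coefficient of the commutation formula is the Gaussian binomial of k over k;
    and F_i^(k) raises every row that can be raised, with coefficient exactly 1. Integrality of the
    inverse rests on Gaussian binomials being Laurent polynomials over the integers, bar-invariance
    on E_i commuting with the involution on [V]. *)

(** * Bar conjugation on Q(q) *)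

HB.instance Definition _ := GRing.RMorphism.copy polyQ (@FracField.tofrac {poly rat}).

Lemma polyQ_inj : injective polyQ.
Proof. by move=> p p' /eqP; rewrite /polyQ tofrac_eq => /eqP. Qed.

Lemma polyQ_eq0 (p : {poly rat}) : (polyQ p == 0) = (p == 0).
Proof. exact: tofrac_eq0. Qed.

Lemma q_neq0 : q != 0.
Proof. by rewrite polyQ_eq0 polyX_eq0. Qed.

Lemma eval_qV_zmod : zmod_morphism eval_qV.
Proof.
move=> p p'; rewrite /eval_qV.
have E : (fun c : rat => polyQ c%:P) = (polyQ \o polyC) by [].
by rewrite E rmorphB hornerD hornerN.
Qed.
HB.instance Definition _ := GRing.isZmodMorphism.Build _ _ eval_qV eval_qV_zmod.

Lemma eval_qV_monoid : monoid_morphism eval_qV.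
Proof.
rewrite /eval_qV.
have E : (fun c : rat => polyQ c%:P) = (polyQ \o polyC) by [].
by split=> [|p p']; rewrite E ?rmorph1 ?hornerC // rmorphM hornerM.
Qed.
HB.instance Definition _ := GRing.isMonoidMorphism.Build _ _ eval_qV eval_qV_monoid.

Lemma eval_qVX : eval_qV 'X = q^-1.
Proof.
rewrite /eval_qV.
have E : (fun c : rat => polyQ c%:P) = (polyQ \o polyC) by [].
by rewrite E map_polyX hornerX.
Qed.

(** Multiplying p(q^-1) by a high enough power of q gives the reversal of p, a genuine polynomial
    whose coefficients can be compared. *)
Lemma eval_qV_rev (p : {poly rat}) n : (size p <= n.+1)%N ->
  q ^+ n * eval_qV p = polyQ (\sum_(i < n.+1) p`_i *: 'X^(n - i)).
Proof.
move=> sp; rewrite /eval_qV (@horner_coef_wide _ n.+1); last first.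
  by rewrite (leq_trans _ sp) // size_poly.
rewrite mulr_sumr rmorph_sum; apply: eq_bigr => i _ /=.
have E : (fun c : rat => polyQ c%:P) = (polyQ \o polyC) by [].
rewrite E coef_map /= -mul_polyC rmorphM rmorphXn /=.
rewrite mulrCA; congr (_ * _).
have iN : (i <= n)%N by rewrite -ltnS.
by rewrite exprVn expfB_cond ?(negPf q_neq0) // ltnW.
Qed.

Lemma eval_qV_eq0 (p : {poly rat}) : (eval_qV p == 0) = (p == 0).
Proof.
apply/idP/idP => [/eqP p0|/eqP ->]; last by rewrite rmorph0.
apply/eqP/polyP => i; rewrite coef0.
have [ip|ip] := ltnP i (size p); last by rewrite nth_default.
(* Taking [size p] rather than its predecessor as degree bound spares the case p = 0; the
   coefficient p_i then sits in degree [size p - i]. *)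
have := @eval_qV_rev p (size p) (leqnSn _).
rewrite p0 mulr0 => /esym/eqP; rewrite polyQ_eq0 => /eqP/polyP/(_ (size p - i)%N).
rewrite coef0 coef_sum.
have iS : (i < (size p).+1)%N by rewrite ltnS ltnW.
rewrite (bigD1 (Ordinal iS)) //= coefZ coefXn eqxx mulr1 big1 ?addr0 // => j ji.
rewrite coefZ coefXn; case: eqP => [e|]; last by rewrite mulr0.
exfalso; move/eqP: ji; apply; apply: ord_inj => /=.
move: e (ltn_ord j) ip; move: (size p) (nat_of_ord j) => s t. lia.
Qed.

Lemma frac_numden (R : idomainType) (f : {fraction R}) :
  f * FracField.tofrac (\d_(repr f)) = FracField.tofrac (\n_(repr f)).
Proof.
rewrite -[X in X * _ = _]reprK; unlock FracField.tofrac; rewrite -[LHS]FracField.pi_mul.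
apply/eqmodP; rewrite /= FracField.equivfE /FracField.mulf.
by rewrite !numden_Ratio ?mulf_neq0 ?oner_eq0 ?denom_ratioP // !mulr1 mulrC.
Qed.

(** Equality of fractions is a cross-multiplied identity of polynomials, which the ring morphism
    [eval_qV] carries over. *)
Lemma barQ_frac (n d : {poly rat}) : d != 0 ->
  barQ (polyQ n / polyQ d) = eval_qV n / eval_qV d.
Proof.
move=> d0; rewrite /barQ; set f := polyQ n / polyQ d.
have := frac_numden f; have := denom_ratioP (repr f).
set n' := \n_(repr f); set d' := \d_(repr f) => d'0.
rewrite -/(polyQ d') -/(polyQ n') /f => e.
apply/eqP; rewrite eqr_div ?eval_qV_eq0 // -!rmorphM; apply/eqP; congr eval_qV.
apply: polyQ_inj; rewrite !rmorphM /= -e mulrAC divfK ?polyQ_eq0 //.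
Qed.

Lemma fracQ_ind (P : Qq -> Prop) :
  (forall n d : {poly rat}, d != 0 -> P (polyQ n / polyQ d)) -> forall f, P f.
Proof.
move=> h f; have := frac_numden f; have := denom_ratioP (repr f).
set n' := \n_(repr f); set d' := \d_(repr f) => d'0 e.
suff -> : f = polyQ n' / polyQ d' by apply: h.
apply: (canRL (mulfK _)); [by rewrite polyQ_eq0 | exact: e].
Qed.

Lemma barQ_zmod : zmod_morphism barQ.
Proof.
elim/fracQ_ind => n d d0; elim/fracQ_ind => n' d' d0'.
rewrite -mulNr addf_div ?polyQ_eq0 // -!rmorphN -!rmorphM -rmorphD.
rewrite !barQ_frac ?mulf_neq0 // -mulNr addf_div ?eval_qV_eq0 //.
by rewrite !(rmorphD, rmorphM, rmorphN).
Qed.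
HB.instance Definition _ := GRing.isZmodMorphism.Build _ _ barQ barQ_zmod.

Lemma barQ_poly (p : {poly rat}) : barQ (polyQ p) = eval_qV p.
Proof. by rewrite -[polyQ p]divr1 -(rmorph1 polyQ) barQ_frac ?oner_eq0 // rmorph1 divr1. Qed.

Lemma barQ_monoid : monoid_morphism barQ.
Proof.
split; first by rewrite -(rmorph1 polyQ) barQ_poly !rmorph1.
elim/fracQ_ind => n d d0; elim/fracQ_ind => n' d' d0'.
rewrite mulf_div -!(rmorphM polyQ) !barQ_frac ?mulf_neq0 //.
by rewrite !(rmorphM eval_qV) mulf_div.
Qed.
HB.instance Definition _ := GRing.isMonoidMorphism.Build _ _ barQ barQ_monoid.

Lemma barQ_q : barQ q = q^-1.
Proof. by rewrite barQ_poly eval_qVX. Qed.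

Lemma barQ_qX (z : int) : barQ (q ^ z) = q ^ (- z).
Proof. by rewrite fmorphXz /= barQ_q -exprz_inv. Qed.

Lemma qX_neq0 (z : int) : q ^ z != 0.
Proof. exact/expfz_neq0/q_neq0. Qed.

Lemma qD (m n : int) : q ^ (m + n) = q ^ m * q ^ n.
Proof. exact/expfzDr/q_neq0. Qed.

(** * Quantum integers and factorials *)

Lemma qexp_eq1 (n : nat) : (0 < n)%N -> q ^+ n != 1.
Proof.
move=> n0; rewrite -(rmorph1 polyQ) -rmorphXn /= (inj_eq polyQ_inj).
by apply/eqP => /(congr1 (size \o @polyseq _)); rewrite /= size_polyXn size_poly1; case: n n0.
Qed.

(** The quantum integer of an arbitrary integer: [qint] stops at natural numbers, whereas weights of
    symbols may be negative. *)
Definition qnum (m : int) : Qq := (q ^ m - q ^ (- m)) / (q - q^-1).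

Lemma qBqV_neq0 : q - q^-1 != 0.
Proof.
have := @qexp_eq1 2 isT; apply: contraNneq => /eqP; rewrite subr_eq0 => /eqP e.
by rewrite expr2 {1}e mulVf // q_neq0.
Qed.

Lemma qnum0 : qnum 0 = 0.
Proof. by rewrite /qnum oppr0 subrr mul0r. Qed.

Lemma qnum1 : qnum 1 = 1.
Proof. by rewrite /qnum expr1z exprN1 divff // qBqV_neq0. Qed.

Lemma qnumN m : qnum (- m) = - qnum m.
Proof. by rewrite /qnum opprK -mulNr opprB. Qed.

Lemma qint_qnum (r : nat) : qint r = qnum r.
Proof. by rewrite /qint /qnum exprnN. Qed.

Lemma qint_neq0 r : (0 < r)%N -> qint r != 0.
Proof.
move=> r0; apply: mulf_neq0; last exact/invr_neq0/qBqV_neq0.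
rewrite subr_eq0.
have := @qexp_eq1 (r + r); rewrite addn_gt0 r0 => /(_ isT).
apply: contraNneq => e; rewrite exprD [X in X * _]e mulVf //.
exact/expf_neq0/q_neq0.
Qed.

Lemma qfactS a : qfact a.+1 = qfact a * qint a.+1.
Proof. by rewrite /qfact big_nat_recr. Qed.

Lemma qfact0 : qfact 0 = 1. Proof. by rewrite /qfact big_geq. Qed.

Lemma qfact_neq0 a : qfact a != 0.
Proof.
elim: a => [|a IH]; first by rewrite qfact0; exact: oner_neq0.
by rewrite qfactS; apply: mulf_neq0; [exact: IH|exact: qint_neq0].
Qed.

Lemma barQ_qnum m : barQ (qnum m) = qnum m.
Proof.
rewrite /qnum fmorph_div !rmorphB /= !barQ_qX opprK barQ_q fmorphV /= barQ_q invrK.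
by rewrite -[X in X / _]opprB -[X in _ / X]opprB invrN mulrNN.
Qed.

Lemma barQ_qfact a : barQ (qfact a) = qfact a.
Proof.
elim: a => [|a IH]; first by rewrite qfact0 rmorph1.
by rewrite qfactS (rmorphM barQ) /= IH qint_qnum barQ_qnum.
Qed.

Lemma barQ_qfactV a : barQ (qfact a)^-1 = (qfact a)^-1.
Proof. by rewrite fmorphV /= barQ_qfact. Qed.

(** * Laurent polynomials and functions regular at 0 *)

Lemma laurentZ_poly (p : {poly int}) : laurentZ (polyQ (map_poly intr p)).
Proof. by exists p, 0%N; rewrite expr0 invr1 mulr1. Qed.

Lemma laurentZ0 : laurentZ 0.
Proof. by have := laurentZ_poly 0; rewrite !rmorph0. Qed.

Lemma laurentZ1 : laurentZ 1.
Proof. by have := laurentZ_poly 1; rewrite !rmorph1. Qed.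

Lemma laurentZM f g : laurentZ f -> laurentZ g -> laurentZ (f * g).
Proof.
move=> [p [m ->]] [p' [m' ->]]; exists (p * p'), (m + m')%N.
by rewrite !rmorphM /= exprD invfM mulrACA.
Qed.

Lemma laurentZD f g : laurentZ f -> laurentZ g -> laurentZ (f + g).
Proof.
move=> [p [m ->]] [p' [m' ->]]; exists (p * 'X^m' + p' * 'X^m), (m + m')%N.
rewrite !rmorphD !rmorphM /= !map_polyXn !rmorphXn /= -/q exprD invfM.
rewrite mulrDl; congr (_ + _).
  by rewrite mulrACA mulfV ?expf_neq0 ?q_neq0 // mulr1.
by rewrite [_^-1 * _]mulrC mulrACA mulfV ?expf_neq0 ?q_neq0 // mulr1.
Qed.

Lemma laurentZN f : laurentZ f -> laurentZ (- f).
Proof. by move=> [p [m ->]]; exists (- p), m; rewrite !rmorphN mulNr. Qed.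

Lemma laurentZ_qX (z : int) : laurentZ (q ^ z).
Proof.
case: z => n.
  by have := laurentZ_poly 'X^n; rewrite map_polyXn rmorphXn.
by exists 1, n.+1; rewrite !rmorph1 mul1r.
Qed.

Lemma regular0_poly (p : {poly rat}) : regular0 (polyQ p).
Proof. by exists p, 1; rewrite hornerC oner_neq0 rmorph1 divr1. Qed.

Lemma regular0_0 : regular0 0.
Proof. by have := regular0_poly 0; rewrite rmorph0. Qed.

Lemma regular0_1 : regular0 1.
Proof. by have := regular0_poly 1; rewrite rmorph1. Qed.

Lemma regular0D f g : regular0 f -> regular0 g -> regular0 (f + g).
Proof.
move=> [p [d [d0 ->]]] [p' [d' [d0' ->]]].
have nz (e : {poly rat}) : e.[0] != 0 -> e != 0 by apply: contraNneq => ->; rewrite horner0.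
exists (p * d' + p' * d), (d * d'); split; first by rewrite hornerM mulf_neq0.
by rewrite addf_div ?polyQ_eq0 ?nz // -!rmorphM -rmorphD.
Qed.

Lemma regular0N f : regular0 f -> regular0 (- f).
Proof. by move=> [p [d [d0 ->]]]; exists (- p), d; split=> //; rewrite rmorphN mulNr. Qed.

Lemma regular0M f g : regular0 f -> regular0 g -> regular0 (f * g).
Proof.
move=> [p [d [d0 ->]]] [p' [d' [d0' ->]]].
exists (p * p'), (d * d'); split; first by rewrite hornerM mulf_neq0.
by rewrite mulf_div -!rmorphM.
Qed.

(** The denominator b is prime to q, so q^(m+1) divides P and f = q P' with P' a polynomial.
    Bar-invariance then reads P'(q^-1) = q^2 P'(q), which fails for degree reasons unless P' = 0. *)
Lemma bar_laurent_regular0 f r :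
  laurentZ f -> regular0 r -> f = q * r -> barQ f = f -> f = 0.
Proof.
move=> [p [m ->]] [a [b [b0 ->]]]; set P := map_poly _ p => e.
have bn0 : b != 0 by apply: contraNneq b0 => ->; rewrite horner0.
have e1 : P * b = 'X^(m.+1) * a.
  apply: polyQ_inj; rewrite !rmorphM rmorphXn /= -/q.
  have : polyQ P = q * (polyQ a / polyQ b) * q ^+ m.
    by rewrite -e divfK // expf_neq0 // q_neq0.
  move=> ->; rewrite exprS; set x := polyQ a; set y := polyQ b.
  have y0 : y != 0 by rewrite polyQ_eq0.
  rewrite mulrA [_ * _ * y]mulrAC divfK //; ring.
have /dvdpP[P' eP] : 'X^(m.+1) %| P.
  have cop : coprimep 'X^(m.+1) b; last first.
    by rewrite -(Gauss_dvdpl _ cop) e1 dvdp_mulr.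
  apply: coprimep_expl; rewrite coprimep_sym -['X]subr0 -(rmorph0 polyC).
  by rewrite coprimep_XsubC /root.
rewrite eP (rmorphM polyQ) (rmorphXn polyQ) /= -/q exprS mulrA (mulfK (expf_neq0 m q_neq0)).
rewrite (rmorphM barQ) /= barQ_q barQ_poly => e2.
have [->|nP'] := eqVneq P' 0; first by rewrite rmorph0 mul0r.
exfalso; have [s sP] : exists s, size P' = s.+1.
  by exists (size P').-1; rewrite prednK // size_poly_gt0.
have := @eval_qV_rev P' s; rewrite sP leqnn => /(_ isT).
have -> : eval_qV P' = polyQ P' * q ^+ 2.
  apply: (mulIf (invr_neq0 q_neq0)); rewrite e2 expr2 !mulrA mulfK ?q_neq0 //.
(* In degree 0 the left side, a multiple of q^2, vanishes, while the reversal of P' contributes its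
   leading coefficient. *)
rewrite -!rmorphXn -!rmorphM => /polyQ_inj /polyP /(_ 0%N) /=.
rewrite coef_sum big_ord_recr /= big1 => [|i _]; last first.
  rewrite coefZ coefXn; case: eqP => //; last by rewrite mulr0.
  by have := ltn_ord i; move: (nat_of_ord i) => k; lia.
rewrite add0r subnn expr0 coefZ coef1 mulr1 mulrA coefMXn /=.
have -> : P'`_s = lead_coef P' by rewrite lead_coefE sP.
by move/esym/eqP; rewrite lead_coef_eq0 (negPf nP').
Qed.

(** * Gaussian binomials with integer upper index *)

(* Here [n] may be negative. *)
Definition qbinom (n : int) (t : nat) : Qq :=
  (\prod_(s < t) qnum (n - s%:Z)) / qfact t.

Lemma qbinom0 n : qbinom n 0 = 1.
Proof. by rewrite /qbinom big_ord0 qfact0 divr1. Qed.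

Lemma qbinomSr n t : qbinom n t.+1 = qbinom n t * qnum (n - t%:Z) / qint t.+1.
Proof. by rewrite /qbinom big_ord_recr /= qfactS invfM mulrACA !mulrA. Qed.

Lemma qbinomSl n t : qbinom (n + 1) t.+1 = qnum (n + 1) * qbinom n t / qint t.+1.
Proof.
rewrite /qbinom big_ord_recl /= qfactS invfM subr0.
rewrite (eq_bigr (fun i : 'I_t => qnum (n - i%:Z))) => [|i _].
  by rewrite !mulrA.
congr qnum; rewrite /bump leq0n add1n -addn1 PoszD; ring.
Qed.

Lemma qnum_add (a b : int) : qnum (a + b) = q ^ b * qnum a + q ^ (- a) * qnum b.
Proof.
rewrite /qnum !mulrA -mulrDl; congr (_ / _).
by rewrite opprD !qD; ring.
Qed.

(** Stated for variables of an abstract field, so that [field] does not meet the concrete fraction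
    field. *)
Fact pascal_field (K : fieldType) (a b c d x : K) :
  x != 0 -> (c * a + d * x) * b / x = c * (b * a / x) + d * b.
Proof. by move=> nz; field. Qed.

(** Splitting n + 1 as (n - t) + (t + 1) in [qnum_add] gives the q-Pascal rule, for negative n
    too. *)
Lemma qbinom_pascal n t :
  qbinom (n + 1) t.+1 = q ^ t.+1%:Z * qbinom n t.+1 + q ^ (t%:Z - n) * qbinom n t.
Proof.
have nz : qint t.+1 != 0 by exact: qint_neq0.
rewrite qbinomSl qbinomSr.
have -> : qnum (n + 1) = q ^ t.+1%:Z * qnum (n - t%:Z) + q ^ (t%:Z - n) * qint t.+1.
  rewrite qint_qnum -[t%:Z - n]opprB -qnum_add; congr qnum; lia.
move: (qint t.+1) nz => x nz.
exact: (pascal_field (qnum _) (qbinom n t) (q ^ _) (q ^ _) nz).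
Qed.

Lemma qbinomn (n : nat) : qbinom n n = 1.
Proof.
elim: n => [|n IH]; first exact: qbinom0.
rewrite -addn1 PoszD addn1 qbinomSl IH mulr1 qint_qnum -addn1 PoszD divff //.
by rewrite -PoszD -qint_qnum addn1 qint_neq0.
Qed.

(** For lower index t + 1, induction on n runs in both directions from n = 0, where the product
    contains [0]; Pascal's rule is solved for its value at n + 1 or at n. *)
Lemma laurentZ_qbinom n t : laurentZ (qbinom n t).
Proof.
elim: t n => [n|t IH]; first by rewrite qbinom0; apply: laurentZ1.
have b0 : laurentZ (qbinom 0 t.+1).
  by rewrite /qbinom big_ord_recl subr0 qnum0 !mul0r; apply: laurentZ0.
elim/int_rec => [|n IHn|n IHn]; first exact: b0.
  rewrite -addn1 PoszD qbinom_pascal; apply: laurentZD; apply: laurentZM => //;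
    exact: laurentZ_qX.
have := qbinom_pascal (- n.+1%:Z) t.
have -> : - n.+1%:Z + 1 = - n%:Z by lia.
move=> e; have -> : qbinom (- n.+1%:Z) t.+1 =
   q ^ (- t.+1%:Z) * (qbinom (- n%:Z) t.+1
     + - (q ^ (t%:Z - (- n.+1%:Z)) * qbinom (- n.+1%:Z) t)).
  by rewrite e addrK mulrA -qD addNr expr0z mul1r.
apply: laurentZM; first exact: laurentZ_qX.
apply: laurentZD => //; apply: laurentZN; apply: laurentZM => //; exact: laurentZ_qX.
Qed.

Fact qnum_field (K : fieldType) (x y z w : K) :
  x != 0 -> y != 0 -> z != 0 -> w != 0 ->
  (x * z^-1 - x^-1 * z) / w * ((y * z^-1 - y^-1 * z) / w)
   + (z - z^-1) / w * ((x * y * z^-1 - (x^-1 * y^-1) * z) / w)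
  = (y - y^-1) / w * ((x - x^-1) / w).
Proof. by move=> *; field; apply/and4P. Qed.

Fact commutation_field (K : fieldType) (a b c d e x : K) :
  x != 0 -> a * b + x * c = d ->
  e * a / x * b + e * c = d * e / x.
Proof. by move=> nz <-; field. Qed.

(* The coefficient recursion behind [E_i^(a) F_i^(b)], see [Ed_Fd]. *)
Lemma qbinom_commutation (n : int) (a t : nat) :
  qbinom n t.+1 * qnum (a%:Z - t%:Z) + qbinom n t * qnum (n + a%:Z + 1 - t%:Z)
  = qint a.+1 * qbinom (n + 1) t.+1.
Proof.
have nz : qint t.+1 != 0 by exact: qint_neq0.
rewrite qbinomSr.
have e : qnum (n - t%:Z) * qnum (a%:Z - t%:Z) + qint t.+1 * qnum (n + a%:Z + 1 - t%:Z)
    = qint a.+1 * qnum (n + 1).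
  rewrite !qint_qnum -(addn1 t) -(addn1 a) !PoszD.
  have -> : n - t%:Z = n + 1 - (t%:Z + 1) by ring.
  have -> : a%:Z - t%:Z = a%:Z + 1 - (t%:Z + 1) by ring.
  have -> : n + a%:Z + 1 - t%:Z = (n + 1) + (a%:Z + 1) - (t%:Z + 1) by ring.
  (* After generalization the powers of q with exponents i, j and k are independent, and a rational
     identity remains. *)
  move: (n + 1) (a%:Z + 1) (t%:Z + 1) => i j k.
  rewrite /qnum !opprD !opprK !qD -!(invr_expz q).
  exact: (qnum_field (qX_neq0 i) (qX_neq0 j) (qX_neq0 k) qBqV_neq0).
rewrite qbinomSl mulrA mulrA; exact: (commutation_field _ nz e).
Qed.

(** * Rows *)

Section Rows.

Variable s : int.
Implicit Types (b : row_of s) (i j y : int).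

Lemma mem_row_funP b y : reflect (exists k : nat, b k = y) (y \in b).
Proof. exact: asboolP. Qed.

Lemma row_fun_lt b k k' : (k < k')%N -> b k' < b k.
Proof. by have [h _] := Defs.rowP b; exact: h. Qed.

Lemma row_fun_le b k k' : (k <= k')%N -> b k' <= b k.
Proof. by rewrite leq_eqVlt => /predU1P[->//|/(row_fun_lt b)/ltW]. Qed.

Lemma row_fun_inj b : injective b.
Proof.
by move=> k k' e; case: (ltngtP k k') => // /(row_fun_lt b); rewrite e ltxx.
Qed.

Lemma row_fun_vac b : exists N : nat, forall k : nat, (N <= k)%N -> b k = s - k%:Z.
Proof. by case: (Defs.rowP b). Qed.

(** Far down the entry is in vacuum position, and each step towards the top increases it by at least
    one. *)
Lemma row_ge b k : s - k%:Z <= b k.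
Proof.
have [N bN] := row_fun_vac b.
have [d] : exists d, (N <= k + d)%N by exists N; rewrite leq_addl.
elim: d k => [|d IH] k; first by rewrite addn0 => /bN ->.
rewrite addnS -addSn => /IH; have := row_fun_lt b (ltnSn k); lia.
Qed.

(** The k-th entry from the top is the largest value not among the k entries before it, so strong
    induction on k recovers the sequence from the set. *)
Lemma row_ext b b' : b =i b' -> b = b'.
Proof.
move=> e; apply: val_inj; apply/funext => k /=.
have H (c c' : row_of s) n : c =i c' -> (forall m, (m < n)%N -> c m = c' m) -> c n <= c' n.
  move=> ee IH.
  have /mem_row_funP[m em] : c n \in c' by rewrite -ee; apply/mem_row_funP; exists n.
  rewrite -em; apply: row_fun_le; rewrite leqNgt; apply/negP => mn.
  by move: em; rewrite -IH // => /row_fun_inj em; rewrite em ltnn in mn.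
elim/ltn_ind: k => k IH; apply/eqP; rewrite eq_le (H _ _ _ e IH) /=.
by apply: H => [y|m mk]; rewrite ?e ?IH.
Qed.

Definition addable i b := (i \in b) && (i + 1 \notin b).
Definition removable i b := (i \notin b) && (i + 1 \in b).

Lemma mem_raise i b y : addable i b ->
  (y \in raise_entry b i) = (y == i + 1) || (y \in b) && (y != i).
Proof.
case/andP => /mem_row_funP[k0 bk0] ni1.
apply/mem_row_funP/idP => [[k]|].
  rewrite raise_entryE //; case: (eqVneq (b k) i) => [_ <-|ne <-]; first by rewrite eqxx.
  by rewrite ne andbT; apply/orP; right; apply/mem_row_funP; exists k.
case/predU1P => [->|/andP[/mem_row_funP[k <-] ne]].
  by exists k0; rewrite raise_entryE // bk0 eqxx.
by exists k; rewrite raise_entryE // (negPf ne).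
Qed.

(** The default of [insubd] is not reached when i is not an entry of b, which [removable i b]
    guarantees. *)
Definition lower_entry b i : row_of s :=
  insubd b (fun k : nat => if b k == i + 1 then i else b k).

Lemma lower_entryE b i k :
  i \notin b -> lower_entry b i k = if b k == i + 1 then i else b k.
Proof.
move=> ni; have nb m : b m != i by apply: contra ni => /eqP <-; apply/mem_row_funP; exists m.
rewrite /lower_entry insubdK //; apply/asboolP; split=> [m m' mm'|].
  have lt_b := row_fun_lt b mm'; have nm := nb m; have nm' := nb m'.
  by case: ifP => ?; case: ifP => ?; lia.
have [N bN] := row_fun_vac b; exists (maxn N (`|s - i|%N).+1) => m Mm.
rewrite bN; last by lia.
by case: eqP; lia.
Qed.

Lemma mem_lower i b y : removable i b ->
  (y \in lower_entry b i) = (y == i) || (y \in b) && (y != i + 1).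
Proof.
case/andP => ni /mem_row_funP[k0 bk0].
apply/mem_row_funP/idP => [[k]|].
  rewrite lower_entryE //; case: (eqVneq (b k) (i + 1)) => [_ <-|ne <-]; first by rewrite eqxx.
  by rewrite ne andbT; apply/orP; right; apply/mem_row_funP; exists k.
case/predU1P => [->|/andP[/mem_row_funP[k <-] ne]].
  by exists k0; rewrite lower_entryE // bk0 eqxx.
by exists k; rewrite lower_entryE // (negPf ne).
Qed.

Lemma removable_raise i b : addable i b -> removable i (raise_entry b i).
Proof.
move=> h; rewrite /removable !mem_raise // !eqxx andbF orbF andbT; lia.
Qed.

Lemma addable_lower i b : removable i b -> addable i (lower_entry b i).
Proof.
move=> h; rewrite /addable !mem_lower // !eqxx andbF orbF /=; lia.
Qed.

Lemma raiseK i b : addable i b -> lower_entry (raise_entry b i) i = b.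
Proof.
move=> h; apply: row_ext => y; rewrite mem_lower ?removable_raise // mem_raise //.
case/andP: h => hi hi1; case: (eqVneq y i) => [->//|yi] /=.
by case: (eqVneq y (i + 1)) => [->|_]; rewrite ?andbF ?andbT //= (negPf hi1).
Qed.

Lemma removableNaddable i b : removable i b -> addable i b = false.
Proof. by rewrite /addable => /andP[/negPf ->]. Qed.

Lemma addable_mem i b y : addable i b ->
  (y \in raise_entry b i) = if y == i then false else if y == i + 1 then true else y \in b.
Proof.
move=> h; rewrite mem_raise //; case: (eqVneq y i) => [->|_]; last by rewrite andbT; case: eqP.
by rewrite andbF orbF; lia.
Qed.

Lemma addable_lower_far i j b : removable j b -> i != j -> i + 1 != j -> j + 1 != i ->
  addable i (lower_entry b j) = addable i b.
Proof.
move=> h h1 h2 h3; rewrite /addable !mem_lower //.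
have -> : (i == j) = false by lia.
have -> : (i == j + 1) = false by lia.
have -> : (i + 1 == j) = false by lia.
have -> : (i + 1 == j + 1) = false by lia.
by rewrite !andbT.
Qed.

Lemma removable_raise_far i j b : addable j b -> i != j -> i + 1 != j -> j + 1 != i ->
  removable i (raise_entry b j) = removable i b.
Proof.
move=> h h1 h2 h3; rewrite /removable !addable_mem //.
have -> : (i == j) = false by lia.
have -> : (i == j + 1) = false by lia.
have -> : (i + 1 == j) = false by lia.
by have -> : (i + 1 == j + 1) = false by lia.
Qed.

Lemma lowerK i b : removable i b -> raise_entry (lower_entry b i) i = b.
Proof.
move=> h; apply: row_ext => y; rewrite mem_raise ?addable_lower // mem_lower //.
case/andP: h => hi hi1; case: (eqVneq y (i + 1)) => [->//|yi] /=.
by case: (eqVneq y i) => [->|_]; rewrite ?andbF ?andbT //= (negPf hi).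
Qed.

Definition vac : row_of s := Row (empty_proof s).

Lemma mem_vac y : (y \in vac) = (y <= s).
Proof.
apply/mem_row_funP/idP => /= [[k <-]|ys]; first by lia.
by exists `|s - y|%N; lia.
Qed.

(** The lowest misplaced entry can be lowered: it lies strictly above its vacuum position and all
    entries below it are in theirs, so the next smaller integer is missing. *)
Lemma row_neq_vac_removable b : b <> vac -> exists i, removable i b.
Proof.
move=> nb; have [N bN] := row_fun_vac b.
have [k0 nk0] : exists k, b k != s - k%:Z.
  apply: contrapT => H; apply: nb; apply: val_inj; apply/funext => k /=.
  by apply/eqP; apply: contrapT => h; apply: H; exists k; apply/negP.
have ub k : b k != s - k%:Z -> (k <= N)%N.
  by apply: contraNleq => /ltnW/bN ->.
case: (ex_maxnP (ex_intro _ k0 nk0) ub) => k nk kmax.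
exists (b k - 1); rewrite /removable subrK; apply/andP; split; last first.
  by apply/mem_row_funP; exists k.
apply/negP => /mem_row_funP[m em].
have km : (k < m)%N by rewrite ltnNge; apply/negP => /(row_fun_le b); lia.
have /eqP bm : b m == s - m%:Z by apply/negPn/negP => /kmax; lia.
have := row_ge b k; lia.
Qed.

Definition row_size b : int := \sum_(j \in [set j : int | j <= s]) (entry b j - j).

Lemma row_sizeE b (N : nat) : (forall k, (N <= k)%N -> b k = s - k%:Z) ->
  row_size b = \sum_(k < N) (b k - (s - k%:Z)).
Proof.
move=> bN; rewrite /row_size.
rewrite (@reindex_fsbig _ _ _ _ _ (fun k : nat => s - k%:Z) setT); last first.
  split=> [k _|k k' _ _|j /= js] /=; [lia|lia|].
  by exists `|s - j|%N => //; lia.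
rewrite (@fsbig_ord _ _ _ N (fun k : nat => b k - (s - k%:Z))); apply/esym; rewrite (fsbig_widen _ setT) //= => [|k [_ /=]].
  by apply: eq_fsbigr => k _; rewrite /entry; congr (b _ - _); lia.
by rewrite ltnNge /= => /negP; rewrite negbK => /bN ->; rewrite subrr.
Qed.

Lemma row_size_vac : row_size vac = 0.
Proof. by rewrite (@row_sizeE _ 0%N) ?big_ord0. Qed.

Lemma row_size_ge0 b : 0 <= row_size b.
Proof.
have [N bN] := row_fun_vac b; rewrite (row_sizeE bN); apply: sumr_ge0 => k _.
by rewrite subr_ge0 row_ge.
Qed.

Lemma row_size_raise i b : addable i b -> row_size (raise_entry b i) = row_size b + 1.
Proof.
move=> /andP[hi hi1].
have [N bN] := row_fun_vac b; have [N' bN'] := row_fun_vac (raise_entry b i).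
have [k0 bk0] : exists k, b k = i by apply/mem_row_funP.
pose M := maxn k0.+1 (maxn N N').
rewrite (@row_sizeE b M) => [|k hk]; last by apply: bN; rewrite /M in hk; lia.
rewrite (@row_sizeE _ M) => [|k hk]; last by apply: bN'; rewrite /M in hk; lia.
have k0M : (k0 < M)%N by rewrite /M; lia.
rewrite (bigD1 (Ordinal k0M)) //= [in RHS](bigD1 (Ordinal k0M)) //=.
rewrite raise_entryE // bk0 eqxx [in RHS]addrAC; congr (_ + _); first by lia.
apply: eq_bigr => k /negP kk; rewrite raise_entryE //.
case: eqP => // e; exfalso; apply: kk; apply/eqP/ord_inj => /=.
by apply: (@row_fun_inj b); rewrite e bk0.
Qed.

Definition rsz b : nat := `|row_size b|%N.

Lemma rsz_vac : rsz vac = 0%N.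
Proof. by rewrite /rsz row_size_vac. Qed.

Lemma rsz_raise i b : addable i b -> rsz (raise_entry b i) = (rsz b).+1.
Proof. by move=> h; rewrite /rsz row_size_raise //; have := row_size_ge0 b; lia. Qed.

Lemma rsz_lower i b : removable i b -> rsz b = (rsz (lower_entry b i)).+1.
Proof. by move=> h; rewrite -(rsz_raise (addable_lower h)) lowerK. Qed.

Lemma row_bounds b : exists N : nat,
  (forall y, y <= - N%:Z -> y \in b) /\ (forall y, N%:Z < y -> y \notin b).
Proof.
have [N bN] := row_fun_vac b; exists (N + `|s| + `|b 0%N|)%N; split=> y hy.
  by apply/mem_row_funP; exists `|s - y|%N; rewrite bN; lia.
by apply/negP => /mem_row_funP[k e]; have := row_fun_le b (leq0n k); lia.
Qed.

(** The exponent of q by which K_i acts on a row in the level-one module. *)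
Definition kap i b : int := (i \in b)%:Z - (i + 1 \in b)%:Z.

Lemma kap_addable i b : addable i b -> kap i b = 1.
Proof. by rewrite /kap => /andP[-> /negPf ->]. Qed.

Lemma kap_removable i b : removable i b -> kap i b = -1.
Proof. by rewrite /kap => /andP[/negPf -> ->]. Qed.

Lemma shift_proof b : `[< is_row (s - 1) (fun k => b k - 1) >].
Proof.
apply/asboolP; split=> [k k' kk'|]; first by rewrite ltrD2r row_fun_lt.
by have [N bN] := row_fun_vac b; exists N => k /bN ->; lia.
Qed.

Definition shift_row b : row_of (s - 1) := Row (shift_proof b).

End Rows.

Arguments vac s : clear implicits.

Lemma mem_shift_row s (b : row_of s) y : (y \in shift_row b) = (y + 1 \in b).
Proof.
apply/mem_row_funP/mem_row_funP => /= -[k e]; exists k; lia.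
Qed.

Lemma insert_row s (x : int) (b : row_of (s - 1)) : x \notin b ->
  exists b' : row_of s, forall y, (y \in b') = (y == x) || (y \in b).
Proof.
move=> nx; have nb k : b k != x by apply: contra nx => /eqP <-; apply/mem_row_funP; exists k.
(* Entries above x stay in place, the first position not above x receives x, and the remaining
   entries move down by one, as the charge grows by one. *)
pose f k := if x < b k then b k else if k is k'.+1 then (if x < b k' then x else b k') else x.
have fP : `[< is_row s f >].
  apply/asboolP; split=> [k k' kk'|].
    rewrite /f; case: k' kk' => // k' kk'.
    have h1 := row_fun_lt b kk'; have h2 := row_fun_le b kk'; rewrite -ltnS in kk'.
    have h3 := row_fun_lt b (ltnSn k'); have := nb k; have := nb k'; have := nb k'.+1.
    case: k kk' h1 h2 => [|k] kk' h1 h2.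
      have h4 := row_fun_le b (leq0n k').
      by do ?(case: ifP => ?); lia.
    have h4 : b k' <= b k.+1 by apply: row_fun_le; lia.
    have := row_fun_lt b (ltnSn k); have := nb k.
    by do ?(case: ifP => ?); lia.
  have [N bN] := row_fun_vac b; exists (N + `|s| + `|x|).+2%N => k hk.
  case: k hk => // k hk; rewrite /f !bN; try lia.
  by do ?(case: ifP => ?); lia.
exists (Row fP) => y; apply/mem_row_funP/idP => [[k <-] /=|].
  rewrite /f; case: ltP => _; first by apply/orP; right; apply/mem_row_funP; exists k.
  case: k => [|k]; rewrite ?eqxx //; case: ltP => _; rewrite ?eqxx //.
  by apply/orP; right; apply/mem_row_funP; exists k.
case/predU1P => [->|/mem_row_funP[k <-]] /=; last first.
  have [xk|kx] := ltP x (b k); first by exists k; rewrite /f xk.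
  by exists k.+1; rewrite /f; have := row_fun_lt b (ltnSn k); do ?(case: ifP => ?); lia.
have [N bN] := row_fun_vac b.
have ex : exists k, b k < x by exists (N + `|s| + `|x| + 1)%N; rewrite bN; lia.
case: (ex_minnP ex) => k kx kmin; exists k; rewrite /f.
case: k kx kmin => [|k] kx kmin; first by case: ltP; lia.
by have := nb k; have := kmin k; do ?(case: ifP => ?); lia.
Qed.

(** * Free modules, supports and linear extension *)

(* The free module with basis [I]; [fock v] is the instance [malg_freeMod v]. *)
Record freeMod (K : fieldType) (I : choiceType) := FreeMod {
  fm_sort :> lmodType K;
  fm_basis : I -> fm_sort;
  fm_coef : I -> fm_sort -> K;
  fm_supp : fm_sort -> {fset I};
  fm_coefD : forall k u w, fm_coef k (u + w) = fm_coef k u + fm_coef k w;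
  fm_coefZ : forall k c u, fm_coef k (c *: u) = c * fm_coef k u;
  fm_coef_basis : forall k k', fm_coef k (fm_basis k') = (k' == k)%:R;
  fm_suppP : forall u k, (k \in fm_supp u) = (fm_coef k u != 0);
  fm_ext : forall u w, (forall k, fm_coef k u = fm_coef k w) -> u = w }.

Arguments fm_basis {K I f}.
Arguments fm_coef {K I f}.
Arguments fm_supp {K I f}.

Section FreeModule.

Variables (K : fieldType) (I : choiceType) (M : freeMod K I).

Lemma fm_coef0 k : fm_coef k (0 : M) = 0.
Proof. by rewrite -(scale0r 0) fm_coefZ mul0r. Qed.

Lemma fm_coef_sum (J : Type) (r : seq J) (P : pred J) (f : J -> M) k :
  fm_coef k (\sum_(j <- r | P j) f j) = \sum_(j <- r | P j) fm_coef k (f j).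
Proof.
by elim/big_rec2: _ => [|j x y _ <-]; rewrite ?fm_coef0 ?fm_coefD.
Qed.

Lemma fm_coefN k (u : M) : fm_coef k (- u) = - fm_coef k u.
Proof. by rewrite -scaleN1r fm_coefZ mulN1r. Qed.

Lemma fm_expandw (u : M) (d : {fset I}) : (fm_supp u `<=` d)%fset ->
  u = \sum_(k <- d) fm_coef k u *: fm_basis k.
Proof.
move=> ud; apply: fm_ext => k; rewrite fm_coef_sum.
have H k' : fm_coef k (fm_coef k' u *: fm_basis k' : M) = if k' == k then fm_coef k u else 0.
  by rewrite fm_coefZ fm_coef_basis; case: eqP => [->|]; rewrite ?mulr1 ?mulr0.
under eq_bigr => k' _ do rewrite H.
have [kd|kd] := boolP (k \in d); last first.
  rewrite big1_fset => [|k' k'd _]; last by case: eqP k'd kd => // -> ->.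
  apply/eqP; rewrite -[_ == _]negbK -fm_suppP; apply: contra kd.
  by move/fsubsetP: ud; apply.
rewrite (big_fsetD1 k) //= eqxx big1_fset ?addr0 // => k'.
by rewrite in_fsetD1 => /andP[/negPf ->].
Qed.

Lemma fm_expand (u : M) : u = \sum_(k <- fm_supp u) fm_coef k u *: fm_basis k.
Proof. exact: fm_expandw. Qed.

Lemma fm_ind (P : M -> Prop) :
  P 0 -> (forall c u w, P u -> P w -> P (c *: u + w)) ->
  (forall k, P (fm_basis k)) -> forall u, P u.
Proof.
move=> h0 hD hU u; rewrite [u]fm_expand; elim/big_rec: _ => [//|k w _ Pw].
exact: hD.
Qed.

Definition supported (P : I -> Prop) (u : M) := forall k, fm_coef k u != 0 -> P k.

Lemma supported0 P : supported P 0.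
Proof. by move=> k; rewrite fm_coef0 eqxx. Qed.

Lemma supported_lin P c u w : supported P u -> supported P w -> supported P (c *: u + w).
Proof.
move=> hu hw k; rewrite fm_coefD fm_coefZ.
case: (eqVneq (fm_coef k u) 0) => [->|/hu //].
by rewrite mulr0 add0r => /hw.
Qed.

Lemma supportedD P u w : supported P u -> supported P w -> supported P (u + w).
Proof. by move=> hu hw; rewrite -[u]scale1r; apply: supported_lin. Qed.

Lemma supportedZ P c u : supported P u -> supported P (c *: u).
Proof. by move=> hu; rewrite -[c *: u]addr0; apply: supported_lin => //; apply: supported0. Qed.

Lemma supportedB P u w : supported P u -> supported P w -> supported P (u - w).
Proof. by move=> hu hw; rewrite -scaleN1r; apply: supportedD => //; apply: supportedZ. Qed.

Lemma supported_basis (P : I -> Prop) k : P k -> supported P (fm_basis k).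
Proof. by move=> h k'; rewrite fm_coef_basis; case: (eqVneq k k') => [<-//|]; rewrite eqxx. Qed.

Lemma supported_sub (P Q : I -> Prop) u : (forall k, P k -> Q k) -> supported P u -> supported Q u.
Proof. by move=> PQ hu k /hu; apply: PQ. Qed.

Lemma supported_ind (P : I -> Prop) (Q : M -> Prop) :
  Q 0 -> (forall c u w, Q u -> Q w -> Q (c *: u + w)) ->
  (forall k, P k -> Q (fm_basis k)) -> forall u, supported P u -> Q u.
Proof.
move=> h0 hD hU u lu; rewrite [u]fm_expand big_seq; elim/big_rec: _ => [//|k w + Pw].
by rewrite fm_suppP => /lu lk; apply: hD => //; apply: hU.
Qed.

Variable W : lmodType K.

Definition mlin (phi : I -> W) (u : M) : W := \sum_(k <- fm_supp u) fm_coef k u *: phi k.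

Lemma mlinEw (phi : I -> W) (u : M) (d : {fset I}) :
  (fm_supp u `<=` d)%fset -> mlin phi u = \sum_(k <- d) fm_coef k u *: phi k.
Proof.
move=> ud; rewrite /mlin; apply: big_fset_incl => // k kd.
by rewrite fm_suppP negbK => /eqP ->; rewrite scale0r.
Qed.

Lemma mlin_is_linear phi : linear (mlin phi).
Proof.
move=> c u w; pose d := (fm_supp u `|` fm_supp w `|` fm_supp (c *: u + w))%fset.
rewrite !(@mlinEw _ _ d) /d ?fsubsetUr // -1?fsetUA ?fsubsetUl //; last first.
  by rewrite fsetUCA fsubsetUl.
rewrite scaler_sumr -big_split /=; apply: eq_bigr => k _.
by rewrite fm_coefD fm_coefZ scalerDl scalerA.
Qed.
HB.instance Definition _ phi :=
  GRing.isLinear.Build K M W *:%R (mlin phi) (mlin_is_linear phi).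

Lemma mlin_basis phi k : mlin phi (fm_basis k) = phi k.
Proof.
rewrite (@mlinEw _ _ [fset k]%fset) ?big_seq_fset1 ?fm_coef_basis ?eqxx ?scale1r //.
apply/fsubsetP => k'; rewrite fm_suppP fm_coef_basis inE [k' == k]eq_sym.
by case: (k == k') => //; rewrite eqxx.
Qed.

End FreeModule.

Section Restriction.

Variables (K : fieldType) (I : choiceType) (M : freeMod K I).

Definition restrict (P : I -> Prop) : M -> M :=
  mlin (fun k => if `[< P k >] then fm_basis k else 0).
HB.instance Definition _ P := GRing.Linear.on (restrict P).

Lemma coef_restrict P k (u : M) : fm_coef k (restrict P u) = if `[< P k >] then fm_coef k u else 0.
Proof.
elim/fm_ind: u => [|c u w hu hw|k']; first by rewrite linear0 fm_coef0 if_same.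
  by rewrite linearP /= !(fm_coefD, fm_coefZ) hu hw; case: asboolP => _ //; rewrite mulr0 addr0.
rewrite /restrict mlin_basis; case: (eqVneq k' k) => [->|kk].
  by case: asboolP => // _; rewrite fm_coef0.
rewrite [in RHS]fm_coef_basis (negPf kk) if_same.
by case: asboolP => _; rewrite ?fm_coef0 // fm_coef_basis (negPf kk).
Qed.

Lemma restrict_supported (P Q : I -> Prop) (u : M) : supported Q u ->
  (forall k, Q k -> P k) -> restrict P u = u.
Proof.
move=> hu QP; apply: fm_ext => k; rewrite coef_restrict; case: asboolP => // nP.
by apply/esym/eqP/negPn/negP => /hu/QP.
Qed.

Lemma restrict_disjoint (P Q : I -> Prop) (u : M) : supported Q u ->
  (forall k, Q k -> ~ P k) -> restrict P u = 0.
Proof.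
move=> hu QP; apply: fm_ext => k; rewrite coef_restrict fm_coef0; case: asboolP => // hP.
by apply/eqP/negPn/negP => /hu/QP.
Qed.

End Restriction.

(** * Passing the Serre relations through one more tensor factor *)

Section SerreChain.

Variables (K : fieldType) (I : Type) (M : lmodType K) (x : K).
Variable coef : I -> M -> K.
Hypothesis coefD : forall T u w, coef T (u + w) = coef T u + coef T w.
Hypothesis coefZ : forall T c u, coef T (c *: u) = c * coef T u.
Hypothesis coefP : forall u w, (forall T, coef T u = coef T w) -> u = w.

(** The quantum Serre relation for adjacent indices, with x + x^-1 = [2]. Its pointwise form lets it
    pass from u to the vectors obtained by adding a row to u. *)
Definition serre (A B : M -> M) (u : M) : Prop :=
  A (A (B u)) + B (A (A u)) = (x + x^-1) *: A (B (A u)).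

Variables (A B A' B' h0 h1 h2 : M -> M).
Hypothesis x0 : x != 0.
Hypothesis lA : linear A'.
Hypothesis lB : linear B'.
Hypothesis l0 : linear h0.
Hypothesis l1 : linear h1.
Hypothesis l2 : linear h2.

Let linD (f : M -> M) : linear f -> {morph f : u w / u + w}.
Proof. by move=> lf u w; have := lf 1 u w; rewrite !scale1r. Qed.

Let lin0 (f : M -> M) : linear f -> f 0 = 0.
Proof. by move=> lf; apply: (addIr (f 0)); rewrite -(linD lf) !add0r. Qed.

Let linZ (f : M -> M) : linear f -> forall c u, f (c *: u) = c *: f u.
Proof. by move=> lf c u; have := lf c u 0; rewrite (lin0 lf) !addr0. Qed.

Let lin' := (linD lA, linZ lA, linD lB, linZ lB, linD l0, linZ l0, linD l1,
  linZ l1, linD l2, linZ l2).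

(** On the image of h0 the new operators act through the old ones up to the scalars a and b, so the
    whole relation is multiplied by a^2 b. *)
Lemma serre_scaled (a b : K) u :
  (forall m, A' (h0 m) = a *: h0 (A m)) -> (forall m, B' (h0 m) = b *: h0 (B m)) ->
  serre A B u -> serre A' B' (h0 u).
Proof.
rewrite /serre => eA eB s; rewrite !(eA, eB, lin') /= !scalerA.
apply: coefP => T; have := congr1 (fun y => coef T (h0 y)) s.
rewrite /= !lin' /= !(coefD, coefZ).
move=> /(canRL (addrK _)) e.
by ring: e.
Qed.

Hypothesis A0 : forall m, A' (h0 m) = x *: h0 (A m) + h1 m.
Hypothesis B0 : forall m, B' (h0 m) = h0 (B m).
Hypothesis A1 : forall m, A' (h1 m) = x^-1 *: h1 (A m).
Hypothesis B1 : forall m, B' (h1 m) = x *: h1 (B m) + h2 m.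
Hypothesis A2 : forall m, A' (h2 m) = h2 (A m).
Hypothesis B2 : forall m, B' (h2 m) = x^-1 *: h2 (B m).

(** Here h0, h1, h2 stand for inserting a row, the row after one raise and after two; A causes the
    first raise, B the second, and x, 1, x^-1 are the values of K. In the expansion the component of
    the initial insertion is a multiple of the given relation, and the other components cancel by x
    x^-1 = 1. *)
Lemma serre_chain u : serre A B u -> serre B A u ->
  [/\ serre A' B' (h0 u), serre B' A' (h0 u), serre A' B' (h1 u) & serre B' A' (h1 u)].
Proof.
have e2 : x * x^-1 = 1 by rewrite mulfV.
rewrite /serre => s s'; split;
  rewrite !(A0, B0, A1, B1, A2, B2, lin') /= ?scalerA; apply: coefP => T.
- have := congr1 (fun y => coef T (h0 y)) s.
  rewrite /= !lin' /= !(coefD, coefZ).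
  move: (x^-1) e2 => y e2 /(canRL (addrK _)) e.
  by ring: e e2.
- have := congr1 (fun y => coef T (h0 y)) s'.
  rewrite /= !lin' /= !(coefD, coefZ).
  move: (x^-1) e2 => y e2 /(canRL (addrK _)) e.
  by ring: e e2.
- have := congr1 (fun y => coef T (h1 y)) s.
  rewrite /= !lin' /= !(coefD, coefZ).
  move: (x^-1) e2 => y e2 /(canRL (addrK _)) e.
  by ring: e e2.
- have := congr1 (fun y => coef T (h1 y)) s'.
  rewrite /= !lin' /= !(coefD, coefZ).
  move: (x^-1) e2 => y e2 /(canRL (addrK _)) e.
  by ring: e e2.
Qed.

End SerreChain.

(** * The Fock space and the Serre relations *)

Section FockModel.

Variables (K : fieldType) (q : K) (l : nat) (v : 'I_l -> int).
Variable W : freeMod K (symbol v).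
Hypothesis q0 : q != 0.
Implicit Types (S T : symbol v) (r : 'I_l) (i j : int) (u w : W) (n : nat).

Local Notation sy S := (fm_basis S : W).

Definition set_row S r (b : row_of (v r)) : symbol v := dfwith S b.

Lemma set_row_in S r (b : row_of (v r)) : set_row S b r = b.
Proof. exact: dfwith_in. Qed.

Lemma set_row_out S r (b : row_of (v r)) k : r != k -> set_row S b k = S k.
Proof. exact: dfwith_out. Qed.

Lemma set_row_set S r (b b' : row_of (v r)) : set_row (set_row S b) b' = set_row S b'.
Proof.
apply: functional_extensionality_dep => k; case: (eqVneq r k) => [<-|rk].
  by rewrite !set_row_in.
by rewrite !set_row_out.
Qed.

Lemma set_rowC S r r' (b : row_of (v r)) (b' : row_of (v r')) : r != r' ->
  set_row (set_row S b) b' = set_row (set_row S b') b.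
Proof.
move=> rr'; apply: functional_extensionality_dep => k; case: (eqVneq r k) => [<-|rk].
  by rewrite set_row_out ?set_row_in // eq_sym.
case: (eqVneq r' k) => [<-|rk'].
  by rewrite set_row_in set_row_out ?set_row_in.
by rewrite !set_row_out.
Qed.

Lemma set_row_id S r : set_row S (S r) = S.
Proof.
apply: functional_extensionality_dep => k; case: (eqVneq r k) => [<-|rk].
  by rewrite set_row_in.
by rewrite set_row_out.
Qed.

Lemma raise_rowE S r i : raise_row S r i = set_row S (raise_entry (S r) i).
Proof.
apply: functional_extensionality_dep => k; rewrite /raise_row.
case: eqP => [->|/eqP kr]; first by rewrite set_row_in.
by rewrite set_row_out // eq_sym.
Qed.

(* [F_i] on the tensor product of the first [n] rows; the rows of index [>= n]
   are spectators. *)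
Definition Fsym n i S : W :=
  \sum_(j < l | (j < n)%N && addable i (S j))
    q ^ (\sum_(k < l | (j < k < n)%N) kap i (S k)) *: sy (raise_row S j i).

Definition Fn n i : W -> W := mlin (Fsym n i).
HB.instance Definition _ n i := GRing.Linear.on (Fn n i).

(** In the tensor product of the rows up to r this is tensoring with b on the right; the former
    content of row r is forgotten. *)
Definition ins r (b : row_of (v r)) : W -> W := mlin (fun S => sy (set_row S b)).
HB.instance Definition _ r (b : row_of (v r)) := GRing.Linear.on (ins b).

Lemma FnU n i S : Fn n i (sy S) = Fsym n i S.
Proof. exact: mlin_basis. Qed.

Lemma insU r (b : row_of (v r)) S : ins b (sy S) = sy (set_row S b).
Proof. exact: mlin_basis. Qed.

Lemma FnD n i u w : Fn n i (u + w) = Fn n i u + Fn n i w.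
Proof. exact: linearD. Qed.
Lemma FnZ n i c u : Fn n i (c *: u) = c *: Fn n i u.
Proof. exact: linearZZ. Qed.
Lemma Fn0 n i : Fn n i 0 = 0.
Proof. exact: linear0. Qed.
Lemma insD r (b : row_of (v r)) u w : ins b (u + w) = ins b u + ins b w.
Proof. exact: linearD. Qed.
Lemma insZ r (b : row_of (v r)) c u : ins b (c *: u) = c *: ins b u.
Proof. exact: linearZZ. Qed.
Lemma ins0 r (b : row_of (v r)) : ins b (0 : W) = 0.
Proof. exact: linear0. Qed.
Definition fockE := (FnD, FnZ, Fn0, insD, insZ, ins0).

Lemma ins_ins r (b b' : row_of (v r)) u : ins b (ins b' u) = ins b u.
Proof.
elim/fm_ind: u => [|c u w eu ew|S]; first by rewrite !ins0.
  by rewrite !fockE eu ew.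
by rewrite !insU set_row_set.
Qed.

Lemma insC r r' (b : row_of (v r)) (b' : row_of (v r')) u : r != r' ->
  ins b (ins b' u) = ins b' (ins b u).
Proof.
move=> rr'; elim/fm_ind: u => [|c u w eu ew|S]; first by rewrite !ins0.
  by rewrite !fockE eu ew.
by rewrite !insU set_rowC // eq_sym.
Qed.

Lemma sy_ins S r : sy S = ins (S r) (sy S).
Proof. by rewrite insU set_row_id. Qed.

(** This is the coproduct sending F_i to F_i tensor K_i plus 1 tensor F_i, with row r as second
    factor. Its linear extension [Fn_ins] drives the inductions on rows. *)
Lemma Fsym_ins r (b : row_of (v r)) i S : Fsym r.+1 i (set_row S b) =
  q ^ kap i b *: ins b (Fsym r i S)
  + (if addable i b then sy (set_row S (raise_entry b i)) else 0).
Proof.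
rewrite /Fsym big_mkcond (bigD1 r) //= addrC; congr (_ + _); last first.
  rewrite ltnSn set_row_in; case: (addable i b) => //=.
  rewrite big_pred0 => [|k]; last by lia.
  by rewrite expr0z scale1r raise_rowE set_row_in set_row_set.
rewrite [in RHS]big_mkcond [in RHS](bigD1 r) //= ltnn /= add0r.
rewrite [in RHS](linear_sum (ins b)) /= scaler_sumr; apply: eq_bigr => j jr.
rewrite set_row_out 1?eq_sym // (_ : (j < r.+1)%N = (j < r)%N); last first.
  by rewrite ltnS leq_eqVlt -[_ == _ :> nat]/(j == r) (negPf jr).
case: ifP => [/andP[jltr _]|_]; last by rewrite ins0 scaler0.
rewrite insZ scalerA -expfzDr // insU; congr (_ *: fm_basis _); last first.
  by rewrite !raise_rowE set_row_out 1?eq_sym // set_rowC // eq_sym.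
congr (q ^ _); rewrite (bigD1 r) /=; last by lia.
rewrite set_row_in; congr (_ + _).
apply: eq_big => [k|k /andP[_ kr]]; last by rewrite set_row_out 1?eq_sym.
have := ltn_ord k; rewrite -(inj_eq (@ord_inj _)); lia.
Qed.

Lemma Fn_ins r (b : row_of (v r)) i u : Fn r.+1 i (ins b u) =
  q ^ kap i b *: ins b (Fn r i u) + (if addable i b then ins (raise_entry b i) u else 0).
Proof.
elim/fm_ind: u => [|c u w eu ew|S].
- by rewrite !fockE scaler0 add0r if_same.
- rewrite !fockE eu ew !scalerDr !scalerA [_ * c]mulrC -!addrA; congr (_ + _).
  by rewrite addrCA; case: ifP => _ //; rewrite scaler0 addr0.
by rewrite !(insU, FnU) Fsym_ins.
Qed.

Lemma Fn_ins_out n r (b : row_of (v r)) i u : (n <= r)%N ->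
  Fn n i (ins b u) = ins b (Fn n i u).
Proof.
move=> nr; elim/fm_ind: u => [|c u w eu ew|S]; first by rewrite !fockE.
  by rewrite !fockE eu ew.
rewrite insU !FnU /Fsym (linear_sum (ins b)) /=; apply: eq_big => [j|j].
  by case: ltnP => //= jn; rewrite set_row_out // -(inj_eq (@ord_inj _)); lia.
case/andP => jn _; have jr : j != r by rewrite -(inj_eq (@ord_inj _)); lia.
rewrite insZ insU; congr (_ *: fm_basis _); last first.
  by rewrite !raise_rowE set_row_out 1?eq_sym // set_rowC // eq_sym.
congr (q ^ _); apply: eq_bigr => k /andP[_ kn].
by rewrite set_row_out // -(inj_eq (@ord_inj _)); lia.
Qed.

Lemma Fn_zero i u : Fn 0 i u = 0.
Proof.
elim/fm_ind: u => [|c u w eu ew|S]; rewrite ?fockE //.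
  by rewrite eu ew scaler0 addr0.
by rewrite FnU /Fsym big1.
Qed.

End FockModel.

Section FockRelations.

Variables (K : fieldType) (q : K) (l : nat) (v : 'I_l -> int).
Variable W : freeMod K (symbol v).
Hypothesis q0 : q != 0.
Implicit Types (S T : symbol v) (r : 'I_l) (i j p : int) (u w : W) (n : nat).

Local Notation Fn := (@Fn K q l v W).
Local Notation Serre := (@serre K W q).
Local Notation ins := (@ins K l v W _).

(** By induction on rows: for distant i and j, raising at one changes neither the addability nor the
    power of q at the other, so the terms of the two coproducts commute. *)
Lemma Fn_far n i j u : (n <= l)%N -> i + 1 != j -> j + 1 != i ->
  Fn n i (Fn n j u) = Fn n j (Fn n i u).
Proof.
elim: n u => [|n IH] u nl ij ji; first by rewrite !Fn_zero.
case: (eqVneq i j) => [->//|ne].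
have {}IH m := IH m (ltnW nl) ij ji; pose r := Ordinal nl.
elim/fm_ind: u => [|c u w eu ew|S]; first by rewrite !fockE.
  by rewrite !fockE eu ew.
rewrite (@sy_ins _ _ _ _ S r); move: (S r) (fm_basis S) => b m.
rewrite -[n.+1]/(r.+1) !Fn_ins // !fockE.
have kapE i' j' : i' + 1 != j' -> j' + 1 != i' -> i' != j' -> addable j' b ->
    (kap i' (raise_entry b j') = kap i' b) * (addable i' (raise_entry b j') = addable i' b).
  move=> h1 h2 h3 h; rewrite /kap /addable !addable_mem //.
  have -> : (i' == j') = false by lia. 
  have -> : (i' == j' + 1) = false by lia. 
  have -> : (i' + 1 == j') = false by lia. 
  by have -> : (i' + 1 == j' + 1) = false by lia.
have comm : addable i b -> addable j b ->
    raise_entry (raise_entry b i) j = raise_entry (raise_entry b j) i.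
  move=> hi hj; apply: row_ext => y.
  rewrite !addable_mem ?kapE //; try by rewrite eq_sym.
  by do ?(case: eqP => ? //); lia.
case: (boolP (addable i b)) => hi; case: (boolP (addable j b)) => hj;
  rewrite ?(Fn_ins, fockE) // ?(hi, hj, negPf hi, negPf hj) /= ?kapE ?hi ?hj ?(negPf hi) ?(negPf hj);
  rewrite ?comm ?IH //; try lia;
  by apply: fm_ext => T; rewrite !(fm_coefD, fm_coefZ, fm_coef0); ring.
Qed.

Lemma Fn_serre_linear n i j c u w :
  Serre (Fn n i) (Fn n j) u -> Serre (Fn n i) (Fn n j) w ->
  Serre (Fn n i) (Fn n j) (c *: u + w).
Proof.
rewrite /serre !fockE => eu ew; apply: fm_ext => T.
move: (congr1 (fm_coef T) eu) (congr1 (fm_coef T) ew).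
rewrite !(fm_coefD, fm_coefZ) => /(canRL (addrK _)) e /(canRL (addrK _)) e'.
by ring: e e'.
Qed.

(* [b] has [p] but neither [p + 1] nor [p + 2], or [p] and [p + 1] but not [p + 2];
   in both cases two raises in succession are possible, and no other ones. *)
Lemma serre_chain_lo r (b : row_of (v r)) p m :
  p \in b -> p + 1 \notin b -> p + 2 \notin b ->
  Serre (Fn r p) (Fn r (p + 1)) m -> Serre (Fn r (p + 1)) (Fn r p) m ->
  [/\ Serre (Fn r.+1 p) (Fn r.+1 (p + 1)) (ins b m),
      Serre (Fn r.+1 (p + 1)) (Fn r.+1 p) (ins b m),
      Serre (Fn r.+1 p) (Fn r.+1 (p + 1)) (ins (raise_entry b p) m) &
      Serre (Fn r.+1 (p + 1)) (Fn r.+1 p) (ins (raise_entry b p) m)].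
Proof.
move=> h0 h1 h2 s1 s2; have e2 : p + 1 + 1 = p + 2 by ring.
have a0 : addable p b by rewrite /addable h0 h1.
pose b1 := raise_entry b p; pose b2 := raise_entry b1 (p + 1).
have n0 : (p + 1 == p) = false by lia.
have n1 : (p + 2 == p) = false by lia.
have n2 : (p + 2 == p + 1) = false by lia.
have m10 : p \in b1 = false by rewrite addable_mem // eqxx.
have m11 : p + 1 \in b1 by rewrite addable_mem // n0 eqxx.
have m12 : p + 2 \in b1 = false by rewrite addable_mem // n1 n2 (negPf h2).
have a1 : addable (p + 1) b1 by rewrite /addable e2 m11 m12.
have m20 : p \in b2 = false.
  by rewrite addable_mem // eq_sym n0 e2 eq_sym n1.
have m21 : p + 1 \in b2 = false by rewrite addable_mem // eqxx.
have m22 : p + 2 \in b2 by rewrite addable_mem // n2 e2 eqxx.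
apply: (@serre_chain K (symbol v) W q fm_coef (@fm_coefD _ _ W) (@fm_coefZ _ _ W) (@fm_ext _ _ W) 
  (Fn r p) (Fn r (p + 1)) (Fn r.+1 p) (Fn r.+1 (p + 1)) (ins b) (ins b1) (ins b2)) => //;
  try exact: linearP; move=> u;
  rewrite Fn_ins // /kap /addable ?e2 ?(h0, h1, h2, negPf h1, negPf h2, m10, m11, m12, m20, m21, m22) /=;
  by rewrite ?subrr ?subr0 ?sub0r ?addr0 ?expr0z ?expr1z ?exprN1 ?scale1r.
Qed.

Lemma serre_chain_hi r (b : row_of (v r)) p m :
  p \in b -> p + 1 \in b -> p + 2 \notin b ->
  Serre (Fn r p) (Fn r (p + 1)) m -> Serre (Fn r (p + 1)) (Fn r p) m ->
  [/\ Serre (Fn r.+1 (p + 1)) (Fn r.+1 p) (ins b m),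
      Serre (Fn r.+1 p) (Fn r.+1 (p + 1)) (ins b m),
      Serre (Fn r.+1 (p + 1)) (Fn r.+1 p) (ins (raise_entry b (p + 1)) m) &
      Serre (Fn r.+1 p) (Fn r.+1 (p + 1)) (ins (raise_entry b (p + 1)) m)].
Proof.
move=> h0 h1 h2 s1 s2; have e2 : p + 1 + 1 = p + 2 by ring.
have a0 : addable (p + 1) b by rewrite /addable e2 h1 h2.
pose b1 := raise_entry b (p + 1); pose b2 := raise_entry b1 p.
have n0 : (p + 1 == p) = false by lia.
have n0' : (p == p + 1) = false by lia.
have n1 : (p + 2 == p) = false by lia.
have n1' : (p == p + 2) = false by lia.
have n2 : (p + 2 == p + 1) = false by lia.
have m10 : p \in b1 by rewrite addable_mem // e2 n0' n1' h0.
have m11 : p + 1 \in b1 = false by rewrite addable_mem // eqxx.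
have m12 : p + 2 \in b1 by rewrite addable_mem // n2 e2 eqxx.
have a1 : addable p b1 by rewrite /addable m10 m11.
have m20 : p \in b2 = false by rewrite addable_mem // eqxx.
have m21 : p + 1 \in b2 by rewrite addable_mem // n0 eqxx.
have m22 : p + 2 \in b2 by rewrite addable_mem // n1 n2 m12.
(* The entry p + 1 has to move first, so F_(p+1) plays the role of A and F_p that of B. *)
apply: (@serre_chain K (symbol v) W q fm_coef (@fm_coefD _ _ W) (@fm_coefZ _ _ W) (@fm_ext _ _ W) 
  (Fn r (p + 1)) (Fn r p) (Fn r.+1 (p + 1)) (Fn r.+1 p) (ins b) (ins b1) (ins b2)) => //;
  try exact: linearP; move=> u;
  rewrite Fn_ins // /kap /addable ?e2 ?(h0, h1, h2, negPf h2, m10, m11, m12, m20, m21, m22) /=;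
  by rewrite ?subrr ?subr0 ?sub0r ?addr0 ?expr0z ?expr1z ?exprN1 ?scale1r.
Qed.

Lemma serre_fixed r (b : row_of (v r)) i j m :
  ~~ addable i b -> ~~ addable j b ->
  Serre (Fn r i) (Fn r j) m -> Serre (Fn r.+1 i) (Fn r.+1 j) (ins b m).
Proof.
move=> hi hj; apply: (@serre_scaled K (symbol v) W q fm_coef (@fm_coefD _ _ W) (@fm_coefZ _ _ W) (@fm_ext _ _ W)
  (Fn r i) (Fn r j) (Fn r.+1 i) (Fn r.+1 j) (ins b) _ _ _ (q ^ kap i b) (q ^ kap j b)) => //;
  try exact: linearP; move=> u.
  by rewrite Fn_ins // (negPf hi) addr0.
by rewrite Fn_ins // (negPf hj) addr0.
Qed.

(** Only the membership of p, p + 1 and p + 2 in the last row matters. A row with p + 1 alone, or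
    with exactly p and p + 2, is the midpoint of a chain of two raises, whose start is found by
    lowering; on rows where neither raise is possible the operators act by scalars. *)
Lemma Fn_serre n p u : (n <= l)%N ->
  Serre (Fn n p) (Fn n (p + 1)) u /\ Serre (Fn n (p + 1)) (Fn n p) u.
Proof.
elim: n u => [|n IH] u nl.
  by rewrite /serre !Fn_zero addr0 scaler0.
have {}IH m := IH m (ltnW nl); pose r := Ordinal nl.
elim/fm_ind: u => [|c u w [eu eu'] [ew ew']|S].
- by rewrite /serre !fockE scaler0 addr0.
- by split; apply: Fn_serre_linear.
rewrite (@sy_ins _ _ _ _ S r); move: (S r) (fm_basis S) => b m.
rewrite -[n.+1]/(r.+1); case: (IH m); rewrite -[n in Fn n]/(nat_of_ord r) => s1 s2.
have e2 : p + 1 + 1 = p + 2 by ring.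
case: (boolP (p \in b)) => h0; case: (boolP (p + 1 \in b)) => h1; case: (boolP (p + 2 \in b)) => h2.
- by split; apply: serre_fixed => //; rewrite /addable ?e2 h1 ?h2 ?andbF.
- by case: (serre_chain_hi h0 h1 h2 s1 s2).
- have rm : removable (p + 1) b by rewrite /removable e2 h1 h2.
  have := @serre_chain_hi r (lower_entry b (p + 1)) p m.
  rewrite !mem_lower // lowerK // e2 !eqxx !andbF !orbF h0 orTb.
  have -> : (p == p + 1) = false by lia.
  have -> : (p == p + 2) = false by lia.
  have -> : (p + 2 == p + 1) = false by lia.
  by case/(_ isT isT isT s1 s2).
- by case: (serre_chain_lo h0 h1 h2 s1 s2).
- by split; apply: serre_fixed => //; rewrite /addable ?e2 ?(negPf h0) ?h1 ?h2 ?andbF.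
- have rm : removable p b by rewrite /removable h0 h1.
  have := @serre_chain_lo r (lower_entry b p) p m.
  rewrite !mem_lower // lowerK // !eqxx !andbF !orbF (negPf h2) orTb.
  have -> : (p + 1 == p) = false by lia.
  have -> : (p + 2 == p) = false by lia.
  by case/(_ isT isT isT s1 s2).
- by split; apply: serre_fixed => //; rewrite /addable ?e2 ?(negPf h0) ?(negPf h1).
- by split; apply: serre_fixed => //; rewrite /addable ?e2 ?(negPf h0) ?(negPf h1).
Qed.

End FockRelations.

(** * The bar involution of the Fock space *)

Section BarStep.

Variables (K : fieldType) (q : K) (l : nat) (v : 'I_l -> int).
Variable W : freeMod K (symbol v).
Variable bar : {rmorphism K -> K}.
Hypothesis q0 : q != 0.
Hypothesis q2 : q + q^-1 != 0.
Hypothesis bar_q : bar q = q^-1.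
Implicit Types (S T : symbol v) (i j : int) (u w : W) (n m : nat).

Local Notation sy S := (fm_basis S : W).
Local Notation Fn := (@Fn K q l v W).
Local Notation ins := (@ins K l v W _).

(** The field [bl_lead] is what is retained of unitriangularity: a nonzero vector has a nonzero
    coefficient that is merely conjugated. [bl_ins] makes the rows from n on spectators. *)
Record bar_like n (psi : W -> W) : Prop := BarLike {
  bl_lin : forall c u w, psi (c *: u + w) = bar c *: psi u + psi w;
  bl_F : forall i u, psi (Fn n i u) = Fn n i (psi u);
  bl_ins : forall (k : 'I_l) (b : row_of (v k)) u, (n <= k)%N -> psi (ins b u) = ins b (psi u);
  bl_vac : psi (sy (empty_symbol v)) = sy (empty_symbol v);
  bl_lead : forall d, d != 0 -> exists T, fm_coef T d != 0 /\ fm_coef T (psi d) = bar (fm_coef T d) }.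

Variable r : 'I_l.
Local Notation F := (Fn r.+1).
Local Notation row := (row_of (v r)).
Implicit Types b : row.

Variable psi : W -> W.
Hypothesis psiP : bar_like r psi.

Lemma psiD u w : psi (u + w) = psi u + psi w.
Proof. by rewrite -[u]scale1r (bl_lin psiP) rmorph1 !scale1r. Qed.

Lemma psi0 : psi 0 = 0.
Proof. by apply: (addIr (psi 0)); rewrite -psiD !add0r. Qed.

Lemma psiZ c u : psi (c *: u) = bar c *: psi u.
Proof. by rewrite -[c *: u]addr0 (bl_lin psiP) psi0 addr0. Qed.

Lemma psiB u w : psi (u - w) = psi u - psi w.
Proof. by rewrite psiD -[- w]scaleN1r psiZ rmorphN rmorph1 scaleN1r. Qed.

(* The row [r] is built up from the vacuum by [F_i]'s; by the commutation of
   distant [F_i]'s the result [Y b] depends only on the row [b] reached. *)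
Definition Yword (s : seq int) u : W := foldr F (ins (vac (v r)) u) s.

Fixpoint reach (s : seq int) : option row :=
  if s is i :: s' then
    if reach s' is Some b then (if addable i b then Some (raise_entry b i) else None) else None
  else Some (vac (v r)).

Lemma reach_size s b : reach s = Some b -> rsz b = size s.
Proof.
elim: s b => [|i s IH] b /= => [[<-]|]; first by rewrite rsz_vac.
case: (reach s) IH => // b' /(_ _ erefl) <-.
by case: ifP => // h [<-]; rewrite rsz_raise.
Qed.

Lemma reach_exists b : exists s, reach s = Some b.
Proof.
move e: (rsz b) => n; elim: n b e => [|n IH] b e.
  exists [::]; congr Some; apply/esym; apply: contrapT => /row_neq_vac_removable[i /rsz_lower].
  by rewrite e.
have [i h] : exists i, removable i b.
  by apply: row_neq_vac_removable => eb; rewrite eb rsz_vac in e.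
have [|s hs] := IH (lower_entry b i); first by have := rsz_lower h; rewrite e => -[].
by exists (i :: s); rewrite /= hs addable_lower // lowerK.
Qed.

Lemma reach_cons i s b : reach (i :: s) = Some b ->
  removable i b /\ reach s = Some (lower_entry b i).
Proof.
rewrite /=; case: (reach s) => // b'; case: ifP => // h [<-].
by rewrite removable_raise // raiseK.
Qed.

Lemma removable2 i j b : removable i b -> removable j b -> i != j ->
  [/\ i + 1 != j, j + 1 != i & removable j (lower_entry b i)].
Proof.
move=> hi hj ij; have hij : i + 1 != j.
  by case/andP: hi => _ hi; case/andP: hj => hj _; apply: contraNneq hj => <-.
have hji : j + 1 != i.
  by case/andP: hi => hi _; case/andP: hj => _ hj; apply: contraNneq hi => <-.
split=> //; rewrite /removable !mem_lower //.
case/andP: hj => /negPf -> ->; rewrite andFb orbF; lia.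
Qed.

Lemma lower_lower i j b : removable i b -> removable j b -> i != j ->
  lower_entry (lower_entry b i) j = lower_entry (lower_entry b j) i.
Proof.
move=> hi hj ij; have [_ _ hji] := removable2 hi hj ij.
have ji : j != i by rewrite eq_sym.
have [h1 h2 hij] := removable2 hj hi ji.
apply: row_ext => y; rewrite !mem_lower //.
case: (eqVneq y i) => [->|]; case: (eqVneq y j) => [e|] //=; try lia.
Qed.

Lemma lower_adjacent i j b : removable i b -> (j == i + 1) || (i == j + 1) ->
  ~~ addable j (lower_entry b i).
Proof.
move=> ri /orP[]/eqP e; rewrite /addable !mem_lower // e ?eqxx ?andbF //.
by have -> : (i + 1 == i) = false by lia.
Qed.

Lemma removable_lower_adjacent i j b : ~~ addable i b -> removable j b ->
  (i == j + 1) || (j == i + 1) -> removable i (lower_entry b j).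
Proof.
move=> hi rj /orP[]/eqP e; move: hi; case/andP: (rj) => rj1 rj2;
  rewrite /addable /removable !mem_lower // e eqxx ?andbF ?rj2 /=.
  rewrite negbK => ->; rewrite orbF.
  have -> : (j + 1 == j) = false by lia.
  have -> : (j + 1 + 1 == j) = false by lia.
  by have -> : (j + 1 + 1 == j + 1) = false by lia.
rewrite -e rj1 andbT => hi; rewrite (negPf hi) andFb orbF; lia.
Qed.

(** A diamond argument by induction on the length. If the outermost letters i and j differ, both are
    removable from b, hence distant. A word t for b with both lowered links the two: [j :: t] can
    replace the tail of s, [i :: t] that of s', and F_i and F_j commute. *)
Lemma Yword_indep s s' b u : reach s = Some b -> reach s' = Some b ->
  Yword s u = Yword s' u.
Proof.
move e: (size s) => n; elim: n s s' b e => [|n IH] s s' b e hs hs'.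
  have := reach_size hs'; rewrite (reach_size hs) e.
  by case: s e {hs}; case: s' {hs'}.
have := reach_size hs'; rewrite (reach_size hs) e.
case: s e hs => // i s [es] hs; case: s' hs' => // j s' hs' [es'].
have [ri hs1] := reach_cons hs; have [rj hs1'] := reach_cons hs'.
case: (eqVneq i j) => [eij|nij].
  by rewrite /= -eij (IH s s' (lower_entry b i)) // eij.
have [h1 h2 rij] := removable2 ri rj nij.
have [t ht] := reach_exists (lower_entry (lower_entry b i) j).
have hjt : reach (j :: t) = Some (lower_entry b i).
  by rewrite /= ht addable_lower // lowerK.
have hit : reach (i :: t) = Some (lower_entry b j).
  have [_ _ rji] : [/\ j + 1 != i, i + 1 != j & removable i (lower_entry b j)].
    by apply: removable2 => //; rewrite eq_sym.
  by rewrite /= ht (lower_lower ri rj nij) addable_lower // lowerK.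
have szt : size t = n.-1.
  by have := reach_size hjt; rewrite (reach_size hs1) es => -> .
rewrite /= -!/(Yword _ _) (IH s (j :: t) _ _ hs1 hjt) //.
rewrite -(IH (i :: t) s' _ _ hit hs1'); last first.
  by rewrite -(reach_size hit) (reach_size hs1') -es'.
by rewrite /= Fn_far.
Qed.

Definition Y b : W -> W := Yword (projT1 (cid (reach_exists b))).

Lemma Y_vac u : Y (vac (v r)) u = ins (vac (v r)) u.
Proof.
rewrite /Y; case: (cid _) => s hs /=.
by rewrite (@Yword_indep s [::] (vac (v r))).
Qed.

Lemma Y_raise i b u : addable i b -> F i (Y b u) = Y (raise_entry b i) u.
Proof.
move=> h; rewrite /Y; case: (cid _) => s hs /=; case: (cid _) => s' hs' /=.
by apply: (@Yword_indep (i :: s) s' (raise_entry b i)); rewrite //= hs h.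
Qed.

Lemma Y_lower i b u : removable i b -> Y b u = F i (Y (lower_entry b i) u).
Proof. by move=> h; rewrite Y_raise ?addable_lower // lowerK. Qed.

(** The predicate also takes the operator, because the word chosen for a raised row need not extend
    the word chosen for the row before. *)
Lemma Y_ind (P : row -> (W -> W) -> Prop) :
  P (vac (v r)) (ins (vac (v r))) ->
  (forall i b f, addable i b -> P b f -> P (raise_entry b i) (fun u => F i (f u))) ->
  forall b, P b (Y b).
Proof.
move=> h0 h1 b; rewrite /Y; case: (cid _) => s /=.
elim: s b => [|i s IH] b /= => [[<-]//|].
case: (reach s) IH => // b' /(_ _ erefl) IH; case: ifP => // h [<-].
exact: (h1 i b' (Yword s) h IH).
Qed.

Lemma Y_linear b : linear (Y b).
Proof.
apply: (@Y_ind (fun _ f => linear f)) => [c u w|i b' f _ e c u w]; first by rewrite !fockE.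
by rewrite e !fockE.
Qed.
HB.instance Definition _ b := GRing.isLinear.Build K W W *:%R (Y b) (Y_linear b).

Lemma YD b u w : Y b (u + w) = Y b u + Y b w.
Proof. exact: linearD. Qed.
Lemma YZ b c u : Y b (c *: u) = c *: Y b u.
Proof. exact: linearZZ. Qed.
Lemma Y0 b : Y b 0 = 0.
Proof. exact: linear0. Qed.

Lemma Y_ins b b' u : Y b (ins b' u) = Y b u.
Proof.
apply: (@Y_ind (fun _ f => f (ins b' u) = f u)) => [|i b'' f _ -> //].
by rewrite ins_ins.
Qed.

Lemma Y_insC (k : 'I_l) (c : row_of (v k)) b u : (r < k)%N -> Y b (ins c u) = ins c (Y b u).
Proof.
move=> rk; apply: (@Y_ind (fun _ f => f (ins c u) = ins c (f u))) => [|i b' f _ ->].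
  by rewrite insC // -(inj_eq (@ord_inj _)); lia.
by rewrite Fn_ins_out.
Qed.

(** The filtration by the size of row r; the strict bound makes [low 0] the zero space. *)
Definition low m : W -> Prop := supported (fun T => (rsz (T r) < m)%N).

Lemma low_sub m n u : (m <= n)%N -> low m u -> low n u.
Proof. by move=> mn; apply: supported_sub => T h; apply: leq_trans h mn. Qed.

Lemma low_ins m b u : (rsz b < m)%N -> low m (ins b u).
Proof.
move=> bm; elim/fm_ind: u => [|c u w hu hw|S]; first by rewrite ins0; apply: supported0.
  by rewrite insD insZ; apply: supported_lin.
by rewrite insU; apply: supported_basis; rewrite set_row_in.
Qed.

Lemma low_F m i u : low m u -> low m.+1 (F i u).
Proof.
move: u; apply: supported_ind => [|c u w hu hw|S Sm]; first by rewrite Fn0; apply: supported0.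
  by rewrite FnD FnZ; apply: supported_lin.
rewrite (@sy_ins _ _ _ _ S r) Fn_ins //; apply: supported_lin.
  by apply: low_ins; apply: ltnW.
by case: ifP => h; [apply: low_ins; rewrite rsz_raise | apply: supported0].
Qed.

Lemma low_ex u : exists m, low m u.
Proof.
elim/fm_ind: u => [|c u w [m hm] [n hn]|S]; first by exists 0%N; apply: supported0.
  exists (maxn m n); apply: supported_lin; [apply: low_sub hm|apply: low_sub hn];
    by rewrite ?leq_maxl ?leq_maxr.
by exists (rsz (S r)).+1; apply: supported_basis.
Qed.

Lemma low_eq0 u : low 0 u -> u = 0.
Proof.
move=> lu; apply: fm_ext => T; rewrite fm_coef0; apply/eqP/negPn/negP => /lu.
by rewrite ltn0.
Qed.

(** Raising row r has coefficient 1 in [Fn_ins], and every other term leaves that row at a smaller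
    size. *)
Lemma Y_tri b u : low (rsz b) (Y b u - ins b u).
Proof.
apply: (@Y_ind (fun b f => low (rsz b) (f u - ins b u))) => [|i b' f h e].
  by rewrite subrr; apply: supported0.
rewrite rsz_raise // (_ : _ - _ = q ^ kap i b' *: ins b' (Fn r i u) + F i (f u - ins b' u)).
  by apply: supported_lin; [apply: low_ins | apply: low_F].
by rewrite (linearB (F i)) /= Fn_ins // h opprD addrCA addNKr.
Qed.

Definition bar_comm (X : W -> W) := forall u, psi (X u) = X (psi u).

(* The operators [sum_b c_b (Y b \o X_b)] with [rsz b <= m], all [c_b] bar-invariant
   and all [X_b] commuting with [psi]. *)
Inductive bar_ops m : (W -> W) -> Prop :=
| BarOps0 (f : W -> W) : (forall u, f u = 0) -> bar_ops m f
| BarOpsS b X c f g : (rsz b <= m)%N -> bar_comm X -> bar c = c -> bar_ops m f ->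
    (forall u, g u = c *: Y b (X u) + f u) -> bar_ops m g.

Lemma bar_ops_ext m f g : f =1 g -> bar_ops m f -> bar_ops m g.
Proof.
move=> fg h; case: h fg => [f' f'0|b X c f' g' hb hX hc hf hg] fg.
  by apply: BarOps0 => u; rewrite -fg.
by apply: (BarOpsS hb hX hc hf) => u; rewrite -fg.
Qed.

Lemma bar_ops_lin m c f g : bar c = c -> bar_ops m f -> bar_ops m g ->
  bar_ops m (fun u => c *: f u + g u).
Proof.
move=> hc hf hg; elim: hf => {f} [f f0|b X d f f' hb hX hd _ IH e].
  by apply: bar_ops_ext hg => u; rewrite f0 scaler0 add0r.
apply: (BarOpsS hb hX _ IH (c := c * d)) => [|u]; first by rewrite rmorphM hc hd.
by rewrite e scalerDr scalerA addrA.
Qed.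

Lemma bar_ops_sub m n f : (m <= n)%N -> bar_ops m f -> bar_ops n f.
Proof.
move=> mn; elim=> {f} [f f0|b X c f g hb hX hc _ IH e]; first exact: BarOps0.
by apply: (BarOpsS _ hX hc IH) => //; apply: leq_trans hb mn.
Qed.

Lemma bar_ops_Y b : bar_ops (rsz b) (Y b).
Proof.
apply: (@BarOpsS _ b id 1 (fun=> 0)) => //; first exact: rmorph1.
  by apply: BarOps0.
by move=> u; rewrite scale1r addr0.
Qed.

Lemma bar_ops_comp m f X : bar_comm X -> bar_ops m f -> bar_ops m (f \o X).
Proof.
move=> hX; elim=> {f} [f f0|b X' c f g hb hX' hc _ IH e].
  by apply: BarOps0 => u; rewrite /= f0.
apply: (BarOpsS hb _ hc IH (X := X' \o X)) => u /=; last by rewrite e.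
by rewrite hX' hX.
Qed.

Lemma bar_ops_F m n i f :
  (forall b, (rsz b <= m)%N -> bar_ops n (F i \o Y b)) ->
  bar_ops m f -> bar_ops n (F i \o f).
Proof.
move=> h; elim=> {f} [f f0|b X c f g hb hX hc _ IH e].
  by apply: BarOps0 => u; rewrite /= f0 Fn0.
apply: bar_ops_ext (bar_ops_lin hc (bar_ops_comp hX (h b hb)) IH) => u /=.
by rewrite e FnD FnZ.
Qed.

Lemma Fr_far i j u : i + 1 != j -> j + 1 != i -> F i (F j u) = F j (F i u).
Proof. by move=> h1 h2; apply: Fn_far. Qed.

Lemma Fr_serre i j u : (j == i + 1) || (i == j + 1) ->
  F i (F i (F j u)) + F j (F i (F i u)) = (q + q^-1) *: F i (F j (F i u)).
Proof.
by case/orP => /eqP ->; [have [] := @Fn_serre K q l v W q0 r.+1 i u (ltn_ord r)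
  | have [] := @Fn_serre K q l v W q0 r.+1 j u (ltn_ord r)].
Qed.

Lemma bar_q2 : bar (q + q^-1) = q + q^-1.
Proof. by rewrite rmorphD fmorphV /= bar_q invrK addrC. Qed.

Lemma bar_comm_F i : bar_comm (Fn r i).
Proof. exact: (bl_F psiP). Qed.

Lemma addable_vac i : addable i (vac (v r)) = (i == v r).
Proof. by rewrite /addable !mem_vac; lia. Qed.

Lemma bar_ops_vac i : ~~ addable i (vac (v r)) -> bar_ops 0 (F i \o Y (vac (v r))).
Proof.
move=> h; have := @bar_ops_comp _ _ _ (bar_comm_F i) (bar_ops_Y (vac (v r))).
rewrite rsz_vac; apply: bar_ops_ext => u /=; rewrite !Y_vac Fn_ins // (negPf h) addr0.
rewrite addable_vac in h.
(* As i differs from the charge, the vacuum row contains both or neither of i and i + 1, so K_i acts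
   trivially on it. *)
rewrite /kap !mem_vac (_ : _ - _ = 0); last by lia.
by rewrite expr0z scale1r.
Qed.

(** With z the insertion of the vacuum row and f the operator F_i on the first r rows, F_i^2 z = [2]
    F_i z f - z f^2, since the row can be raised only once; both coefficients are bar-invariant. *)
Lemma bar_ops_vac2 i : addable i (vac (v r)) -> bar_ops 1 (F i \o Y (raise_entry (vac (v r)) i)).
Proof.
move=> h; set z := vac (v r); set b1 := raise_entry z i.
have s1 : rsz b1 = 1%N by rewrite rsz_raise // rsz_vac.
have o1 : bar_ops 1 (Y b1 \o Fn r i).
  by rewrite -s1; apply: bar_ops_comp (bar_comm_F i) (bar_ops_Y b1).
have o0 : bar_ops 1 (Y z \o Fn r i \o Fn r i).
  apply: bar_ops_comp (bar_comm_F i) (bar_ops_comp (bar_comm_F i) _).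
  by apply: bar_ops_sub (bar_ops_Y z); rewrite rsz_vac.
have oz : bar_ops 1 (fun=> 0) by exact: BarOps0.
have cN : bar (-1) = -1 by rewrite rmorphN rmorph1.
apply: bar_ops_ext (bar_ops_lin bar_q2 o1 (bar_ops_lin cN o0 oz)) => u /=.
rewrite addr0 -!(Y_raise _ h) !Y_vac.
have [k0 k1] : kap i z = 1 /\ kap i b1 = -1.
  by rewrite kap_addable // kap_removable // removable_raise.
have nb1 : addable i b1 = false by rewrite removableNaddable // removable_raise.
rewrite !Fn_ins // -/z -/b1 h !fockE !Fn_ins // -/z -/b1 h nb1 k0 k1 expr1z exprN1 addr0.
have e : q * q^-1 = 1 by rewrite mulfV.
by apply: fm_ext => T; rewrite !(fm_coefD, fm_coefZ); ring: e.
Qed.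

(** Under the induction hypothesis an F_i increases the bound on row sizes by at most one, whether
    or not it raises the row. *)
Lemma bar_ops_step n :
  (forall b i, (rsz b < n)%N -> ~~ addable i b -> bar_ops (rsz b) (F i \o Y b)) ->
  forall m i f, (m < n)%N -> bar_ops m f -> bar_ops m.+1 (F i \o f).
Proof.
move=> IH m i f mn; apply: bar_ops_F => b bm.
case: (boolP (addable i b)) => h.
  apply: (@bar_ops_ext _ (Y (raise_entry b i))) => [u /=|]; first by rewrite Y_raise.
  by apply: bar_ops_sub (bar_ops_Y _); rewrite rsz_raise.
by apply: bar_ops_sub (IH _ _ _ h); [apply: leqW | apply: leq_ltn_trans mn].
Qed.

(* Strong induction on the size of [b]: peel off one or two raises of [b] and move
   [F_i] to the right past them by the Serre relations. *)
Lemma bar_ops_nonaddable b i : ~~ addable i b -> bar_ops (rsz b) (F i \o Y b).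
Proof.
move e: (rsz b) => n; elim/ltn_ind: n b i e => n IHn b i sb hi.
have {IHn}IH b' i' : (rsz b' < n)%N -> ~~ addable i' b' -> bar_ops (rsz b') (F i' \o Y b').
  by move=> h; apply: IHn.
have FF := bar_ops_step IH.
case: (eqVneq b (vac (v r))) => [eb|nb].
  by rewrite -sb eb rsz_vac; apply: bar_ops_vac; rewrite -eb.
have [j hj] := row_neq_vac_removable (elimN eqP nb).
have := rsz_lower hj; rewrite sb; set b0 := lower_entry b j => sn.
have {sn} [n' [en sb0]] : exists n', n = n'.+1 /\ rsz b0 = n' by exists (rsz b0).
rewrite {}en in sb IH FF *; have aj : addable j b0 by apply: addable_lower.
have eb : b = raise_entry b0 j by rewrite lowerK.
have EY u : Y b u = F j (Y b0 u) by rewrite -Y_lower.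
case: (eqVneq i j) => [eij|nij].
- subst j; case: (eqVneq b0 (vac (v r))) => [eb0|nb0].
    by rewrite -sb0 eb eb0 rsz_vac; apply: bar_ops_vac2; rewrite -eb0.
  have [k hk] := row_neq_vac_removable (elimN eqP nb0).
  have := rsz_lower hk; rewrite sb0; set b1 := lower_entry b0 k => sn.
  have ak : addable k b1 by apply: addable_lower.
  have eb0 : b0 = raise_entry b1 k by rewrite lowerK.
  have EY0 u : Y b0 u = F k (Y b1 u) by rewrite -Y_lower.
  have nik : i != k.
    by case/andP: aj => aj _; case/andP: hk => hk _; apply: contraNneq hk => <-.
  case: (boolP ((k == i + 1) || (i == k + 1))) => kk; last first.
    have [h1 h2] : i + 1 != k /\ k + 1 != i by move: kk; rewrite negb_or eq_sym [i == _]eq_sym => /andP[].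
    have ai1 : addable i b1 by rewrite addable_lower_far.
    apply: (@bar_ops_ext _ (F k \o (F i \o Y (raise_entry b1 i)))) => [u /=|].
      by rewrite EY EY0 -(Y_raise _ ai1) -!(Fr_far (i := i) (j := k)).
    apply: (FF) => //.
    have s1 : rsz (raise_entry b1 i) = n' by rewrite rsz_raise.
    rewrite -[X in bar_ops X]s1; apply: IH; first by rewrite s1.
    by rewrite removableNaddable // removable_raise.
  have na1 : ~~ addable i b1.
    by apply: lower_adjacent => //; rewrite orbC.
  have s1 : (rsz b1).+1 = n' by rewrite -sn.
  have o1 : bar_ops (rsz b1) (F i \o Y b1) by apply: IH na1; rewrite -s1.
  have cN : bar (-1) = -1 by rewrite rmorphN rmorph1.
  have o2 : bar_ops n'.+1 (F i \o (F k \o (F i \o Y b1))).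
    by apply: (FF) => //; rewrite -s1; apply: (FF); rewrite -?s1.
  have o3 : bar_ops n'.+1 (F k \o (F i \o (F i \o Y b1))).
    by apply: (FF) => //; rewrite -s1; apply: (FF); rewrite -?s1.
  have oz : bar_ops n'.+1 (fun=> 0) by exact: BarOps0.
  apply: bar_ops_ext (bar_ops_lin bar_q2 o2 (bar_ops_lin cN o3 oz)) => u /=.
  by rewrite EY EY0 addr0 scaleN1r -Fr_serre // addrK.
- case: (boolP ((j == i + 1) || (i == j + 1))) => kk; last first.
    have [h1 h2] : i + 1 != j /\ j + 1 != i by move: kk; rewrite negb_or eq_sym [i == _]eq_sym => /andP[].
    apply: (@bar_ops_ext _ (F j \o (F i \o Y b0))) => [u /=|].
      by rewrite EY Fr_far.
    apply: (FF) => //; rewrite -[X in bar_ops X]sb0; apply: IH; first by rewrite sb0.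
    by rewrite addable_lower_far.
  (* For adjacent j, b arises from b1 by raising at i and then at j. The Serre relation writes F_i
     F_j F_i as the sum of F_i F_i F_j and F_j F_i F_i divided by [2]; the first term starts with
     F_j on [Y b1], the second has F_i on [Y b0], and neither raises the row. *)
  have ri : removable i b0.
    by apply: removable_lower_adjacent => //; rewrite orbC.
  have := rsz_lower ri; rewrite sb0; set b1 := lower_entry b0 i => sn.
  have ai : addable i b1 by apply: addable_lower.
  have nj1 : ~~ addable j b1.
    exact: lower_adjacent.
  have EY0 u : Y b0 u = F i (Y b1 u) by rewrite -Y_lower.
  have s1 : (rsz b1).+1 = n' by rewrite -sn.
  have o1 : bar_ops (rsz b1) (F j \o Y b1) by apply: IH nj1; rewrite -s1.
  have o2 : bar_ops n'.+1 (F i \o (F i \o (F j \o Y b1))).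
    by apply: (FF) => //; rewrite -s1; apply: (FF); rewrite -?s1.
  have o3 : bar_ops n'.+1 (F j \o (F i \o Y b0)).
    apply: (FF) => //; rewrite -[X in bar_ops X]sb0; apply: IH; first by rewrite sb0.
    by rewrite removableNaddable.
  have oz : bar_ops n'.+1 (fun=> 0) by exact: BarOps0.
  have c2 : bar (q + q^-1)^-1 = (q + q^-1)^-1 by rewrite fmorphV /= bar_q2.
  apply: bar_ops_ext (bar_ops_lin c2 o2 (bar_ops_lin c2 o3 oz)) => u /=.
  by rewrite EY EY0 addr0 -scalerDr Fr_serre // scalerA mulVf // scale1r.
Qed.

Lemma bar_ops_all b i : exists m, bar_ops m (F i \o Y b).
Proof.
case: (boolP (addable i b)) => h; last by exists (rsz b); apply: bar_ops_nonaddable.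
exists (rsz (raise_entry b i)); apply: bar_ops_ext (bar_ops_Y _) => u /=.
by rewrite Y_raise.
Qed.

(* [Theta] is unitriangular for the size of the row [r], hence bijective, and
   conjugating [psi] by it gives the involution on one more row. *)
Definition Theta : W -> W := mlin (fun S => Y (S r) (sy S)).
HB.instance Definition _ := GRing.Linear.on Theta.

Lemma Theta_ins b u : Theta (ins b u) = Y b u.
Proof.
elim/fm_ind: u => [|c u w hu hw|S]; first by rewrite ins0 linear0 Y0.
  by rewrite insD insZ linearP /= hu hw YD YZ.
by rewrite insU /Theta mlin_basis set_row_in -insU Y_ins.
Qed.

Lemma Theta_insC (k : 'I_l) (c : row_of (v k)) u : (r < k)%N -> Theta (ins c u) = ins c (Theta u).
Proof.
move=> rk; elim/fm_ind: u => [|a u w hu hw|S]; first by rewrite ins0 linear0 ins0.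
  by rewrite insD insZ !linearP /= hu hw.
rewrite insU /Theta !mlin_basis set_row_out; last by rewrite -(inj_eq (@ord_inj _)); lia.
by rewrite -insU Y_insC.
Qed.

Lemma Theta_low m u : low m.+1 u -> low m (Theta u - u).
Proof.
move: u; apply: supported_ind => [|c u w hu hw|S Sm]; first by rewrite linear0 subr0; apply: supported0.
  rewrite linearP /= opprD addrACA -scalerBr; exact: supported_lin.
rewrite /Theta mlin_basis; have := @Y_tri (S r) (sy S).
by rewrite -sy_ins; apply: low_sub.
Qed.

(** Successive approximation: the error [Theta u - u] lies one step lower in the filtration, so it
    has a preimage by induction, which is subtracted from u. *)
Lemma Theta_surj_low m u : low m u -> exists2 w, Theta w = u & low m w.
Proof.
elim: m u => [|m IH] u lu.
  by exists 0; [rewrite linear0 (low_eq0 lu) | apply: supported0].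
have [w ew lw] := IH _ (Theta_low lu).
exists (u - w); first by rewrite linearB /= ew subKr.
by apply: supportedB => //; apply: low_sub lw.
Qed.

Lemma Theta_surj u : exists w, Theta w = u.
Proof. by have [m /Theta_surj_low[w]] := low_ex u; exists w. Qed.

Lemma Theta_inj0 u : Theta u = 0 -> u = 0.
Proof.
move=> u0; have [m] := low_ex u; elim: m => [/low_eq0//|m IH] lu.
apply: IH; have -> : u = (-1) *: (Theta u - u) by rewrite u0 sub0r scaleN1r opprK.
by apply: supportedZ; apply: Theta_low.
Qed.

Lemma Theta_inj u w : Theta u = Theta w -> u = w.
Proof. by move=> e; apply/eqP; rewrite -subr_eq0; apply/eqP/Theta_inj0; rewrite linearB /= e subrr. Qed.

Definition ThetaV u : W := projT1 (cid (Theta_surj u)).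

Lemma ThetaK u : ThetaV (Theta u) = u.
Proof. by rewrite /ThetaV; case: (cid _) => w /= /Theta_inj. Qed.

Lemma ThetaVK u : Theta (ThetaV u) = u.
Proof. by rewrite /ThetaV; case: (cid _). Qed.

Definition psi' u : W := Theta (psi (ThetaV u)).

Lemma psi'_Theta u : psi' (Theta u) = Theta (psi u).
Proof. by rewrite /psi' ThetaK. Qed.

Lemma psi'_Y b u : psi' (Y b u) = Y b (psi u).
Proof. by rewrite -Theta_ins psi'_Theta (bl_ins psiP) // Theta_ins. Qed.

Lemma psi'_lin c u w : psi' (c *: u + w) = bar c *: psi' u + psi' w.
Proof.
rewrite -(ThetaVK u) -(ThetaVK w) -(linearP Theta) !psi'_Theta.
by rewrite (bl_lin psiP) linearP.
Qed.

Lemma psi'0 : psi' 0 = 0.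
Proof. by rewrite -(linear0 Theta) psi'_Theta psi0. Qed.

Lemma bar_ops_psi m f u : bar_ops m f -> psi' (f u) = f (psi u).
Proof.
elim=> {f} [f f0|b X c f g _ hX hc _ IH e]; first by rewrite !f0 psi'0.
by rewrite !e psi'_lin psi'_Y hX IH hc.
Qed.

(** By surjectivity of [Theta] it suffices to look at the vectors [Y b u], and F_i composed with
    [Y b] is one of the operators of [bar_ops]. *)
Lemma psi'_F i u : psi' (F i u) = F i (psi' u).
Proof.
rewrite -(ThetaVK u); elim/fm_ind: (ThetaV u) => [|c w w' hw hw'|S].
- by rewrite linear0 Fn0 psi'0 Fn0.
- by rewrite linearP /= FnD FnZ !psi'_lin hw hw' FnD FnZ.
rewrite (@sy_ins _ _ _ _ S r) Theta_ins psi'_Y.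
by have [m /bar_ops_psi h] := bar_ops_all (S r) i; apply: h.
Qed.

Lemma psi_low m u : low m u -> low m (psi u).
Proof.
move: u; apply: supported_ind => [|c u w hu hw|S Sm]; first by rewrite psi0; apply: supported0.
  by rewrite (bl_lin psiP); apply: supported_lin.
by rewrite (@sy_ins _ _ _ _ S r) (bl_ins psiP) //; apply: low_ins.
Qed.

(** On [Theta w] the difference splits into two errors of the form [Theta] minus the identity, both
    of which lower the size of row r. *)
Lemma psi'_low m u : low m.+1 u -> low m (psi' u - psi u).
Proof.
move=> lu; have [w ew lw] := Theta_surj_low lu.
rewrite -ew psi'_Theta (_ : _ - _ = (Theta (psi w) - psi w) - psi (Theta w - w)).
  by apply: supportedB; [apply: Theta_low; apply: psi_low | apply: psi_low; apply: Theta_low].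
by rewrite psiB opprB addrA subrK.
Qed.

(** Let t be the part of d whose row r has the maximal size m. Modulo smaller rows [psi'] takes d to
    [psi t], so a coefficient that [bl_lead] provides for t also serves d. *)
Lemma psi'_lead d : d != 0 ->
  exists T, fm_coef T d != 0 /\ fm_coef T (psi' d) = bar (fm_coef T d).
Proof.
move=> d0; have ex : exists m, `[< low m.+1 d >].
  by have [m hm] := low_ex d; exists m; apply/asboolP; apply: low_sub hm.
case: (ex_minnP ex) => m /asboolP ld mmin.
pose P T := rsz (T r) = m; pose t := restrict P d.
have lrest : low m (d - t).
  move=> T; rewrite fm_coefD fm_coefN coef_restrict; case: asboolP => [_|PT].
    by rewrite subrr eqxx.
  by rewrite subr0 => /ld; rewrite ltnS leq_eqVlt => /predU1P[/PT|].
have t0 : t != 0.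
  apply/eqP => te; move: lrest; rewrite te subr0 => lm.
  case: m mmin ld {P t te} lm => [|m] mmin ld lm.
    by move/eqP: d0; apply; apply: low_eq0.
  by have := mmin m (@asboolT (low m.+1 d) lm); rewrite ltnn.
have [T [tT eT]] := bl_lead psiP t0; exists T.
move: tT; rewrite /t coef_restrict; case: asboolP => [PT|]; last by rewrite eqxx.
move=> dT; split=> //.
have hl u : low m u -> fm_coef T u = 0.
  by move=> lu; apply/eqP/negPn/negP => /lu; rewrite PT ltnn.
have -> : psi' d = (psi' d - psi d) + (psi (d - t) + psi t).
  by rewrite -psiD subrK subrK.
rewrite fm_coefD (hl _ (psi'_low ld)) fm_coefD (hl _ (psi_low lrest)) !add0r eT.
by rewrite /t coef_restrict; case: asboolP.
Qed.

Lemma empty_symbolE : empty_symbol v r = vac (v r).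
Proof. by []. Qed.

Lemma bar_like_step : bar_like r.+1 psi'.
Proof.
split=> [c u w|i u|k b u rk||d].
- exact: psi'_lin.
- exact: psi'_F.
- rewrite /psi' -Theta_insC // -(bl_ins psiP) 1?ltnW //; congr (Theta (psi _)).
  by apply: Theta_inj; rewrite ThetaVK Theta_insC // ThetaVK.
- rewrite (@sy_ins _ _ _ _ _ r) empty_symbolE -Y_vac psi'_Y.
  by rewrite (bl_vac psiP).
- exact: psi'_lead.
Qed.

End BarStep.

Section BarExists.

Variables (K : fieldType) (q : K) (l : nat) (v : 'I_l -> int).
Variable W : freeMod K (symbol v).
Variable bar : {rmorphism K -> K}.
Hypothesis q0 : q != 0.
Hypothesis q2 : q + q^-1 != 0.
Hypothesis bar_q : bar q = q^-1.

(** With no rows every F_i is 0, so conjugating the coefficients is enough to start the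
    induction. *)
Definition psi_base (u : W) : W := \sum_(S <- fm_supp u) bar (fm_coef S u) *: fm_basis S.

Lemma coef_psi_base T u : fm_coef T (psi_base u) = bar (fm_coef T u).
Proof.
rewrite fm_coef_sum [in RHS](fm_expand u) fm_coef_sum rmorph_sum /=.
apply: eq_bigr => S _; rewrite !fm_coefZ !fm_coef_basis rmorphM.
by case: eqP; rewrite ?rmorph1 ?rmorph0.
Qed.

Lemma bar_like_base : bar_like q bar 0 psi_base.
Proof.
have lin c u w : psi_base (c *: u + w) = bar c *: psi_base u + psi_base w.
  by apply: fm_ext => T; rewrite !(coef_psi_base, fm_coefD, fm_coefZ) rmorphD rmorphM.
have e0 : psi_base 0 = 0.
  by apply: fm_ext => T; rewrite coef_psi_base !fm_coef0 rmorph0.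
have eU S : psi_base (fm_basis S) = fm_basis S.
  by apply: fm_ext => T; rewrite coef_psi_base !fm_coef_basis; case: eqP; rewrite ?rmorph1 ?rmorph0.
split=> [//|i u|k b u _|//|d d0].
- by rewrite !Fn_zero.
- elim/fm_ind: u => [|c u w hu hw|S]; first by rewrite ins0 e0 ins0.
    by rewrite insD insZ !lin hu hw insD insZ.
  by rewrite insU !eU insU.
have [T dT] : exists T, fm_coef T d != 0.
  apply: contrapT => h; move/eqP: d0; apply; apply: fm_ext => T; rewrite fm_coef0.
  by apply/eqP/negPn/negP => dT; apply: h; exists T.
by exists T; rewrite coef_psi_base.
Qed.

Theorem bar_like_exists n : (n <= l)%N -> exists psi : W -> W, bar_like q bar n psi.
Proof.
elim: n => [|n IH] nl; first by exists psi_base; exact: bar_like_base.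
have [psi psiP] := IH (ltnW nl).
exact: (ex_intro _ _ (@bar_like_step _ _ _ _ _ _ q0 q2 bar_q (Ordinal nl) psi psiP)).
Qed.

End BarExists.

(** The Cartan matrix of the doubly infinite type A diagram. *)
Definition crt (i j : int) : int :=
  if i == j then 2 else if (i == j + 1) || (j == i + 1) then -1 else 0.

Lemma crtC i j : crt i j = crt j i.
Proof. by rewrite /crt eq_sym orbC. Qed.

Lemma kap_raise s i j (b : row_of s) : addable j b ->
  kap i (raise_entry b j) = kap i b - crt i j.
Proof.
move=> h; rewrite /kap !addable_mem //; case/andP: h => hj hj1; rewrite /crt.
have -> : (i + 1 == j + 1) = (i == j) by lia.
rewrite [j == i + 1]eq_sym; case: (eqVneq i j) => [->|ij].
  have -> : (j + 1 == j) = false by lia.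
  by rewrite hj (negPf hj1).
case: (eqVneq i (j + 1)) => [->|ij1].
  have -> : (j + 1 + 1 == j) = false by lia.
  by rewrite (negPf hj1) /=; lia.
case: (eqVneq (i + 1) j) => [e|_]; last by rewrite subr0.
by rewrite e hj /=; lia.
Qed.

Lemma kap_lower s i j (b : row_of s) : removable j b ->
  kap i (lower_entry b j) = kap i b + crt i j.
Proof.
by move=> h; rewrite -{2}(lowerK h) kap_raise ?addable_lower // subrK.
Qed.

(** * Divided powers *)

Section EOperators.

Variables (l : nat) (v : 'I_l -> int).
Variable W : freeMod Qq (symbol v).
Implicit Types (S T : symbol v) (r : 'I_l) (i j : int) (u w : W) (n : nat).

Local Notation sy S := (fm_basis S : W).
Local Notation Fn := (@Fn Qq q l v W).
Local Notation ins := (@ins Qq l v W _).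

Definition Ksum n i S : int := \sum_(k < l | (k < n)%N) kap i (S k).

Lemma Ksum_set r (b : row_of (v r)) i S :
  Ksum r.+1 i (set_row S b) = Ksum r i S + kap i b.
Proof.
rewrite /Ksum (bigD1 r) //= set_row_in addrC; congr (_ + _).
apply: eq_big => [k|k /andP[_ kr]]; last by rewrite set_row_out 1?eq_sym.
by have := ltn_ord k; rewrite -(inj_eq (@ord_inj _)); lia.
Qed.

Lemma Ksum_set_out r (b : row_of (v r)) n i S : (n <= r)%N ->
  Ksum n i (set_row S b) = Ksum n i S.
Proof.
move=> nr; apply: eq_bigr => k kn; rewrite set_row_out //.
by rewrite -(inj_eq (@ord_inj _)); lia.
Qed.

(** The action of E_i for the coproduct sending E_i to E_i tensor 1 plus K_i^-1 tensor E_i, which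
    matches the coproduct of F_i. *)
Definition Esym n i S : W :=
  \sum_(j < l | (j < n)%N && removable i (S j))
    q ^ (- Ksum j i S) *: sy (set_row S (lower_entry (S j) i)).

Definition En n i : W -> W := mlin (Esym n i).
HB.instance Definition _ n i := GRing.Linear.on (En n i).

Definition Kinv n i : W -> W := mlin (fun S => q ^ (- Ksum n i S) *: sy S).
HB.instance Definition _ n i := GRing.Linear.on (Kinv n i).

Lemma EnU n i S : En n i (sy S) = Esym n i S.
Proof. exact: mlin_basis. Qed.

Lemma KinvU n i S : Kinv n i (sy S) = q ^ (- Ksum n i S) *: sy S.
Proof. exact: mlin_basis. Qed.

Lemma EnD n i u w : En n i (u + w) = En n i u + En n i w.
Proof. exact: linearD. Qed.
Lemma EnZ n i c u : En n i (c *: u) = c *: En n i u.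
Proof. exact: linearZZ. Qed.
Lemma En0 n i : En n i 0 = 0.
Proof. exact: linear0. Qed.
Lemma KinvD n i u w : Kinv n i (u + w) = Kinv n i u + Kinv n i w.
Proof. exact: linearD. Qed.
Lemma KinvZ n i c u : Kinv n i (c *: u) = c *: Kinv n i u.
Proof. exact: linearZZ. Qed.
Lemma Kinv0 n i : Kinv n i 0 = 0.
Proof. exact: linear0. Qed.

Lemma En_ins r (b : row_of (v r)) i u : En r.+1 i (ins b u) =
  ins b (En r i u) + (if removable i b then ins (lower_entry b i) (Kinv r i u) else 0).
Proof.
elim/fm_ind: u => [|c u w eu ew|S].
- by rewrite !(ins0, En0, Kinv0) if_same addr0.
- rewrite !(fockE, EnD, EnZ, KinvD, KinvZ) eu ew scalerDr -!addrA; congr (_ + _).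
  by rewrite addrCA; case: ifP => _ //; rewrite scaler0 add0r.
rewrite insU !EnU KinvU insZ insU /Esym big_mkcond (bigD1 r) //= addrC; congr (_ + _); last first.
  rewrite ltnSn set_row_in; case: (removable i b) => //=.
  by rewrite set_row_set Ksum_set_out.
rewrite [in RHS]big_mkcond [in RHS](bigD1 r) //= ltnn /= add0r.
rewrite [in RHS](linear_sum (ins b)) /=; apply: eq_bigr => j jr.
rewrite set_row_out 1?eq_sym // (_ : (j < r.+1)%N = (j < r)%N); last first.
  by rewrite ltnS leq_eqVlt -[_ == _ :> nat]/(j == r) (negPf jr).
case: ifP => [/andP[jltr _]|_]; last by rewrite ins0.
rewrite insZ insU Ksum_set_out 1?ltnW //; congr (_ *: fm_basis _).
by rewrite set_rowC // eq_sym.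
Qed.

Lemma En_zero i u : En 0 i u = 0.
Proof.
elim/fm_ind: u => [|c u w eu ew|S]; rewrite ?(EnD, EnZ, En0) //.
  by rewrite eu ew scaler0 addr0.
by rewrite EnU /Esym big1.
Qed.

Lemma Kinv_ins_out r (b : row_of (v r)) n i u : (n <= r)%N ->
  Kinv n i (ins b u) = ins b (Kinv n i u).
Proof.
move=> nr; elim/fm_ind: u => [|c u w eu ew|S]; first by rewrite !(ins0, Kinv0).
  by rewrite !(fockE, KinvD, KinvZ) eu ew.
by rewrite !(insU, KinvU, insZ) Ksum_set_out.
Qed.

Lemma Kinv_Fn n i j u : (n <= l)%N -> Kinv n i (Fn n j u) = q ^ crt i j *: Fn n j (Kinv n i u).
Proof.
move=> nl; elim/fm_ind: u => [|c u w eu ew|S].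
- by rewrite !(Fn0, Kinv0) scaler0.
- by rewrite !(FnD, FnZ, KinvD, KinvZ) eu ew scalerDr !scalerA [_ * c]mulrC.
rewrite KinvU FnZ !FnU /Fsym linear_sum !scaler_sumr; apply: eq_bigr => k /andP[kn ak] /=.
rewrite KinvZ KinvU !scalerA; congr (_ *: _).
have -> : Ksum n i (raise_row S k j) = Ksum n i S - crt i j.
  rewrite /Ksum (bigD1 k) // [in RHS](bigD1 k) //= raise_rowE set_row_in kap_raise //.
  rewrite addrAC; congr (_ + _ - _).
  by apply: eq_bigr => k' /andP[_ kk]; rewrite set_row_out // eq_sym.
by rewrite opprB qD [RHS]mulrC mulrA.
Qed.

Lemma removable_raise_neq s i j (b : row_of s) : i != j ->
  addable j b && removable i (raise_entry b j) = removable i b && addable j (lower_entry b i).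
Proof.
move=> ij; case: (eqVneq i (j + 1)) => [->|h1].
  rewrite [LHS]andbC [RHS]andbC; case: (boolP (addable j b)) => [aj|_]; last first.
    rewrite andbF; case: (boolP (removable (j + 1) b)) => [rj|_]; last by rewrite andbF.
    by rewrite /addable !mem_lower // eqxx /= andbF.
  rewrite {1}/removable !addable_mem // eqxx (_ : (j + 1 == j) = false); last by lia.
  case: (boolP (removable (j + 1) b)) => [rj|_]; last by rewrite andbF.
  by rewrite /addable !mem_lower // eqxx /= andbF.
case: (eqVneq j (i + 1)) => [->|h2].
  have -> : addable (i + 1) b && removable i (raise_entry b (i + 1)) = false.
    case: (boolP (addable _ _)) => //= aj.
    by rewrite /removable !addable_mem // eqxx andbF.
  case: (boolP (removable _ _)) => //= ri.
  rewrite /addable !mem_lower // eqxx andbF orbF.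
  by have -> : (i + 1 == i) = false by lia.
rewrite andbC; case: (boolP (addable j b)) => aj; last first.
  rewrite andbF; case: (boolP (removable i b)) => //= ri.
  by rewrite addable_lower_far ?(negPf aj) //; rewrite eq_sym.
rewrite andbT removable_raise_far 1?eq_sym // 1?eq_sym //.
case: (boolP (removable i b)) => //= ri.
by rewrite addable_lower_far ?aj //; rewrite eq_sym.
Qed.

Lemma raise_lower_neq s i j (b : row_of s) : i != j -> addable j b ->
  removable i (raise_entry b j) -> removable i b -> addable j (lower_entry b i) ->
  lower_entry (raise_entry b j) i = raise_entry (lower_entry b i) j.
Proof.
move=> ij aj ri' ri aj'; apply: row_ext => y.
rewrite mem_lower // addable_mem // [in RHS]addable_mem // mem_lower //.
have : j != i + 1.
  apply/eqP => e; move: ri'; rewrite /removable !addable_mem // e eqxx andbC.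
  by [].
have : i != j + 1.
  apply/eqP => e; move: ri'; rewrite /removable !addable_mem // e eqxx.
  by have -> : (j + 1 == j) = false by lia.
by do ?(case: ifP => ?); lia.
Qed.

(** Induction on rows. Moving K_i^-1 past F_j costs q to the Cartan number, which is also the change
    of K_j when the row is lowered at i; hence the mixed terms cancel. For i = j the contribution of
    the last row is merged by [qnum_add]. *)
Lemma En_Fn n i j S : (n <= l)%N ->
  En n i (Fn n j (sy S)) =
  Fn n j (En n i (sy S)) + (if i == j then qnum (Ksum n i S) *: sy S else 0).
Proof.
elim: n S => [|n IH] S nl.
  rewrite !(Fn_zero, En_zero) add0r /Ksum big_pred0 // qnum0 scale0r if_same //.
have {}IH := IH S (ltnW nl); have [r er] : exists r : 'I_l, n = r by exists (Ordinal nl).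
rewrite {n}er in nl IH *.
have -> : Ksum r.+1 i S = Ksum r i S + kap i (S r).
  by rewrite -[in LHS](set_row_id S r) Ksum_set.
rewrite -[in LHS](set_row_id S r) -[in X in _ = X + _](set_row_id S r) -!insU.
rewrite Fn_ins ?q_neq0 // En_ins; set b := S r.
rewrite (_ : (if i == j then _ else _) = if i == j then qnum (Ksum r i S + kap i b) *: ins b (sy S) else 0);
  last by rewrite insU set_row_id.
rewrite EnD EnZ En_ins IH FnD Fn_ins ?q_neq0 //.
have KF := @Kinv_Fn r i j (sy S) (ltnW nl).
have Kb (c : row_of (v r)) : Kinv r i (ins c (sy S)) = q ^ (- Ksum r i S) *: ins c (sy S).
  by rewrite Kinv_ins_out // KinvU insZ.
case: (eqVneq i j) IH KF => [eij|ij] IH KF.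
- subst j; case: (boolP (addable i b)) => ai.
    have ri : removable i b = false.
      by case/andP: ai => hi _; rewrite /removable hi.
    rewrite ri !addr0 En_ins removable_raise // raiseK // kap_addable // Fn0 addr0 insD insZ.
    rewrite KinvU insZ.
    apply: fm_ext => T; rewrite !(fm_coefD, fm_coefZ) qnum_add qnum1 expr1z.
    ring.
  case: (boolP (removable i b)) => ri.
    rewrite !addr0 En0 addr0 kap_removable // KF !Fn_ins ?q_neq0 // addable_lower // lowerK //.
    rewrite !kap_lower // kap_removable // /crt eqxx.
    rewrite !(insD, insZ, scalerDr, scalerA) KinvU !(insZ, FnZ, scalerA).
    rewrite -(qD (-1) 2) (qnum_add _ (-1)) qnumN qnum1.
    by apply: fm_ext => T; rewrite !(fm_coefD, fm_coefZ); ring.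
  have -> : kap i b = 0.
    by move: ai ri; rewrite /addable /removable /kap; case: (i \in b); case: (i + 1 \in b).
  by rewrite !addr0 En0 Fn0 !addr0 expr0z !scale1r insD insZ.
have Nij := removable_raise_neq b ij.
rewrite !addr0; case: (boolP (addable j b)) Nij => aj /= Nij; case: (boolP (removable i b)) Nij => ri /= Nij.
- rewrite En_ins Nij Fn_ins ?q_neq0 // -Nij.
  rewrite kap_lower // crtC KF !(insD, insZ, scalerDr, scalerA) -qD.
  have -> : (if removable i (raise_entry b j) then ins (lower_entry (raise_entry b j) i) (Kinv r i (sy S)) else 0)
     = (if removable i (raise_entry b j) then ins (raise_entry (lower_entry b i) j) (Kinv r i (sy S)) else 0).
    by case: ifP => // rj; rewrite raise_lower_neq // -Nij.
  move: (kap j b + _) (if _ then _ else _) => e A.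
  by rewrite -!addrA; congr (_ + _); rewrite addrCA.
- by rewrite En_ins Nij Fn0 !addr0.
- by rewrite Fn_ins ?q_neq0 // -Nij En0 kap_lower // crtC KF !(insD, insZ, scalerDr, scalerA) -qD !addr0.
- by rewrite En0 Fn0 !addr0.
Qed.

End EOperators.

Fact Epow_field (K : fieldType) (x y z w : K) : x != 0 -> y != 0 -> z != 0 -> w != 0 ->
  (y - y^-1) / w * ((x * y^-1 * z - x^-1 * y * z^-1) / w)
    + (x * y^-1 * y^-1 - x^-1 * y * y) / w * ((z - z^-1) / w)
  = (y * z - y^-1 * z^-1) / w * ((x * y^-1 - x^-1 * y) / w).
Proof. by move=> *; field; apply/and4P. Qed.

Lemma qnum_Epow (m b : int) :
  qnum b * qnum (m - b + 1) + qnum (m - b - b) = qnum (b + 1) * qnum (m - b).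
Proof.
have e := Epow_field (qX_neq0 m) (qX_neq0 b) q_neq0 qBqV_neq0.
rewrite /qnum !opprD !opprK !qD -!(invr_expz q) expr1z -e; congr (_ + _).
by rewrite (mulfV qBqV_neq0) mulr1.
Qed.

Section DividedPowers.

Variables (l : nat) (v : 'I_l -> int).
Variable W : freeMod Qq (symbol v).
Implicit Types (S T : symbol v) (i j m : int) (u w : W) (a b t : nat).

Local Notation F := (@Fn Qq q l v W l).
Local Notation E := (@En l v W l).
Local Notation K := (@Ksum l v l).

Definition homog i m : W -> Prop := supported (fun T => K i T = m).

Lemma homog_F i j m u : homog i m u -> homog i (m - crt i j) (F j u).
Proof.
move: u; apply: supported_ind => [|c u w hu hw|S hS]; first by rewrite Fn0; apply: supported0.
  rewrite FnD FnZ; exact: supported_lin hu hw.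
rewrite FnU /Fsym; elim/big_rec: _ => [|k w /andP[_ ak] hw]; first exact: supported0.
apply: supported_lin hw; apply: supported_basis.
rewrite -hS /Ksum (bigD1 k) // [in RHS](bigD1 k) //= raise_rowE set_row_in kap_raise //.
rewrite addrAC; congr (_ + _ - _).
by apply: eq_bigr => k' /andP[_ kk]; rewrite set_row_out // eq_sym.
Qed.

Lemma homog_E i j m u : homog i m u -> homog i (m + crt i j) (E j u).
Proof.
move: u; apply: supported_ind => [|c u w hu hw|S hS]; first by rewrite En0; apply: supported0.
  rewrite EnD EnZ; exact: supported_lin hu hw.
rewrite EnU /Esym; elim/big_rec: _ => [|k w /andP[_ ak] hw]; first exact: supported0.
apply: supported_lin hw; apply: supported_basis.
rewrite -hS /Ksum (bigD1 k) // [in RHS](bigD1 k) //= set_row_in kap_lower //.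
rewrite addrAC; congr (_ + _ + _).
by apply: eq_bigr => k' /andP[_ kk]; rewrite set_row_out // eq_sym.
Qed.

Lemma EF_neq i j u : i != j -> E i (F j u) = F j (E i u).
Proof.
move=> ij; elim/fm_ind: u => [|c u w hu hw|S]; first by rewrite !(Fn0, En0).
  by rewrite !(FnD, FnZ, EnD, EnZ) hu hw.
by rewrite En_Fn // (negPf ij) addr0.
Qed.

Lemma EF_homog i m u : homog i m u -> E i (F i u) = F i (E i u) + qnum m *: u.
Proof.
move: u; apply: supported_ind => [|c u w hu hw|S hS]; first by rewrite !(Fn0, En0) scaler0 addr0.
  rewrite !(FnD, FnZ, EnD, EnZ) hu hw.
  by apply: fm_ext => T; rewrite !(fm_coefD, fm_coefZ); ring.
by rewrite En_Fn // eqxx hS.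
Qed.

(** Locked so that simplification keeps divided powers folded; [FdE] opens them. *)
Definition Fd i a u : W := locked ((qfact a)^-1 *: iter a (F i) u).
Definition Ed i a u : W := locked ((qfact a)^-1 *: iter a (E i) u).

Lemma FdE i a u : Fd i a u = (qfact a)^-1 *: iter a (F i) u.
Proof. by rewrite /Fd -lock. Qed.
Lemma EdE i a u : Ed i a u = (qfact a)^-1 *: iter a (E i) u.
Proof. by rewrite /Ed -lock. Qed.

Lemma Fd_linear i a : linear (Fd i a).
Proof.
move=> c u w; rewrite !FdE; have -> : iter a (F i) (c *: u + w) = c *: iter a (F i) u + iter a (F i) w.
  by elim: a => //= a ->; rewrite FnD FnZ.
by rewrite scalerDr !scalerA [_ * c]mulrC.
Qed.
HB.instance Definition _ i a := GRing.isLinear.Build Qq W W *:%R (Fd i a) (Fd_linear i a).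

Lemma Ed_linear i a : linear (Ed i a).
Proof.
move=> c u w; rewrite !EdE; have -> : iter a (E i) (c *: u + w) = c *: iter a (E i) u + iter a (E i) w.
  by elim: a => //= a ->; rewrite EnD EnZ.
by rewrite scalerDr !scalerA [_ * c]mulrC.
Qed.
HB.instance Definition _ i a := GRing.isLinear.Build Qq W W *:%R (Ed i a) (Ed_linear i a).

Lemma FdD i a u w : Fd i a (u + w) = Fd i a u + Fd i a w.
Proof. exact: linearD. Qed.
Lemma FdZ i a c u : Fd i a (c *: u) = c *: Fd i a u.
Proof. exact: linearZZ. Qed.
Lemma Fd_0 i a : Fd i a 0 = 0.
Proof. exact: linear0. Qed.
Lemma EdD i a u w : Ed i a (u + w) = Ed i a u + Ed i a w.
Proof. exact: linearD. Qed.
Lemma EdZ i a c u : Ed i a (c *: u) = c *: Ed i a u.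
Proof. exact: linearZZ. Qed.
Lemma Ed_0 i a : Ed i a 0 = 0.
Proof. exact: linear0. Qed.

Lemma Fd0 i u : Fd i 0 u = u.
Proof. by rewrite FdE qfact0 invr1 scale1r. Qed.

Lemma Ed0 i u : Ed i 0 u = u.
Proof. by rewrite EdE qfact0 invr1 scale1r. Qed.

Lemma F_Fd i a u : F i (Fd i a u) = qint a.+1 *: Fd i a.+1 u.
Proof.
by rewrite !FdE FnZ qfactS invfM scalerA mulrC -mulrA mulVf ?mulr1 //; exact: qint_neq0.
Qed.

Lemma E_Ed i a u : E i (Ed i a u) = qint a.+1 *: Ed i a.+1 u.
Proof.
by rewrite !EdE EnZ qfactS invfM scalerA mulrC -mulrA mulVf ?mulr1 //; exact: qint_neq0.
Qed.

Lemma homog_Fd i m a u : homog i m u -> homog i (m - 2 * a%:Z) (Fd i a u).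
Proof.
move=> hu; rewrite FdE; apply: supportedZ; elim: a => [|a IH] /=; first by rewrite mulr0 subr0.
by have := @homog_F i i _ _ IH; rewrite /crt eqxx (_ : _ - 2 = m - 2 * a.+1%:Z) //; lia.
Qed.

Lemma homog_Ed i m a u : homog i m u -> homog i (m + 2 * a%:Z) (Ed i a u).
Proof.
move=> hu; rewrite EdE; apply: supportedZ; elim: a => [|a IH] /=; first by rewrite mulr0 addr0.
by have := @homog_E i i _ _ IH; rewrite /crt eqxx (_ : _ + 2 = m + 2 * a.+1%:Z) //; lia.
Qed.

Lemma E_Fd i m b u : homog i m u ->
  E i (Fd i b.+1 u) = Fd i b.+1 (E i u) + qnum (m - b%:Z) *: Fd i b u.
Proof.
move=> hu; elim: b => [|b IH].
  have e w : Fd i 1 w = F i w by have := F_Fd i 0 w; rewrite Fd0 qint_qnum qnum1 scale1r.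
  by rewrite !e Fd0 (EF_homog hu) subr0.
have nz := @qint_neq0 b.+2 isT.
(* Multiplying by [b + 2] turns the divided power into F_i applied to the preceding one. *)
apply: (scalerI nz); rewrite -EnZ -F_Fd (EF_homog (@homog_Fd i m b.+1 u hu)) IH FnD (FnZ _ _ _ (qnum _)) !F_Fd.
rewrite scalerDr !scalerA -addrA -scalerDl; congr (_ + _ *: _).
have := qnum_Epow m b.+1; rewrite -[qnum b.+1%:Z]qint_qnum.
have -> : m - b.+1%:Z + 1 = m - b%:Z by lia.
have -> : m - b.+1%:Z - b.+1%:Z = m - 2 * b.+1%:Z by lia.
have -> : qnum (b.+1%:Z + 1) = qint b.+2 by rewrite qint_qnum; congr qnum; lia.
by move=> <-; rewrite [qnum _ * _]mulrC.
Qed.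

(* [F_i^(b - t)], which is [0] for [b < t]. *)
Definition Fdsub i b t u : W := if (t <= b)%N then Fd i (b - t) u else 0.

Lemma FdsubZ i b t c u : Fdsub i b t (c *: u) = c *: Fdsub i b t u.
Proof. by rewrite /Fdsub; case: ifP => _; rewrite ?FdZ ?scaler0. Qed.

Lemma E_Fdsub i m b t u : homog i m u ->
  E i (Fdsub i b t u) = Fdsub i b t (E i u) + qnum (m - b%:Z + t%:Z + 1) *: Fdsub i b t.+1 u.
Proof.
move=> hu; rewrite /Fdsub; case: (ltngtP t b) => [tb|bt|->].
- have [c ec] : exists c, (b - t = c.+1)%N by exists (b - t.+1)%N; lia.
  rewrite ec (@E_Fd i m c u hu) (_ : (b - t.+1 = c)%N); last by lia.
  by congr (_ + qnum _ *: _); lia.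
- by rewrite En0 scaler0 addr0.
by rewrite subnn !Fd0 scaler0 addr0.
Qed.

(** Induction on a, after multiplication by [a + 1]: one more E_i moved through F_i^(b - t)
    contributes to the terms t and t + 1, and [qbinom_commutation] is the resulting recursion. *)
Lemma Ed_Fd i m a b u : homog i m u ->
  Ed i a (Fd i b u) =
  \sum_(t < a.+1) qbinom (m + a%:Z - b%:Z) t *: Fdsub i b t (Ed i (a - t) u).
Proof.
move=> hu; elim: a => [|a IH].
  by rewrite big_ord_recl big_ord0 qbinom0 scale1r addr0 /Fdsub /= subn0 !Ed0.
have nz := @qint_neq0 a.+1 isT.
apply: (scalerI nz); rewrite -E_Ed IH linear_sum scaler_sumr /=.
set n := m + a%:Z - b%:Z.
have -> : m + a.+1%:Z - b%:Z = n + 1 by rewrite /n; lia.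
under eq_bigr => t _.
  rewrite EnZ (@E_Fdsub i _ b t _ (@homog_Ed i m (a - t) u hu)) E_Ed scalerDr scalerA.
  over.
rewrite big_split /= [in LHS]big_ord_recl [in RHS]big_ord_recl /= !qbinom0 !scale1r !subn0 -addrA.
congr (_ + _); first by rewrite /Fdsub /= !subn0 FdZ.
(* The sum is extended by the index t = a, where [a - t] = 0, to match the range of the other
   one. *)
rewrite (_ : \sum_(t < a) _ = \sum_(t < a.+1) (qbinom n t.+1 * qnum (a%:Z - t%:Z)) *:
     Fdsub i b t.+1 (Ed i (a - t) u)); last first.
  rewrite [RHS]big_ord_recr /= subrr qnum0 mulr0 scale0r addr0; apply: eq_bigr => t _.
  rewrite /bump leq0n add1n FdsubZ scalerA; have ta := ltn_ord t.
  have -> : (a - t.+1).+1 = (a - t)%N by lia.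
  by congr (_ * _ *: _); rewrite qint_qnum; congr qnum; lia.
rewrite -big_split; apply: eq_bigr => t _ /=; rewrite -scalerDl scalerA /bump leq0n add1n subSS.
congr (_ *: _); rewrite -qbinom_commutation; congr (_ + _ * qnum _).
by have := ltn_ord t; rewrite /n; lia.
Qed.

(** All terms of [Ed_Fd] but the last contain E_i u = 0, and the last has coefficient 1 by
    [qbinomn]. *)
Lemma Ed_Fd_id i k u : homog i k%:Z u -> E i u = 0 -> Ed i k (Fd i k u) = u.
Proof.
move=> hu Eu; rewrite (Ed_Fd k k hu) big_ord_recr big1 => [|t _].
  by rewrite /= add0r subnn Ed0 addrK qbinomn scale1r /Fdsub leqnn subnn Fd0.
have [c ->] : exists c, (k - t = c.+1)%N by have := ltn_ord t; exists (k - t.+1)%N; lia.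
rewrite EdE iterSr Eu (_ : iter c (E i) 0 = 0).
  by rewrite scaler0 -[0 in X in _ *: X](scale0r (0 : W)) FdsubZ !scale0r scaler0.
by elim: c => //= c ->; rewrite En0.
Qed.

End DividedPowers.

(** * The submodule V and its integral form *)

Section Spans.

Variables (M : lmodType Qq).
Implicit Types (A : Qq -> Prop) (X : M -> Prop) (u w : M).

(** An inductive counterpart of [qspan], for inductions on linear combinations; [qspanE] relates the
    two. *)
Inductive gspan A X : M -> Prop :=
| GSpan0 : gspan A X 0
| GSpanS c x u : A c -> X x -> gspan A X u -> gspan A X (c *: x + u).

Lemma gspan_lin A X c u w : A c -> (forall a b, A a -> A b -> A (a * b)) ->
  gspan A X u -> gspan A X w -> gspan A X (c *: u + w).
Proof.
move=> hc hM hu hw; elim: hu => [|a x y ha hx _ IH]; first by rewrite scaler0 add0r.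
by rewrite scalerDr scalerA -addrA; apply: GSpanS => //; apply: hM.
Qed.

Lemma gspan_mem A X x : A 1 -> X x -> gspan A X x.
Proof. by move=> h1 hx; rewrite -[x]scale1r -[1 *: x]addr0; apply: GSpanS => //; apply: GSpan0. Qed.

End Spans.

Section CanonicalModel.

Variables (l : nat) (v : 'I_l -> int).
Variable W : freeMod Qq (symbol v).
Implicit Types (S T : symbol v) (i j m : int) (u w : W) (a b t n : nat).

Local Notation sy S := (fm_basis S : W).
Local Notation Fn := (@Fn Qq q l v W).
Local Notation F := (Fn l).
Local Notation E := (@En l v W l).
Local Notation Fd := (@Fd l v W).
Local Notation Ed := (@Ed l v W).
Local Notation ins := (@ins Qq l v W _).

Definition word (s : seq int) : W := foldr F (sy (empty_symbol v)) s.
Definition mono (s : seq (int * nat)) : W :=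
  foldr (fun p => Fd p.1 p.2) (sy (empty_symbol v)) s.

Definition VV : W -> Prop := gspan (fun=> True) (fun x => exists s, x = word s).
Definition VVZ : W -> Prop := gspan laurentZ (fun x => exists s, x = mono s).

Lemma VV_lin c u w : VV u -> VV w -> VV (c *: u + w).
Proof. exact: gspan_lin. Qed.

Lemma VV0 : VV 0.
Proof. exact: GSpan0. Qed.

Lemma VV_word s : VV (word s).
Proof. by apply: gspan_mem => //; exists s. Qed.

Lemma VVZs c u : VV u -> VV (c *: u).
Proof. by move=> hu; rewrite -[_ *: _]addr0; apply: VV_lin => //; apply: VV0. Qed.

Lemma VV_ind (Q : W -> Prop) : Q 0 ->
  (forall c s u, VV u -> Q u -> Q (c *: word s + u)) -> forall u, VV u -> Q u.
Proof. by move=> h0 hS u; elim=> // c x w _ [s ->] hw; apply: hS. Qed.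

Lemma VV_F i u : VV u -> VV (F i u).
Proof.
elim=> [|c x w _ [s ->] _ IH]; first by rewrite Fn0; apply: VV0.
by rewrite FnD FnZ; apply: VV_lin => //; rewrite -[F i _]/(word (i :: s)); apply: VV_word.
Qed.

Lemma VV_Fd i a u : VV u -> VV (Fd i a u).
Proof. by move=> hu; rewrite FdE; apply: VVZs; elim: a => //= a; apply: VV_F. Qed.

Lemma VV_mono s : VV (mono s).
Proof. by elim: s => [|p s IH] /=; [apply: (VV_word [::]) | apply: VV_Fd]. Qed.

Lemma VVZ_lin c u w : laurentZ c -> VVZ u -> VVZ w -> VVZ (c *: u + w).
Proof. by move=> hc; apply: gspan_lin => //; exact: laurentZM. Qed.

Lemma VVZ0 : VVZ 0.
Proof. exact: GSpan0. Qed.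

Lemma VVZ_mono s : VVZ (mono s).
Proof. by apply: gspan_mem; [exact: laurentZ1 | exists s]. Qed.

Lemma VVZB u w : VVZ u -> VVZ w -> VVZ (u - w).
Proof.
move=> hu hw; rewrite addrC -scaleN1r; apply: VVZ_lin => //.
by apply: laurentZN; exact: laurentZ1.
Qed.

Lemma VVZ_VV u : VVZ u -> VV u.
Proof.
by elim=> [|c x w _ [s ->] _ IH]; [apply: VV0 | apply: VV_lin => //; apply: VV_mono].
Qed.

Lemma VVZ_Fd i a u : VVZ u -> VVZ (Fd i a u).
Proof.
elim=> [|c x w hc [s ->] _ IH]; first by rewrite Fd_0; apply: VVZ0.
by rewrite FdD FdZ; apply: VVZ_lin => //; apply: (VVZ_mono ((i, a) :: s)).
Qed.

Lemma VVZ_Fdsub i b t u : VVZ u -> VVZ (Fdsub i b t u).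
Proof. by rewrite /Fdsub; case: ifP => _; [apply: VVZ_Fd | move=> _; apply: VVZ0]. Qed.

Lemma E_vac i : E i (sy (empty_symbol v)) = 0.
Proof.
rewrite EnU /Esym big_pred0 // => k; rewrite /removable.
have -> : empty_symbol v k = vac (v k) by [].
by rewrite !mem_vac; lia.
Qed.

Lemma homog_mono i s : exists m, @homog l v W i m (mono s).
Proof.
elim: s => [|[j a] s [m IH]] /=; first by exists (Ksum l i (empty_symbol v)); apply: supported_basis.
rewrite FdE; elim: a => [|a [m' IH']] /=; first by exists m; apply: supportedZ.
exists (m' - crt i j); apply: supportedZ; apply: homog_F.
have := @supportedZ _ _ _ _ (qfact a) _ IH'; rewrite scalerA mulfV ?scale1r //; exact: qfact_neq0.
Qed.

(** E_i^(a) is moved to the right through the monomial: past F_i^(b) this costs Gaussian binomials,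
    which are integral, past F_j^(b) nothing, and E_i kills the empty symbol. *)
Lemma VVZ_Ed i a u : VVZ u -> VVZ (Ed i a u).
Proof.
elim=> [|c x w hc [s ->] _ IH]; first by rewrite Ed_0; apply: VVZ0.
rewrite EdD EdZ; apply: VVZ_lin => //.
elim: s a {IH} => [|[j b] s IH] a.
  case: a => [|a]; first by rewrite Ed0; apply: VVZ_mono.
  rewrite EdE iterSr E_vac (_ : iter a (E i) 0 = 0) ?scaler0; first exact: VVZ0.
  by elim: a => //= a ->; rewrite En0.
have [m hm] := homog_mono i s.
rewrite [mono _]/=; case: (eqVneq i j) => [<-|ij].
  rewrite (@Ed_Fd _ _ _ _ _ a b _ hm); elim/big_rec: _ => [|t y _ hy]; first exact: VVZ0.
  by apply: VVZ_lin => //; [exact: laurentZ_qbinom | apply: VVZ_Fdsub; apply: IH].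
suff -> : Ed i a (Fd j b (mono s)) = Fd j b (Ed i a (mono s)) by apply: VVZ_Fd; apply: IH.
rewrite !FdE EdZ !EdE; congr (_ *: _).
have -> : iter b (F j) ((qfact a)^-1 *: iter a (E i) (mono s)) =
          (qfact a)^-1 *: iter b (F j) (iter a (E i) (mono s)).
  by elim: b => //= b ->; rewrite FnZ.
congr (_ *: _); have h y : E i (iter b (F j) y) = iter b (F j) (E i y).
  by elim: b => //= b IHb; rewrite EF_neq // IHb.
by elim: a => //= a ->; rewrite h.
Qed.

Definition laurent_coefs u := forall T, laurentZ (fm_coef T u).

Lemma laurent_lin c u w : laurentZ c -> laurent_coefs u -> laurent_coefs w -> laurent_coefs (c *: u + w).
Proof.
by move=> hc hu hw T; rewrite fm_coefD fm_coefZ; apply: laurentZD => //; apply: laurentZM.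
Qed.

Lemma laurent0 : laurent_coefs 0.
Proof. by move=> T; rewrite fm_coef0; exact: laurentZ0. Qed.

Lemma laurent_sy S : laurent_coefs (sy S).
Proof. by move=> T; rewrite fm_coef_basis; case: eqP => _; [exact: laurentZ1 | exact: laurentZ0]. Qed.

Lemma laurent_linear (f : {linear W -> W}) u :
  (forall S, laurent_coefs (f (sy S))) -> laurent_coefs u -> laurent_coefs (f u).
Proof.
move=> hf hu; rewrite [u]fm_expand linear_sum; elim/big_rec: _ => [|S y _ hy]; first exact: laurent0.
by rewrite linearZ; apply: laurent_lin.
Qed.

Lemma laurent_ins (r : 'I_l) (b : row_of (v r)) u : laurent_coefs u -> laurent_coefs (ins b u).
Proof. by apply: (laurent_linear (f := ins b)) => S /=; rewrite insU; apply: laurent_sy. Qed.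

Definition Fdn n i a u : W := locked ((qfact a)^-1 *: iter a (Fn n i) u).

Lemma FdnE n i a u : Fdn n i a u = (qfact a)^-1 *: iter a (Fn n i) u.
Proof. by rewrite /Fdn -lock. Qed.

Lemma Fdn_linear n i a : linear (Fdn n i a).
Proof.
move=> c u w; rewrite !FdnE; have -> : iter a (Fn n i) (c *: u + w) = c *: iter a (Fn n i) u + iter a (Fn n i) w.
  by elim: a => //= a ->; rewrite FnD FnZ.
by rewrite scalerDr !scalerA [_ * c]mulrC.
Qed.
HB.instance Definition _ n i a := GRing.isLinear.Build Qq W W *:%R (Fdn n i a) (Fdn_linear n i a).

Lemma Fdn_zero n i u : Fdn n i 0 u = u.
Proof. by rewrite FdnE qfact0 invr1 scale1r. Qed.

(** F_i acts at most once in row r, and the a + 1 moments at which it may do so add up to [a + 1],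
    which the factorial absorbs. So the divided power brings in no denominators. *)
Lemma Fdn_ins_addable (r : 'I_l) (b : row_of (v r)) i a u : addable i b ->
  Fdn r.+1 i a.+1 (ins b u) =
  q ^ a.+1%:Z *: ins b (Fdn r i a.+1 u) + ins (raise_entry b i) (Fdn r i a u).
Proof.
move=> h; rewrite !FdnE !insZ.
have -> : iter a.+1 (Fn r.+1 i) (ins b u) = q ^ a.+1%:Z *: ins b (iter a.+1 (Fn r i) u)
     + qint a.+1 *: ins (raise_entry b i) (iter a (Fn r i) u).
  elim: a => [|a IH].
    by rewrite /= Fn_ins ?q_neq0 // h kap_addable // qint_qnum qnum1 scale1r.
  rewrite iterS IH FnD !FnZ !Fn_ins ?q_neq0 // h kap_addable //.
  rewrite removableNaddable ?removable_raise // kap_removable ?removable_raise // addr0.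
  rewrite scalerDr !scalerA -qD -addrA -scalerDl -!iterS; congr (_ ^ _ *: _ + _ *: _); first by lia.
  rewrite !qint_qnum (_ : a.+2%:Z = 1 + a.+1%:Z); last by lia.
  by rewrite qnum_add qnum1 mulr1 mulrC.
rewrite scalerDr !scalerA; congr (_ *: _ + _ *: _); first by rewrite mulrC.
by rewrite qfactS invfM -mulrA mulVf ?mulr1 //; exact: qint_neq0.
Qed.

Lemma Fdn_ins_nonaddable (r : 'I_l) (b : row_of (v r)) i a u : ~~ addable i b ->
  Fdn r.+1 i a (ins b u) = q ^ (kap i b * a%:Z) *: ins b (Fdn r i a u).
Proof.
move=> h; rewrite !FdnE !insZ scalerA [q ^ _ * _]mulrC -scalerA; congr (_ *: _).
elim: a => [|a IH]; first by rewrite mulr0 expr0z scale1r.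
rewrite iterS IH FnZ Fn_ins ?q_neq0 // (negPf h) addr0 scalerA -qD.
by congr (_ ^ _ *: _); lia.
Qed.

Lemma laurent_Fdn n i a u : (n <= l)%N -> laurent_coefs u -> laurent_coefs (Fdn n i a u).
Proof.
elim: n a u => [|n IH] a u nl.
  case: a => [|a]; first by rewrite Fdn_zero.
  by rewrite FdnE /= Fn_zero scaler0 => _; apply: laurent0.
have [r er] : exists r : 'I_l, n = r by exists (Ordinal nl).
rewrite {n}er in nl IH *; apply: (laurent_linear (f := Fdn r.+1 i a)) => S /=.
rewrite (@sy_ins _ _ _ _ S r); set b := S r.
have IH' a' : laurent_coefs (Fdn r i a' (sy S)) by apply: IH; [exact: ltnW | exact: laurent_sy].
case: (boolP (addable i b)) => h.
  case: a => [|a]; first by rewrite Fdn_zero insU; apply: laurent_sy.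
  rewrite /= Fdn_ins_addable //; apply: laurent_lin; [exact: laurentZ_qX | |]; exact: laurent_ins.
rewrite /= Fdn_ins_nonaddable // -[_ *: _]addr0; apply: laurent_lin; [exact: laurentZ_qX | | exact: laurent0].
exact: laurent_ins.
Qed.

Lemma VVZ_laurent u : VVZ u -> laurent_coefs u.
Proof.
elim=> [|c x w hc [s ->] _ IH]; first exact: laurent0.
apply: laurent_lin => //; elim: s => [|[i a] s IHs]; first exact: laurent_sy.
by rewrite /= FdE -FdnE; apply: laurent_Fdn.
Qed.

End CanonicalModel.

(** * Weights of symbols *)

Section Symbols.

Variables (l : nat) (v : 'I_l -> int).
Implicit Types (S T : symbol v) (i j m : int) (r : 'I_l).

Definition col y S : int := \sum_(k < l) (y \in S k)%:Z.
(** The size is recorded beside the column counts so that homogeneity of G(S) also confines it to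
    the symbols of size n. *)
Definition wt S : (int -> int) * int := (fun y => col y S, symbol_size S).

Definition raise_wt i (w : (int -> int) * int) : (int -> int) * int :=
  (fun y => w.1 y - (y == i)%:Z + (y == i + 1)%:Z, w.2 + 1).

Lemma wt_raise i S r : addable i (S r) -> wt (raise_row S r i) = raise_wt i (wt S).
Proof.
move=> h; rewrite /wt /raise_wt /=; congr pair.
  apply/funext => y; rewrite /col (bigD1 r) //= [in RHS](bigD1 r) //= raise_rowE set_row_in.
  rewrite [RHS](ACl (1*3*4*2))/=; congr (_ + _); last first.
    by apply: eq_bigr => k kr; rewrite set_row_out // eq_sym.
  rewrite addable_mem //; case/andP: h => h1 h2.
  have e : (i == i + 1) = false by lia.
  case: (eqVneq y i) => [->|yi]; first by rewrite e h1.
  by case: (eqVneq y (i + 1)) => [->|_]; rewrite ?(negPf h2) // subr0 addr0.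
rewrite -[LHS]/(\sum_(k < l) row_size (raise_row S r i k)) -[symbol_size S]/(\sum_(k < l) row_size (S k)).
rewrite (bigD1 r) //= [in RHS](bigD1 r) //= raise_rowE set_row_in row_size_raise // addrAC; congr (_ + _ + _).
by apply: eq_bigr => k kr; rewrite set_row_out // eq_sym.
Qed.

Lemma col_full y S : (forall k, y \in S k) <-> col y S = l%:Z.
Proof.
have le k : (y \in S k)%:Z <= 1 by case: (_ \in _).
split=> [h|h].
  rewrite /col (eq_bigr (fun=> 1)) => [|k _]; last by rewrite h.
  by rewrite sumr_const card_ord -mulr_natr mul1r natz.
move=> k; apply/negPn/negP => nk; suff : col y S < l%:Z by rewrite h ltxx.
have -> : l%:Z = \sum_(k < l) (1 : int) by rewrite sumr_const card_ord -mulr_natr mul1r natz.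
rewrite /col (bigD1 k) // [X in _ < X](bigD1 k) //= (negPf nk).
by rewrite ltr_leD //; apply: ler_sum.
Qed.

Lemma col_empty y S : (forall k, y \notin S k) <-> col y S = 0.
Proof.
split=> [h|/eqP]; first by rewrite /col big1 // => k _; rewrite (negPf (h k)).
by rewrite psumr_eq0 => [/allP h k|//]; have := h k (mem_index_enum k); case: (_ \in _).
Qed.

Definition raise_all n i S : symbol v :=
  fun k => if (k < n)%N && addable i (S k) then raise_entry (S k) i else S k.

Definition nb_addable n i S : nat := \sum_(k < l | (k < n)%N) addable i (S k).

Definition no_removable i S := forall k, ~~ removable i (S k).

Lemma Ksum_no_removable n i S : no_removable i S -> Ksum n i S = (nb_addable n i S)%:Z.
Proof.
move=> h; rewrite /Ksum /nb_addable -[RHS]natz natr_sum; apply: eq_bigr => k _; rewrite natz.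
have := h k; rewrite /kap /addable /removable.
by case: (_ \in _); case: (_ \in _).
Qed.

End Symbols.

(** * Bar-invariant integral vectors *)

Section BarModel.

Variables (l : nat) (v : 'I_l -> int).
Variable W : freeMod Qq (symbol v).
Implicit Types (S T : symbol v) (i j m : int) (u w g : W) (a b t n : nat).

Local Notation sy S := (fm_basis S : W).
Local Notation Fn := (@Fn Qq q l v W).
Local Notation F := (Fn l).
Local Notation E := (@En l v W l).
Local Notation Fd := (@Fd l v W).
Local Notation Ed := (@Ed l v W).
Local Notation ins := (@ins Qq l v W _).

(** The vanishing for larger a is carried along because, when row r can be raised, it kills the term
    of [Fdn_ins_addable] that leaves row r alone; the surviving term has coefficient 1. *)
Lemma Fdn_raise_all n i S : (n <= l)%N -> no_removable i S ->
  Fdn n i (nb_addable n i S) (sy S) = sy (raise_all n i S) /\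
  forall a, (nb_addable n i S < a)%N -> Fdn n i a (sy S) = 0.
Proof.
move=> nl hS; elim: n nl => [|n IH] nl.
  have -> : nb_addable 0 i S = 0%N by rewrite /nb_addable big_pred0.
  split=> [|a a0]; first by rewrite Fdn_zero.
  by case: a a0 => // a _; rewrite FdnE /= Fn_zero scaler0.
have [{}IH IH0] := IH (ltnW nl).
have [r er] : exists r : 'I_l, n = r by exists (Ordinal nl).
rewrite {n}er in nl IH IH0 *; set b := S r.
have nbS : nb_addable r.+1 i S = (nb_addable r i S + addable i b)%N.
  rewrite /nb_addable (bigD1 r) //= addnC; congr (_ + _)%N.
  by apply: eq_bigl => k; have := ltn_ord k; rewrite -(inj_eq (@ord_inj _)); lia.
have raE : raise_all r.+1 i S = set_row (raise_all r i S) (if addable i b then raise_entry b i else b).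
  apply: functional_extensionality_dep => k; case: (eqVneq r k) => [<-|rk].
    by rewrite set_row_in /raise_all ltnSn.
  rewrite set_row_out // /raise_all (_ : (k < r.+1)%N = (k < r)%N) //.
  by move: rk; rewrite -(inj_eq (@ord_inj _)); lia.
have eS : sy S = ins b (sy S) by exact: sy_ins.
rewrite nbS raE; case: (boolP (addable i b)) => h.
  rewrite addn1; split=> [|a].
    by rewrite eS Fdn_ins_addable // IH IH0 // ins0 scaler0 add0r insU.
  case: a => // a; rewrite ltnS => ha.
  by rewrite eS Fdn_ins_addable // !IH0 ?ins0 ?scaler0 ?addr0 // ltnW.
have k0 : kap i b = 0.
  have := hS r; rewrite -/b; move: h; rewrite /addable /removable /kap.
  by case: (_ \in _); case: (_ \in _).
rewrite addn0; split=> [|a ha].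
  by rewrite eS Fdn_ins_nonaddable // k0 mul0r expr0z scale1r IH insU.
by rewrite eS Fdn_ins_nonaddable // IH0 // ins0 scaler0.
Qed.

Lemma Fd_raise_all i S : no_removable i S ->
  Fd i (nb_addable l i S) (sy S) = sy (raise_all l i S).
Proof. by move=> h; rewrite FdE -FdnE; case: (Fdn_raise_all (leqnn l) h). Qed.

Definition raise_lin i : W -> W := mlin (fun S => sy (raise_all l i S)).
HB.instance Definition _ i := GRing.Linear.on (raise_lin i).

Lemma E_no_removable i u : supported (no_removable i) u -> E i u = 0.
Proof.
move: u; apply: supported_ind => [|c u w hu hw|S hS]; first by rewrite En0.
  by rewrite EnD EnZ hu hw scaler0 addr0.
by rewrite EnU /Esym big_pred0 // => k; rewrite (negPf (hS k)) andbF.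
Qed.

Lemma Fd_raise_lin i k u : supported (no_removable i) u -> @homog l v W i k%:Z u ->
  Fd i k u = raise_lin i u.
Proof.
move=> h1 h2; have : supported (fun S => no_removable i S /\ nb_addable l i S = k) u.
  move=> S Su; split; first exact: h1.
  by apply/eqP; rewrite -eqz_nat -Ksum_no_removable ?h2 //; apply: h1.
apply: (@supported_ind _ _ _ _ (fun u => Fd i k u = raise_lin i u)) => {u h1 h2} [|c u w hu hw|S [h1 <-]].
- by rewrite Fd_0 linear0.
- by rewrite FdD FdZ hu hw linearP.
by rewrite Fd_raise_all // /raise_lin mlin_basis.
Qed.

Variable psi : W -> W.
Hypothesis psiP : bar_like q barQ l psi.

Lemma psi_F i u : psi (F i u) = F i (psi u). Proof. exact: (bl_F psiP). Qed.
Lemma psi_lin c u w : psi (c *: u + w) = barQ c *: psi u + psi w.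
Proof. exact: (bl_lin psiP). Qed.

Lemma psi_0 : psi 0 = 0.
Proof.
apply: (addIr (psi 0)); rewrite -{1}[psi 0]scale1r -(rmorph1 barQ) -psi_lin.
by rewrite scaler0 !add0r.
Qed.

Lemma psi_Z c u : psi (c *: u) = barQ c *: psi u.
Proof. by rewrite -[c *: u]addr0 psi_lin psi_0 addr0. Qed.

Lemma psi_Fd i a u : psi (Fd i a u) = Fd i a (psi u).
Proof.
rewrite !FdE psi_Z barQ_qfactV; congr (_ *: _).
by elim: a => //= a <-; rewrite psi_F.
Qed.

Lemma psi_word s : psi (word W s) = word W s.
Proof. by elim: s => [|i s IH] /=; [exact: (bl_vac psiP) | rewrite psi_F IH]. Qed.

Lemma psi_VV u : VV u -> VV (psi u).
Proof.
move: u; apply: (@VV_ind _ _ W (fun u => VV (psi u))) => [|c s w _ hw]; first by rewrite psi_0; apply: VV0.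
by rewrite psi_lin psi_word; apply: VV_lin => //; apply: VV_word.
Qed.

Lemma homog_word i s : exists m, @homog l v W i m (word W s).
Proof.
elim: s => [|j s [m IH]] /=; first by exists (Ksum l i (empty_symbol v)); apply: supported_basis.
by exists (m - crt i j); apply: homog_F.
Qed.

(** Moving E_i to the right through a word produces only the bar-invariant coefficients [qnum m], so
    compatibility of [psi] with E_i follows from that with the F_j. *)
Lemma psi_E_word i s : VV (E i (word W s)) /\ psi (E i (word W s)) = E i (word W s).
Proof.
elim: s => [|j s [IH1 IH2]]; first by rewrite /= E_vac psi_0; split=> //; apply: VV0.
have hs := VV_word W s; rewrite [word _ _]/=; case: (eqVneq i j) => [<-|ij]; last first.
  by rewrite EF_neq // psi_F IH2; split=> //; apply: VV_F.
have [m hm] := homog_word i s; rewrite (EF_homog hm) addrC; split.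
  by apply: VV_lin => //; apply: VV_F.
by rewrite psi_lin psi_word barQ_qnum psi_F IH2.
Qed.

Lemma VV_E i u : VV u -> VV (E i u).
Proof.
move: u; apply: (@VV_ind _ _ W (fun u => VV (E i u))) => [|c s w _ hw]; first by rewrite En0; apply: VV0.
by rewrite EnD EnZ; apply: VV_lin => //; case: (psi_E_word i s).
Qed.

Lemma psi_E i u : VV u -> psi (E i u) = E i (psi u).
Proof.
move: u; apply: (@VV_ind _ _ W (fun u => psi (E i u) = E i (psi u))) => [|c s w _ hw]; first by rewrite En0 psi_0 En0.
rewrite EnD EnZ !psi_lin EnD EnZ hw psi_word; congr (_ *: _ + _).
by case: (psi_E_word i s).
Qed.

Lemma psi_Ed i a u : VV u -> psi (Ed i a u) = Ed i a (psi u).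
Proof.
move=> hu; rewrite !EdE psi_Z barQ_qfactV; congr (_ *: _).
suff [] : VV (iter a (E i) u) /\ psi (iter a (E i) u) = iter a (E i) (psi u) by [].
by elim: a => [//|a [h1 h2]] /=; rewrite psi_E // h2; split=> //; apply: VV_E.
Qed.

Definition bar_integral u := VVZ u /\ psi u = u.

(* Here [raise_lin i] is [F_i^(k)], and [E_i^(k)] is its inverse. *)
Lemma bar_integral_raise i k u : supported (no_removable i) u -> @homog l v W i k%:Z u ->
  bar_integral u <-> bar_integral (raise_lin i u).
Proof.
move=> h1 h2; rewrite -(Fd_raise_lin h1 h2); split=> -[hu e].
  by split; [apply: VVZ_Fd | rewrite psi_Fd e].
have eu := Ed_Fd_id h2 (E_no_removable h1).
split; first by rewrite -eu; apply: VVZ_Ed.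
by rewrite -eu psi_Ed ?e //; apply: VVZ_VV.
Qed.

Definition q_regular u := forall T, exists2 c, regular0 c & fm_coef T u = q * c.

(* A coefficient [c] of [u] is a Laurent polynomial in [q R]; if it is also
   bar-invariant, it vanishes. Such a coefficient is provided by [bl_lead]. *)
Lemma bar_integral_unique u : bar_integral u -> q_regular u -> u = 0.
Proof.
move=> [hu e] hr; apply/eqP/negPn/negP => u0.
have [T [nT eT]] := bl_lead psiP u0; rewrite e in eT.
have [c hc ec] := hr T.
by move/eqP: nT; apply; apply: (bar_laurent_regular0 _ hc ec) => //; apply: VVZ_laurent.
Qed.

Lemma bar_integralB u w : bar_integral u -> bar_integral w -> bar_integral (u - w).
Proof.
move=> [hu eu] [hw ew]; split; first exact: VVZB.
by rewrite addrC -scaleN1r psi_lin eu ew rmorphN rmorph1.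
Qed.

Definition of_wt (x : (int -> int) * int) : symbol v -> Prop := fun T => wt T = x.

Lemma of_wt_F i x u : supported (of_wt x) u -> supported (of_wt (raise_wt i x)) (F i u).
Proof.
move: u; apply: supported_ind => [|c u w hu hw|S hS]; first by rewrite Fn0; apply: supported0.
  rewrite FnD FnZ; exact: supported_lin hu hw.
rewrite FnU /Fsym; elim/big_rec: _ => [|k w /andP[_ ak] hw]; first exact: supported0.
by apply: supported_lin hw; apply: supported_basis; rewrite /of_wt wt_raise // hS.
Qed.

Lemma of_wt_word s : exists x, supported (of_wt x) (word W s).
Proof.
elim: s => [|i s [x IH]]; first by exists (wt (empty_symbol v)); apply: supported_basis.
by exists (raise_wt i x); apply: of_wt_F.
Qed.

Lemma of_wt_mono s : exists x, supported (of_wt x) (mono W s).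
Proof.
elim: s => [|[i a] s [x IH]] /=; first by exists (wt (empty_symbol v)); apply: supported_basis.
rewrite FdE; suff [y hy] : exists y, supported (of_wt y) (iter a (F i) (mono W s)).
  by exists y; apply: supportedZ.
elim: a => [|a [y hy]] /=; first by exists x.
by exists (raise_wt i y); apply: of_wt_F.
Qed.

Lemma restrict_of_wt x y u : supported (of_wt y) u ->
  restrict (of_wt x) u = u \/ restrict (of_wt x) u = 0.
Proof.
move=> hu; case: (pselect (y = x)) => [<-|yx]; first by left; apply: restrict_supported hu _.
by right; apply: restrict_disjoint hu _ => T h e; apply: yx; exact: etrans (esym h) e.
Qed.

(** Words and monomials are homogeneous, so the projection to a weight keeps or kills each of
    them. *)
Lemma bar_integral_restrict x u : bar_integral u -> bar_integral (restrict (of_wt x) u).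
Proof.
move=> [hu e]; have hv := VVZ_VV hu; split.
  elim: hu => [|c y w hc [s ->] _ hw]; first by rewrite linear0; apply: VVZ0.
  rewrite linearP /=; apply: VVZ_lin => //; have [z hz] := of_wt_mono s.
  by case: (restrict_of_wt x hz) => ->; [apply: VVZ_mono | apply: VVZ0].
rewrite -{2}e; move: u hv {hu e}.
apply: (@VV_ind _ _ W (fun u => psi (restrict (of_wt x) u) = restrict (of_wt x) (psi u))) => [|c s w _ hw].
  by rewrite psi_0 linear0 psi_0.
rewrite linearP /= !psi_lin [in RHS]linearP /= hw psi_word; congr (_ *: _ + _).
have [z hz] := of_wt_word s.
by case: (restrict_of_wt x hz) => ->; rewrite ?psi_word ?psi_0.
Qed.

(* The projection of [g] to the weight of [S] satisfies the same conditions, so it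
   equals [g] by uniqueness. *)
Lemma bar_integral_homog S g : bar_integral g -> q_regular (g - sy S) ->
  supported (of_wt (wt S)) g.
Proof.
move=> hg hS; suff eg : g - restrict (of_wt (wt S)) g = 0.
  move=> T; rewrite -[g in fm_coef _ g]subr0 -eg subKr coef_restrict.
  by case: asboolP => // _; rewrite eqxx.
apply: bar_integral_unique; first by apply: bar_integralB => //; apply: bar_integral_restrict.
move=> T; rewrite fm_coefD fm_coefN coef_restrict; case: asboolP => hT.
  by exists 0; [exact: regular0_0 | rewrite subrr mulr0].
have [c hc] := hS T; rewrite fm_coefD fm_coefN fm_coef_basis.
(* As T has another weight than S, it differs from S, and [sy S] contributes nothing at T. *)
case: eqP hT => [->|_ _]; first by case.
by rewrite !subr0 => ->; exists c.
Qed.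

End BarModel.

(** * Removal of a full column *)

Section SymbolMaps.

Variables (l : nat) (v : 'I_l -> int).
Implicit Types (S T : symbol v) (i x y z : int).

Local Notation v' := (multicharge_pred v).

Lemma symbol_ext S T : (forall k z, (z \in S k) = (z \in T k)) -> S = T.
Proof. by move=> h; apply: functional_extensionality_dep => k; apply: row_ext => z; apply: h. Qed.

Definition sw i z : int := if z == i then i + 1 else if z == i + 1 then i else z.

Definition lower_all i S : symbol v :=
  fun k => if removable i (S k) then lower_entry (S k) i else S k.

Definition no_addable i S := forall k, ~~ addable i (S k).

(** Exchanging i and i + 1 does not affect a row with both or neither, and no row has i + 1 alone,
    so raising acts on every row as this transposition. *)
Lemma mem_raise_all i S k z : no_removable i S -> (z \in raise_all l i S k) = (sw i z \in S k).
Proof.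
move=> h; rewrite /raise_all ltn_ord /=; have := h k; rewrite /sw.
have e : (i + 1 == i) = false by lia.
case: (boolP (addable i (S k))) => ha.
  move=> _; rewrite addable_mem //; case/andP: ha => h1 h2.
  by case: (eqVneq z i) => [_|_]; [rewrite (negPf h2) | case: eqP => // _; rewrite h1].
move: ha; rewrite /addable /removable.
case: (eqVneq z i) => [->|_]; last case: (eqVneq z (i + 1)) => [->|//];
  by case: (i \in _); case: (i + 1 \in _).
Qed.

Lemma mem_lower_all i S k z : no_addable i S -> (z \in lower_all i S k) = (sw i z \in S k).
Proof.
move=> h; rewrite /lower_all; have := h k; rewrite /sw.
have e : (i + 1 == i) = false by lia.
case: (boolP (removable i (S k))) => ha.
  move=> _; rewrite mem_lower //; case/andP: ha => h1 h2.
  case: (eqVneq z i) => [_|_]; first by rewrite h2.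
  by case: eqP => _; rewrite ?andbF ?andbT // (negPf h1).
move: ha; rewrite /addable /removable.
case: (eqVneq z i) => [->|_]; last case: (eqVneq z (i + 1)) => [->|//];
  by case: (i \in _); case: (i + 1 \in _).
Qed.

Lemma swK i : involutive (sw i).
Proof.
move=> z; rewrite /sw; have e : (i + 1 == i) = false by lia.
case: (eqVneq z i) => [->|zi]; first by rewrite e eqxx.
case: (eqVneq z (i + 1)) => [->|zi1]; first by rewrite eqxx.
by rewrite (negPf zi) (negPf zi1).
Qed.

Lemma lower_all_no_removable i S : no_addable i S -> no_removable i (lower_all i S).
Proof.
move=> h k; rewrite /removable !mem_lower_all // /sw !eqxx.
have -> : (i + 1 == i) = false by lia.
by have := h k; rewrite /addable; case: (_ \in _); case: (_ \in _).
Qed.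

Lemma lower_allK i S : no_addable i S -> raise_all l i (lower_all i S) = S.
Proof.
move=> h; apply: symbol_ext => k z.
by rewrite mem_raise_all ?mem_lower_all ?swK //; apply: lower_all_no_removable.
Qed.

Lemma col_lower_all i S z : no_addable i S -> col z (lower_all i S) = col (sw i z) S.
Proof. by move=> h; apply: eq_bigr => k _; rewrite mem_lower_all. Qed.

Definition full x S := forall k, x \in S k.
Definition empty x S := forall k, x \notin S k.

Lemma full_no_addable x S : full (x + 1) S -> no_addable x S.
Proof. by move=> h k; rewrite /addable h andbF. Qed.

Lemma empty_no_addable x S : empty x S -> no_addable x S.
Proof. by move=> h k; rewrite /addable (negPf (h k)). Qed.

Lemma empty_no_removable x S : empty (x + 1) S -> no_removable x S.
Proof. by move=> h k; rewrite /removable (negPf (h k)) andbF. Qed.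

Lemma Ksum_col i S : Ksum l i S = col i S - col (i + 1) S.
Proof.
rewrite /Ksum /col -sumrB; apply: eq_big => [k|k _]; first by rewrite ltn_ord.
by [].
Qed.

Definition shift_symbol S : symbol v' := fun k => shift_row (S k).

Lemma mem_shift_symbol S k z : (z \in shift_symbol S k) = (z + 1 \in S k).
Proof. exact: mem_shift_row. Qed.

Lemma mem_remove_symbol x S k z : full x S ->
  (z \in remove_symbol x S k) = (z \in S k) && (z != x).
Proof. by move=> h; rewrite /remove_symbol mem_remove_entry. Qed.

Lemma remove_symbol_inj x S T : full x S -> full x T ->
  remove_symbol x S = remove_symbol x T -> S = T.
Proof.
move=> hS hT e; apply: symbol_ext => k z; have := mem_remove_symbol k z hS.
rewrite e mem_remove_symbol //; case: (eqVneq z x) => [->|]; first by rewrite hS hT.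
by rewrite !andbT.
Qed.

Lemma shift_symbol_inj S T : shift_symbol S = shift_symbol T -> S = T.
Proof.
move=> e; apply: symbol_ext => k z.
by rewrite -[z](subrK 1) -!mem_shift_symbol e.
Qed.

(** Closes the gap at x by moving the entries above it down; [insubd] falls back on b only if x is
    an entry. *)
Definition close_row s x (b : row_of s) : row_of s :=
  insubd b (fun k => if x < b k then b k - 1 else b k).

Lemma mem_close_row s x (b : row_of s) z : x \notin b ->
  (z \in close_row x b) = if z < x then z \in b else z + 1 \in b.
Proof.
move=> nx; have nb k : b k != x by apply: contra nx => /eqP <-; apply/mem_row_funP; exists k.
have cE k : close_row x b k = if x < b k then b k - 1 else b k.
  rewrite /close_row insubdK //; apply/asboolP; split=> [m m' mm'|].
    have lt_b := row_fun_lt b mm'; have nm := nb m; have nm' := nb m'.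
    by case: ifP => ?; case: ifP => ?; lia.
  have [N bN] := row_fun_vac b; exists (maxn N (`|s - x|%N).+1) => m Mm.
  rewrite bN; last by lia.
  by case: ifP => ?; lia.
apply/mem_row_funP/idP => [[k <-]|].
  rewrite cE; have nk := nb k; case: (ltP x (b k)) => xk.
    by rewrite ifF ?subrK; [apply/mem_row_funP; exists k | lia].
  by rewrite ifT; [apply/mem_row_funP; exists k | lia].
case: ifP => zx /mem_row_funP[k e]; exists k; rewrite cE e; first by rewrite ifF //; lia.
by rewrite ifT ?addrK //; have := nb k; lia.
Qed.

Definition close x S : symbol v := fun k => close_row x (S k).

Lemma mem_close x S k z : empty x S -> (z \in close x S k) = if z < x then z \in S k else z + 1 \in S k.
Proof. by move=> h; apply: mem_close_row. Qed.

End SymbolMaps.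

Section SymbolBijections.

Variables (l : nat) (v : 'I_l -> int).
Local Notation v' := (multicharge_pred v).
Implicit Types (S : symbol v) (T : symbol v') (x y z : int).

(** On either side column x ends up empty and the former column x sits at x + 1. *)
Lemma raise_remove x S : full (x + 1) S ->
  raise_all l x (remove_symbol (x + 1) S) = remove_symbol x (lower_all x S).
Proof.
move=> h; have na := full_no_addable h.
have e : (x + 1 == x) = false by lia.
have hf : full x (lower_all x S) by move=> k; rewrite mem_lower_all // /sw eqxx.
have hn : no_removable x (remove_symbol (x + 1) S).
  by move=> k; rewrite /removable !mem_remove_symbol // eqxx andbF andbF.
apply: symbol_ext => k z; rewrite mem_raise_all // !mem_remove_symbol // mem_lower_all // /sw.
case: (eqVneq z x) => [_|zx]; first by rewrite !eqxx !andbF.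
case: (eqVneq z (x + 1)) => [_|zx1]; first by rewrite eq_sym e.
by rewrite zx1.
Qed.

(** Swapping the empty column x with the next one moves the gap up without affecting the result of
    closing it. *)
Lemma close_lower x (T : symbol v) : empty x T -> close (x + 1) (lower_all x T) = close x T.
Proof.
move=> h; have na := empty_no_addable h.
have h1 : empty (x + 1) (lower_all x T).
  move=> k; rewrite mem_lower_all // /sw eqxx; have -> : (x + 1 == x) = false by lia.
  exact: h.
apply: symbol_ext => k z; rewrite !mem_close // !mem_lower_all // /sw.
have nxk := h k.
case: (ltP z x) => zx.
  have -> : z < x + 1 by lia.
  have -> : (z == x) = false by lia.
  by have -> : (z == x + 1) = false by lia.
case: (eqVneq z x) => [->|zx'].
  by have -> : x < x + 1 by lia.
have -> : (z < x + 1) = false by lia.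
have -> : (z + 1 == x) = false by lia.
by have -> : (z + 1 == x + 1) = false by lia.
Qed.

(** Closing the gap shifts the entries above x and keeps those below. As everything up to x is full,
    the shift takes the lower part to the same set of values. *)
Lemma close_remove x S : (forall y, y <= x -> full y S) ->
  close x (remove_symbol x S) = shift_symbol S.
Proof.
move=> h; have hx := h x (lexx x).
have he : empty x (remove_symbol x S) by move=> k; rewrite mem_remove_symbol // eqxx andbF.
apply: symbol_ext => k z; rewrite mem_close // !mem_remove_symbol // mem_shift_symbol.
case: ltP => zx.
  by rewrite !h ?lt_eqF //; lia.
have -> : (z + 1 != x) by lia.
by rewrite andbT.
Qed.

Lemma close_id x (T : symbol v) : (forall y, x <= y -> empty y T) -> close x T = T.
Proof.
move=> h; apply: symbol_ext => k z; rewrite mem_close; last exact: h.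
case: ltP => // xz; rewrite (negPf (h _ xz k)).
by apply/negbTE/h; lia.
Qed.

Lemma remove_surj x T : empty x T -> exists S, full x S /\ remove_symbol x S = T.
Proof.
move=> h; have [f hf] : exists f : forall k, row_of (v k), forall k z, (z \in f k) = (z == x) || (z \in T k).
  have H k := cid (@insert_row (v k) x (T k) (h k)).
  by exists (fun k => projT1 (H k)) => k z; rewrite (projT2 (H k)).
have fl : full x f by move=> k; rewrite hf eqxx.
exists f; split=> //; apply: symbol_ext => k z.
rewrite mem_remove_symbol // hf; case: (eqVneq z x) => [->|]; last by rewrite andbT.
by rewrite /= (negPf (h k)).
Qed.

End SymbolBijections.

(** * Transport along column swaps, closing of gaps and the shift *)

Section Transfer.

Variables (l : nat) (v : 'I_l -> int).
Variable W : freeMod Qq (symbol v).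
Variable psi : W -> W.
Hypothesis psiP : bar_like q barQ l psi.
Implicit Types (S T : symbol v) (u w : W) (x y z : int) (c : int -> int).

Local Notation sy S := (fm_basis S : W).
Local Notation bar_integral := (@bar_integral l v W psi).

Definition of_col c : symbol v -> Prop := fun T => forall y, col y T = c y.

Definition lower_lin x : W -> W := mlin (fun S => sy (lower_all x S)).
HB.instance Definition _ x := GRing.Linear.on (lower_lin x).

Lemma mlin_supported (I : choiceType) (M : freeMod Qq I) (P : symbol v -> Prop) (Q : I -> Prop)
    (f : symbol v -> I) u :
  (forall S, P S -> Q (f S)) -> supported P u ->
  supported Q (mlin (fun S => fm_basis (f S) : M) u).
Proof.
move=> h; move: u; apply: supported_ind => [|c u w hu hw|S hS]; first by rewrite linear0; apply: supported0.
  rewrite linearP; exact: supported_lin hu hw.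
rewrite mlin_basis; apply: supported_basis; exact: h.
Qed.

Lemma bar_integral_lower x c u : supported (of_col c) u -> supported (@no_addable _ _ x) u ->
  c x <= c (x + 1) -> bar_integral (lower_lin x u) <-> bar_integral u.
Proof.
(* The weight of the lowered vector, which is the number of rows that [raise_lin] moves; the
   inequality on c makes it nonnegative. *)
move=> hc ha cx; pose k := absz (c (x + 1) - c x)%R.
have e : raise_lin x (lower_lin x u) = u.
  move: ha; move: u {hc}; apply: supported_ind => [|a u w hu hw|S hS]; first by rewrite !linear0.
    by rewrite !linearP /= hu hw.
  by rewrite /lower_lin mlin_basis /raise_lin mlin_basis lower_allK.
have h1 : supported (no_removable x) (lower_lin x u).
  by apply: mlin_supported ha => S; apply: lower_all_no_removable.
have h2 : homog x k%:Z (lower_lin x u).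
  have hca : supported (fun S => no_addable x S /\ of_col c S) u.
    by move=> S hS; split; [exact: ha | exact: hc].
  apply: mlin_supported hca => S [hS hcS].
  rewrite Ksum_col !col_lower_all // /sw !eqxx.
  have -> : (x + 1 == x) = false by lia.
  by rewrite !hcS /k; lia.
have H := bar_integral_raise psiP h1 h2; rewrite e in H; exact: H.
Qed.

Lemma supported_lower_col x c u : supported (of_col c) u -> supported (@no_addable _ _ x) u ->
  supported (of_col (c \o sw x)) (lower_lin x u).
Proof.
move=> hc ha; have hca : supported (fun S => no_addable x S /\ of_col c S) u.
  by move=> S hS; split; [exact: ha | exact: hc].
by apply: mlin_supported hca => S [hS hcS] y; rewrite col_lower_all.
Qed.

Definition close_lin x : W -> W := mlin (fun S => sy (close x S)).
HB.instance Definition _ x := GRing.Linear.on (close_lin x).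

Lemma supported_full x c u : supported (of_col c) u -> c x = l%:Z -> supported (@full _ _ x) u.
Proof. by move=> hc cx S hS; apply/col_full; rewrite (hc S hS). Qed.

Lemma supported_empty x c u : supported (of_col c) u -> c x = 0 -> supported (@empty _ _ x) u.
Proof. by move=> hc cx S hS; apply/col_empty; rewrite (hc S hS). Qed.

Lemma col_ge0 y S : 0 <= col y S.
Proof. by apply: sumr_ge0. Qed.

Lemma col_le y S : col y S <= l%:Z.
Proof.
have -> : l%:Z = \sum_(k < l) (1 : int) by rewrite sumr_const card_ord -mulr_natr mul1r natz.
by apply: ler_sum => k _; case: (_ \in _).
Qed.

Lemma mlin_eq (I : choiceType) (M : freeMod Qq I) (P : symbol v -> Prop) (f g : {linear W -> M}) u :
  (forall S, P S -> f (sy S) = g (sy S)) -> supported P u -> f u = g u.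
Proof.
move=> h; move: u; apply: supported_ind => [|c u w hu hw|S hS]; first by rewrite !linear0.
  by rewrite !linearP hu hw.
exact: h.
Qed.

(** Each swap moves the empty column up by one; after d of them nothing lies above the gap and
    closing it changes nothing. *)
Lemma bar_integral_close d x c u : supported (of_col c) u -> (forall y, 0 <= c y) -> c x = 0 ->
  (forall y, x + d%:Z <= y -> c y = 0) ->
  bar_integral (close_lin x u) <-> bar_integral u.
Proof.
elim: d x c u => [|d IH] x c u hc c0 cx ctop.
  suff -> : close_lin x u = u by [].
  have H : supported (fun S => forall y, x <= y -> empty y S) u.
    by move=> S hS y xy; apply/col_empty; rewrite (hc S hS) ctop // addr0.
  apply: (@supported_ind _ _ _ _ (fun u => close_lin x u = u) _ _ _ u H) => [|a w w' hw hw'|S hS].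
  - by rewrite linear0.
  - by rewrite linearP /= hw hw'.
  by rewrite /close_lin mlin_basis close_id.
have he := supported_empty hc cx.
have ha : supported (@no_addable _ _ x) u by apply: supported_sub he => S; apply: empty_no_addable.
rewrite -(bar_integral_lower hc ha) ?cx //.
have -> : close_lin x u = close_lin (x + 1) (lower_lin x u).
  have H S : empty x S -> close_lin x (sy S) = (close_lin (x + 1) \o lower_lin x) (sy S).
    by move=> hS; rewrite /= /lower_lin mlin_basis /close_lin !mlin_basis close_lower.
  exact: (mlin_eq H he).
apply: (IH _ (c \o sw x)) => [|y||y xy] /=.
- exact: supported_lower_col.
- exact: c0.
- rewrite /sw eqxx; have -> : (x + 1 == x) = false by lia.
  exact: cx.
rewrite /sw; case: eqP => [yx|yx]; first by lia.
by case: eqP => [_ //|yx1]; apply: ctop; lia.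
Qed.

End Transfer.

Section Shift.

Variables (l : nat) (v : 'I_l -> int).
Local Notation v' := (multicharge_pred v).
Variables (W : freeMod Qq (symbol v)) (W' : freeMod Qq (symbol v')).
Variables (psi : W -> W) (psi' : W' -> W').
Hypothesis psiP : bar_like q barQ l psi.
Hypothesis psi'P : bar_like q barQ l psi'.
Implicit Types (S : symbol v) (u w : W) (x y z i : int) (c : int -> int).

Definition shift_lin : W -> W' := mlin (fun S => fm_basis (shift_symbol S) : W').
HB.instance Definition _ := GRing.Linear.on shift_lin.

Lemma shift_addable S k i : addable (i - 1) (shift_symbol S k) = addable i (S k).
Proof. by rewrite /addable !mem_shift_symbol subrK. Qed.

Lemma shift_raise S k i : addable i (S k) ->
  shift_symbol (raise_row S k i) = raise_row (shift_symbol S) k (i - 1).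
Proof.
move=> h; have h' : addable (i - 1) (shift_symbol S k) by rewrite shift_addable.
apply: symbol_ext => k' z; rewrite mem_shift_symbol !raise_rowE.
case: (eqVneq k k') => [<-|kk]; last by rewrite !set_row_out // mem_shift_symbol.
rewrite !set_row_in !addable_mem // mem_shift_symbol subrK.
have -> : (z == i - 1) = (z + 1 == i) by lia.
by have -> : (z + 1 == i + 1) = (z == i) by lia.
Qed.

Lemma shift_F i u : shift_lin (Fn q l i u) = Fn q l (i - 1) (shift_lin u).
Proof.
elim/fm_ind: u => [|c u w hu hw|S]; first by rewrite Fn0 (linear0 shift_lin) /= Fn0.
  by rewrite FnD FnZ !(linearP shift_lin) /= hu hw FnD FnZ.
rewrite /shift_lin mlin_basis !FnU /Fsym linear_sum; apply: eq_big => [k|k /andP[_ hk]].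
  by rewrite shift_addable.
rewrite linearZ /= mlin_basis shift_raise //; congr (_ ^ _ *: _).
by apply: eq_bigr => k' _; rewrite /kap !mem_shift_symbol subrK.
Qed.

Lemma shift_Fd i a u : shift_lin (Fd i a u) = Fd (i - 1) a (shift_lin u).
Proof.
rewrite !FdE linearZ /=; congr (_ *: _).
by elim: a => //= a <-; rewrite shift_F.
Qed.

Lemma shift_vac : shift_lin (fm_basis (empty_symbol v)) = fm_basis (empty_symbol v').
Proof.
rewrite /shift_lin mlin_basis; congr fm_basis; apply: symbol_ext => k z.
rewrite mem_shift_symbol.
have -> : empty_symbol v k = vac (v k) by [].
have -> : empty_symbol v' k = vac (v' k) by [].
by rewrite !mem_vac /multicharge_pred; lia.
Qed.

Lemma shift_word s : shift_lin (word W s) = word W' [seq i - 1 | i <- s].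
Proof. by elim: s => [|i s IH] /=; [exact: shift_vac | rewrite shift_F IH]. Qed.

Lemma shift_mono s : shift_lin (mono W s) = mono W' [seq (p.1 - 1, p.2) | p <- s].
Proof. by elim: s => [|p s IH] /=; [exact: shift_vac | rewrite shift_Fd IH]. Qed.

Lemma coef_inj_lin (W2 : freeMod Qq (symbol v')) (P : symbol v -> Prop) (f : symbol v -> symbol v') u :
  (forall S T, P S -> P T -> f S = f T -> S = T) -> supported P u ->
  forall S, P S -> fm_coef (f S) (mlin (fun S => fm_basis (f S) : W2) u) = fm_coef S u.
Proof.
move=> hf hu S hS; move: u hu; apply: supported_ind => [|c u w hu hw|T hT].
- by rewrite linear0 !fm_coef0.
- by rewrite linearP /= !(fm_coefD, fm_coefZ) hu hw.
rewrite mlin_basis !fm_coef_basis; congr (_%:R); congr nat_of_bool.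
by apply/eqP/eqP => [/hf->|->].
Qed.

Lemma shift_inj u : shift_lin u = 0 -> u = 0.
Proof.
move=> e; apply: fm_ext => S; rewrite fm_coef0.
have H := @coef_inj_lin W' (fun=> True) (@shift_symbol l v) u.
by rewrite -H // -/shift_lin; [rewrite -/(shift_lin u) e fm_coef0 | move=> S1 S2 _ _; apply: shift_symbol_inj].
Qed.

Lemma shift_psi u : VV u -> psi' (shift_lin u) = shift_lin (psi u).
Proof.
move: u; apply: (@VV_ind _ _ W (fun u => psi' (shift_lin u) = shift_lin (psi u))) => [|c s w _ hw].
  by rewrite (psi_0 psiP) linear0 (psi_0 psi'P).
rewrite linearP /= (psi_lin psiP) (psi_lin psi'P) [in RHS]linearP /= hw; congr (_ *: _ + _).
by rewrite (psi_word psiP) shift_word (psi_word psi'P).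
Qed.

Lemma shift_VVZ u : VVZ u -> VVZ (shift_lin u).
Proof.
elim=> [|c x w hc [s ->] _ IH]; first by rewrite linear0; apply: VVZ0.
by rewrite linearP /=; apply: VVZ_lin => //; rewrite shift_mono; apply: VVZ_mono.
Qed.

Lemma VVZ_shift (w : W') : VVZ w -> exists2 u, VVZ u & shift_lin u = w.
Proof.
elim=> [|c x w' hc [s ->] _ [u hu <-]]; first by exists 0; [apply: VVZ0 | rewrite linear0].
exists (c *: mono W [seq (p.1 + 1, p.2) | p <- s] + u).
  by apply: VVZ_lin => //; apply: VVZ_mono.
rewrite linearP /= shift_mono; congr (_ *: mono _ _ + _).
by rewrite -map_comp -[RHS]map_id; apply: eq_map => -[i a] /=; rewrite addrK.
Qed.

(** The shift carries F_i to F_(i-1) and permutes the generating monomials bijectively; the converse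
    pulls back along it by injectivity. *)
Lemma bar_integral_shift u : bar_integral psi u <-> bar_integral psi' (shift_lin u).
Proof.
split=> -[hu e].
  by split; [apply: shift_VVZ | rewrite shift_psi ?e //; apply: VVZ_VV].
have [u' hu' eu] := VVZ_shift hu.
have <- : u' = u.
  by apply/eqP; rewrite -subr_eq0; apply/eqP/shift_inj; rewrite linearB /= eu subrr.
split=> //; apply/eqP; rewrite -subr_eq0; apply/eqP/shift_inj.
by rewrite linearB /= -shift_psi ?eu ?e ?subrr //; apply: VVZ_VV.
Qed.

Definition remove_lin x : W -> W' := mlin (fun S => fm_basis (remove_symbol x S) : W').
HB.instance Definition _ x := GRing.Linear.on (remove_lin x).

Lemma col_remove x y S : full x S -> col y (remove_symbol x S) = if y == x then 0 else col y S.
Proof.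
move=> h; case: eqP => [->|/eqP yx].
  by apply/col_empty => k; rewrite mem_remove_symbol // eqxx andbF.
by apply: eq_bigr => k _; rewrite mem_remove_symbol // yx andbT.
Qed.

(* When everything up to [x] is full, closing the gap at [x] turns [remove x] into
   the shift by one. *)
Lemma bar_integral_remove_low x c u N : supported (of_col c) u ->
  (forall y, 0 <= c y) -> (forall y, y <= x -> c y = l%:Z) -> (forall y, N < y -> c y = 0) ->
  bar_integral psi u <-> bar_integral psi' (remove_lin x u).
Proof.
move=> hc c0 cl cN; have hf : supported (fun S => forall y, y <= x -> full y S) u.
  by move=> S hS y yx; apply/col_full; rewrite (hc S hS) cl.
have -> : bar_integral psi u <-> bar_integral psi' (close_lin x (remove_lin x u)).
  rewrite bar_integral_shift.
  have H S : (forall y, y <= x -> full y S) -> shift_lin (fm_basis S) = (close_lin x \o remove_lin x) (fm_basis S).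
    by move=> hS; rewrite /= /shift_lin /remove_lin !mlin_basis /close_lin mlin_basis close_remove.
  by rewrite (mlin_eq H hf).
pose c' y := if y == x then 0 else c y.
apply: (@bar_integral_close _ _ _ _ psi'P (absz (N - x)%R).+1 x c').
- have hcf : supported (fun S => of_col c S /\ full x S) u.
    by move=> S hS; split; [exact: hc | exact: hf].
  by apply: mlin_supported hcf => S [h1 h2] y; rewrite col_remove // /c' h1.
- by move=> y; rewrite /c'; case: eqP.
- by rewrite /c' eqxx.
by move=> y hy; rewrite /c'; case: eqP => // _; apply: cN; lia.
Qed.

(* Swapping the full column [x] with the column [x - 1], and in [T[x]] the empty
   column [x] with [x - 1], lowers [x] until the previous lemma applies. *)
Lemma bar_integral_remove d x c u N : supported (of_col c) u ->
  (forall y, 0 <= c y) -> (forall y, c y <= l%:Z) -> c x = l%:Z ->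
  (forall y, y <= x - d%:Z -> c y = l%:Z) -> (forall y, N < y -> c y = 0) ->
  bar_integral psi u <-> bar_integral psi' (remove_lin x u).
Proof.
elim: d x c u N => [|d IH] x c u N hc c0 c1 cx cl cN.
  by apply: bar_integral_remove_low hc c0 _ cN => y yx; apply: cl; rewrite subr0.
pose x1 := x - 1; have ex : x1 + 1 = x by rewrite subrK.
have hf : supported (@full _ _ (x1 + 1)) u by rewrite ex; exact: supported_full hc cx.
have ha : supported (@no_addable _ _ x1) u.
  by apply: supported_sub hf => S; apply: full_no_addable.
have E1 : bar_integral psi (lower_lin x1 u) <-> bar_integral psi u.
  by apply: (bar_integral_lower psiP hc ha); rewrite ex cx c1.
have hc' := supported_lower_col hc ha.
have swE y : sw x1 y = if y == x1 then x else if y == x then x1 else y by rewrite /sw ex.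
have IH' : bar_integral psi (lower_lin x1 u) <-> bar_integral psi' (remove_lin x1 (lower_lin x1 u)).
  (* The bound becomes a maximum with x because the swap places column x - 1 at x. *)
  apply: (IH x1 (c \o sw x1) _ (Num.max N x)) => [|y|y|||y yN] /=.
  - exact: hc'.
  - exact: c0.
  - exact: c1.
  - rewrite swE eqxx; exact: cx.
  - move=> y yd; rewrite swE; case: eqP => [//|yx1]; case: eqP => [yx|_]; first by lia.
    by apply: cl; lia.
  rewrite swE; case: eqP => [e|yx1]; first by lia.
  by case: eqP => [e|_]; [lia | apply: cN; lia].
rewrite -E1 IH'.
pose c2 y := if y == x then 0 else c y.
have hr : supported (of_col c2) (remove_lin x u).
  have hcf : supported (fun S => of_col c S /\ full x S) u.
    by move=> S hS; split; [exact: hc | rewrite -ex; exact: hf].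
  by apply: mlin_supported hcf => S [h1 h2] y; rewrite col_remove // /c2 h1.
have he : supported (@empty _ _ x) (remove_lin x u).
  by apply: (supported_empty hr); rewrite /c2 eqxx.
have hn : supported (no_removable x1) (remove_lin x u).
  by apply: supported_sub he => S; rewrite -ex; apply: empty_no_removable.
(* After the removal column x is empty, so the weight at x - 1 is the height of column x - 1. *)
have hk : homog x1 (absz (c x1))%:Z (remove_lin x u).
  apply: supported_sub hr => S hS; rewrite Ksum_col !hS ex /c2 eqxx subr0.
  have -> : (x1 == x) = false by lia.
  by rewrite gez0_abs // c0.
have -> : remove_lin x1 (lower_lin x1 u) = raise_lin x1 (remove_lin x u).
  have H S : full (x1 + 1) S ->
      (remove_lin x1 \o lower_lin x1) (fm_basis S) = (raise_lin x1 \o remove_lin x) (fm_basis S).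
    move=> hS; rewrite /= /lower_lin /remove_lin !mlin_basis /raise_lin mlin_basis.
    by rewrite -raise_remove // ex.
  exact: (mlin_eq H hf).
by rewrite -(bar_integral_raise psi'P hn hk).
Qed.

End Shift.

Lemma of_wt_col l (v : 'I_l -> int) (W : freeMod Qq (symbol v)) (S : symbol v) (u : W) :
  supported (of_wt (wt S)) u -> supported (of_col (fun y => col y S)) u.
Proof. by apply: supported_sub => T [/funeqP e _] y; apply: e. Qed.

Section Remove.

Variables (l : nat) (v : 'I_l -> int).
Local Notation v' := (multicharge_pred v).
Variables (W : freeMod Qq (symbol v)) (W' : freeMod Qq (symbol v')).
Variables (psi : W -> W) (psi' : W' -> W').
Hypothesis psiP : bar_like q barQ l psi.
Hypothesis psi'P : bar_like q barQ l psi'.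
Implicit Types (S : symbol v) (u w g : W) (x y z : int).

Local Notation sy S := (fm_basis S : W).
Local Notation remove_lin := (@remove_lin l v W W').

Lemma of_col_bounds S : exists N : nat,
  (forall y, y <= - N%:Z -> col y S = l%:Z) /\ (forall y, N%:Z < y -> col y S = 0).
Proof.
have [f hf] : exists f : 'I_l -> nat, forall k,
    (forall y, y <= - (f k)%:Z -> y \in S k) /\ (forall y, (f k)%:Z < y -> y \notin S k).
  have H k := cid (row_bounds (S k)); by exists (fun k => projT1 (H k)) => k; apply: projT2 (H k).
have le k : (f k <= \max_k f k)%N by apply: leq_bigmax.
exists (\max_k f k)%N; split=> y hy; [apply/col_full => k | apply/col_empty => k];
  by apply hf; have := le k; lia.
Qed.

Lemma bar_integral_removeS S x u : full x S -> supported (of_col (fun y => col y S)) u ->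
  bar_integral psi u <-> bar_integral psi' (remove_lin x u).
Proof.
move=> hS hu; have [N [hl hh]] := of_col_bounds S.
(* This d puts all columns up to x - d at or below -N, where they are full. *)
apply: (bar_integral_remove psiP psi'P (d := absz (x + N%:Z)%R) (N := N%:Z) hu) => [y|y||y hy|y hy].
- exact: col_ge0.
- exact: col_le.
- exact/col_full.
- by apply: hl; lia.
- exact: hh.
Qed.

(** Removal is injective on symbols with full column x, so coefficients are only relabelled, and
    those outside the image are 0. *)
Lemma q_regular_remove x u : supported (@full _ _ x) u ->
  q_regular u <-> q_regular (remove_lin x u).
Proof.
move=> hu.
have E T : full x T -> fm_coef (remove_symbol x T) (remove_lin x u) = fm_coef T u.
  by move=> hT; apply: (@coef_inj_lin _ _ W W' (@full _ _ x) _ u _ hu T hT) => T1 T2; apply: remove_symbol_inj.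
have he : supported (@empty _ _ x) (remove_lin x u).
  apply: mlin_supported hu => T hT k; by rewrite mem_remove_symbol // eqxx andbF.
split=> h T.
  case: (pselect (empty x T)) => [/remove_surj[T0 [hT <-]]|nT]; first by rewrite E.
  exists 0; first exact: regular0_0.
  by rewrite mulr0; apply/eqP/negPn/negP => /he.
case: (pselect (full x T)) => [hT|nT]; first by rewrite -E.
exists 0; first exact: regular0_0.
by rewrite mulr0; apply/eqP/negPn/negP => /hu.
Qed.

Lemma remove_canonical S x g : full x S -> bar_integral psi g -> q_regular (g - sy S) ->
  bar_integral psi' (remove_lin x g) /\
  q_regular (remove_lin x g - fm_basis (remove_symbol x S)).
Proof.
move=> hS hg hr; have hc := of_wt_col (bar_integral_homog psiP hg hr).
split; first by rewrite -(bar_integral_removeS hS hc).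
have -> : fm_basis (remove_symbol x S) = remove_lin x (sy S) by rewrite /remove_lin mlin_basis.
rewrite -(linearB (remove_lin x)).
apply: (iffLR (q_regular_remove _)) hr; apply: supportedB; last exact: supported_basis.
by apply: supported_full hc _; apply/col_full.
Qed.

Lemma remove_canonical_surj S x (g' : W') : full x S -> bar_integral psi' g' ->
  q_regular (g' - fm_basis (remove_symbol x S)) ->
  exists2 g, bar_integral psi g & q_regular (g - sy S).
Proof.
move=> hS hg hr; have hc := of_wt_col (bar_integral_homog psi'P hg hr).
(* A section of the removal on symbols without x, with S as default elsewhere; it lifts g' to a
   vector g. *)
have [f hf] : exists f : symbol v' -> symbol v,
    forall T : symbol v', empty x T -> full x (f T) /\ remove_symbol x (f T) = T.
  have H (T : symbol v') : exists T0, empty x T -> full x T0 /\ remove_symbol x T0 = T.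
    by case: (pselect (empty x T)) => [/remove_surj[T0]|nT]; [exists T0 | exists S].
  by exists (fun T => projT1 (cid (H T))) => T; apply: projT2 (cid (H T)).
have he : supported (@empty _ _ x) g'.
  by apply: supported_empty hc _; rewrite (col_remove _ hS) eqxx.
pose g : W := mlin (fun T => sy (f T)) g'.
have eg : remove_lin x g = g'.
  rewrite /g; apply: (@supported_ind _ _ _ (@empty _ _ x)
    (fun g' : W' => remove_lin x (mlin (fun T => sy (f T)) g') = g') _ _ _ g' he) => [|c u w hu hw|T /hf[_ e]].
  - by rewrite (linear0 (mlin (fun T => sy (f T)))) (linear0 (remove_lin x)).
  - by rewrite (linearP (mlin (fun T => sy (f T)))) /= (linearP (remove_lin x)) /= hu hw.
  by rewrite mlin_basis /remove_lin mlin_basis e.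
have hfg : supported (@full _ _ x) g by apply: mlin_supported he => T /hf[].
have hcg : supported (of_col (fun y => col y S)) g.
  have hce : supported (fun T => empty x T /\ of_col (fun y => col y (remove_symbol x S)) T) g'.
    by move=> T hT; split; [exact: he | exact: hc].
  apply: mlin_supported hce => T [/hf[h1 h2] h3] y; have := h3 y.
  rewrite -{1}h2 !col_remove //; case: eqP => [-> _|_ -> //].
  by rewrite (iffLR (col_full _ _) h1) (iffLR (col_full _ _) hS).
exists g; first by rewrite (bar_integral_removeS hS hcg) eg.
apply: (iffRL (q_regular_remove (x := x) _)); first exact: supportedB hfg (supported_basis _).
rewrite (linearB (remove_lin x)) /= eg.
have -> : remove_lin x (sy S) = fm_basis (remove_symbol x S) by rewrite /remove_lin mlin_basis.
exact: hr.
Qed.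

Lemma canonical_unique S g g2 : bar_integral psi g -> q_regular (g - sy S) ->
  bar_integral psi g2 -> q_regular (g2 - sy S) -> g = g2.
Proof.
move=> h1 r1 h2 r2; apply/eqP; rewrite -subr_eq0; apply/eqP.
apply: (bar_integral_unique psiP); first exact: bar_integralB.
move=> T; have [c1 hc1 e1] := r1 T; have [c2 hc2 e2] := r2 T.
exists (c1 - c2); first by apply: regular0D => //; apply: regular0N.
rewrite mulrBr -e1 -e2 !(fm_coefD, fm_coefN); ring.
Qed.

End Remove.

(** * Comparison with the Fock space of the statement *)

Section Concrete.

Variables (l : nat) (v : 'I_l -> int).
Implicit Types (S T : symbol v) (u w g : fock v) (i : int).

Fact malg_coefZ S (c : Qq) u : (c *: u)@_S = c * u@_S.
Proof. exact: mcoeffZ. Qed.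
Fact malg_coef_basis S T : (sym T)@_S = (T == S)%:R.
Proof. exact: mcoeffU. Qed.

Definition malg_freeMod : freeMod Qq (symbol v) :=
  @FreeMod Qq (symbol v) (fock v) (@sym l v) (fun S u => u@_S) (fun u => msupp u)
    (fun S u w => mcoeffD S u w) malg_coefZ malg_coef_basis
    (fun u S => esym (mcoeff_neq0 u S)) (fun u w h => iffLR (malgP u w) h).

Local Notation W := malg_freeMod.

Lemma kap_sum i S j :
  #|[pred k : 'I_l | (j < k)%N && (i \in S k)]|%:Z
    - #|[pred k : 'I_l | (j < k)%N && (i + 1 \in S k)]|%:Z =
  \sum_(k < l | (j < k < l)%N) kap i (S k).
Proof.
have E (P : pred 'I_l) : #|P|%:Z = \sum_(k < l) (P k)%:Z.
  rewrite -sum1_card -[LHS]natz raddf_sum big_mkcond; apply: eq_bigr => k _.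
  by rewrite unfold_in; case: (P k).
rewrite !E -sumrB [RHS]big_mkcond; apply: eq_bigr => k _ /=.
by rewrite ltn_ord andbT /kap; case: (j < k)%N.
Qed.

Lemma F_symbolE i S : F_symbol i S = @Fsym Qq q l v W l i S.
Proof.
rewrite /F_symbol; under eq_bigr => j _ do rewrite kap_sum.
rewrite /Fsym; apply: eq_bigl => j; by rewrite ltn_ord.
Qed.

Lemma FE i u : F i u = @Fn Qq q l v W l i u.
Proof.
by rewrite /F /Fn /mlin; apply: eq_bigr => S _; rewrite F_symbolE.
Qed.

(** The carrier of the model is [fock v] only up to conversion, so equalities are composed by
    [etrans] rather than by rewriting. *)
Lemma FdivE i a u : Fdiv i a u = @Fd l v W i a u.
Proof.
have e : iter a (@F l v i) u = iter a (@Fn Qq q l v W l i) u.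
  elim: a => [|a IH].
    exact (erefl u).
  exact (etrans (congr1 (@F l v i) IH) (FE _ _)).
exact: etrans (congr1 (fun w : fock v => (qfact a)^-1 *: w) e) (esym (@FdE l v W i a u)).
Qed.

Lemma foldr_F s : foldr (@F l v) (sym (empty_symbol v)) s = word W s.
Proof.
elim: s => [|i s IH]; first exact (erefl (sym (empty_symbol v))).
exact (etrans (congr1 (@F l v i) IH) (FE _ _)).
Qed.

Lemma foldr_Fdiv s :
  foldr (fun p => @Fdiv l v p.1 p.2) (sym (empty_symbol v)) s = mono W s.
Proof.
elim: s => [|p s IH]; first exact (erefl (sym (empty_symbol v))).
exact (etrans (congr1 (@Fdiv l v p.1 p.2) IH) (FdivE _ _ _)).
Qed.

Lemma qspanE (A : set Qq) (X : set (fock v)) (Y : fock v -> Prop) u :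
  (forall x, X x <-> Y x) -> qspan A X u <-> @gspan (fock v) A Y u.
Proof.
move=> h; split=> [[s [hs ->]]|].
  elim: s hs => [|p s IH] hs; first by rewrite big_nil; apply: GSpan0.
  rewrite big_cons; have [hA hX] := hs p (mem_head p s).
  apply: GSpanS; [exact: hA | exact/h | apply: IH => p' hp'].
  by apply: hs; rewrite inE hp' orbT.
elim=> [|c x w hc /h hx _ [s [hs ->]]]; first by exists [::]; split=> //; rewrite big_nil.
exists ((c, x) :: s); split=> [p|]; last by rewrite big_cons.
by rewrite inE => /orP[/eqP ->|/hs].
Qed.

Lemma VE u : V u <-> @VV l v W u.
Proof.
apply: qspanE => x; split=> [[s _ <-]|[s ->]]; first by exists s; exact (foldr_F s).
exists s; [exact I | exact (foldr_F s)].
Qed.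

Lemma VZE u : VZ u <-> @VVZ l v W u.
Proof.
apply: qspanE => x; split=> [[s _ <-]|[s ->]]; first by exists s; exact (foldr_Fdiv s).
exists s; [exact I | exact (foldr_Fdiv s)].
Qed.

Lemma fockRP u : fockR u <-> forall T, regular0 u@_T.
Proof.
rewrite /fockR; split=> [|h].
  move/(@qspanE _ _ (range (@sym l v)) u (fun=> iff_refl _)).
  elim=> [T|c x w hc [S _ <-] _ IH T]; first by rewrite mcoeff0; exact: regular0_0.
  rewrite mcoeffD malg_coefZ malg_coef_basis; apply: regular0D; last exact: IH.
  apply: regular0M => //; case: eqP => _; [exact: regular0_1 | exact: regular0_0].
exists [seq (u@_T, sym T) | T <- msupp u]; split.
  by move=> p /mapP[T _ ->]; split; [exact: h | exists T].
rewrite big_map {1}[u](@fm_expand _ _ W); by [].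
Qed.

Lemma q_regularP u : q_regular (u : W) <-> exists2 w, fockR w & u = q *: w.
Proof.
split=> [h|[w /fockRP hw ->] T]; last first.
  by exists w@_T; [exact: hw | exact: malg_coefZ].
have h' T : regular0 (q^-1 * u@_T).
  have [c hc e] := h T; have {}e : u@_T = q * c := e.
  rewrite e mulKf; [exact: hc | exact: q_neq0].
exists (q^-1 *: u); first by apply/fockRP => T; rewrite malg_coefZ.
rewrite scalerA divff ?scale1r; [exact: erefl | exact: q_neq0].
Qed.

End Concrete.

(** Otherwise q^2 = -1 and q^4 = 1, but q is not a root of unity. *)
Lemma q_add_qV_neq0 : q + q^-1 != 0.
Proof.
have := @qexp_eq1 4 isT; apply: contraNneq => e.
have e2 : q * q = -1.
  have := congr1 ( *%R q) e; rewrite mulrDr mulfV ?mulr0; last exact: q_neq0.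
  by move/eqP; rewrite addr_eq0 => /eqP.
have -> : q ^+ 4 = (q * q) * (q * q) by ring.
by rewrite e2 mulrNN mulr1.
Qed.

Section Bar.

Variables (l : nat) (v : 'I_l -> int).
Implicit Types (S T : symbol v) (u w g : fock v) (i : int).
Local Notation W := (malg_freeMod v).

Lemma exists_bar_like : exists psi : W -> W, bar_like q barQ l psi.
Proof. exact: (bar_like_exists _ q_neq0 q_add_qV_neq0 barQ_q (leqnn l)). Qed.

Variable psi : W -> W.
Hypothesis psiP : bar_like q barQ l psi.

Lemma is_bar_psi : is_bar (psi : fock v -> fock v).
Proof.
split.
- move=> u /VE hu; apply/VE; exact: psi_VV psiP _ hu.
- move=> u w _ _; have := bl_lin psiP 1 u w.
  rewrite (rmorph1 barQ) !scale1r; exact.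
- move=> a u _; exact (psi_Z psiP a u).
- move=> i u _; rewrite !FE; exact: (bl_F psiP).
exact: (bl_vac psiP).
Qed.

(** As [bar] is selected by [xget], it has the required properties once some map has them, and [psi]
    does. *)
Lemma is_bar_bar : is_bar (@bar l v).
Proof. have h : exists f : fock v -> fock v, [set f | is_bar f] f by exists psi; exact is_bar_psi.
exact (@xgetPex (fock v -> fock v)%type id _ h). Qed.

(** Both maps fix every word and are semilinear on [V], which the words span. *)
Lemma bar_V u : V u -> bar u = psi u.
Proof.
have [hV hD hZ hF h0] := is_bar_bar.
have hz : V (0 : fock v) by apply/VE; apply: VV0.
move/VE; move: u; apply: (@VV_ind l v W (fun u => bar u = psi u)) => [|c s u hu e].
  have e := hZ 0 0 hz; rewrite (rmorph0 barQ) !scale0r in e.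
  exact (etrans e (esym (psi_0 psiP))).
have hs s' : V (word W s' : fock v) by apply/VE; apply: VV_word.
have es s' : bar (word W s' : fock v) = word W s'.
  elim: s' => [|i s' IH]; first exact h0.
  exact (etrans (etrans (congr1 (@bar l v) (esym (FE i (word W s')))) (hF i _ (hs s')))
    (etrans (congr1 (F i) IH) (FE i _))).
have hcs : V (c *: (word W s : fock v)) by apply/VE; apply: (VVZs c); apply: VV_word.
have hu' : V (u : fock v) by apply/VE.
apply: (etrans (hD _ _ hcs hu')); rewrite (hZ _ _ (hs s)) es e.
rewrite -[X in _ *: X](psi_word psiP); exact (esym (bl_lin psiP c (word W s) u)).
Qed.

End Bar.

Section CanonicalBasis.

Variables (l : nat) (v : 'I_l -> int).
Implicit Types (S T : symbol v) (u w g : fock v) (i : int).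
Local Notation W := (malg_freeMod v).

(** D may be infinite; as it contains the support of u, the sum over it reduces to [msupp u]. *)
Lemma fsum_coef (v2 : 'I_l -> int) (D : set (symbol v)) (f : symbol v -> symbol v2) u :
  (forall T, u@_T != 0 -> D T) ->
  \sum_(T \in D) u@_T *: sym (f T) =
  @mlin Qq (symbol v) W (malg_freeMod v2) (fun T => fm_basis (f T)) u.
Proof.
move=> hD; rewrite (fsbigE (msupp u)) ?fset_uniq //=.
- rewrite big_seq_cond /mlin [in RHS]big_seq; apply: eq_bigl => T.
  case: (boolP (T \in msupp u)) => //=; rewrite -mcoeff_neq0 => /hD h.
  exact: mem_set h.
- by move=> T /=; rewrite -mcoeff_neq0; apply: hD.
by move=> T _ /=; rewrite -mcoeff_eq0 => /eqP ->; rewrite scale0r.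
Qed.

Variable psi : W -> W.
Hypothesis psiP : bar_like q barQ l psi.

Lemma is_canonicalP S g : is_canonical S g <->
  bar_integral psi g /\ q_regular (g - sym S : W).
Proof.
split=> [[/VZE hg e /q_regularP hr]|[[hg e] /q_regularP hr]].
  split=> //; split=> //; rewrite -(bar_V psiP) //; apply/VE; exact: VVZ_VV.
split=> //; first exact/VZE.
by rewrite (bar_V psiP) //; apply/VE; exact: VVZ_VV.
Qed.

Lemma G_canonical S g : is_canonical S g -> G S = g.
Proof.
move=> hg; have h : is_canonical S (G S).
  exact (@xgetPex (fock v) 0 [set g | is_canonical S g] (ex_intro _ g hg)).
move/is_canonicalP: hg => [h1 r1]; move/is_canonicalP: h => [h2 r2].
exact (canonical_unique psiP h2 r2 h1 r1).
Qed.

Lemma G_0 S : ~ (exists g, is_canonical S g) -> G S = 0.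
Proof. by move=> h; apply: xgetPN => g hg; apply: h; exists g. Qed.

End CanonicalBasis.

Theorem theorem3p4 (l : nat) (v : 'I_l -> int) (n : nat) (x : int)
    (S : symbol v) :
  (0 < l)%N ->
  (forall i j : 'I_l, (i <= j)%N -> v j <= v i) ->
  standard S ->
  S \in symbols_of_size v n ->
  in_every_row x S ->
  [/\ G S = \sum_(T \in symbols_of_size v n) alpha S T *: sym T,
      forall T : symbol v, alpha S T != 0 -> in_every_row x T
    & G (remove_symbol x S) =
      \sum_(T \in symbols_of_size v n)
        alpha S T *: sym (remove_symbol x T)].
Proof.
move=> _ _ _ /set_mem hn hS.
have [psi psiP] := exists_bar_like v.
have [psi' psi'P] := exists_bar_like (multicharge_pred v).
rewrite /alpha; case: (pselect (exists g, is_canonical S g)) => [[g hg]|nG]; last first.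
  have nG' : ~ (exists g, is_canonical (remove_symbol x S) g).
    move=> [g' /(is_canonicalP psi'P)[h r]]; apply: nG.
    have [g h1 r1] := remove_canonical_surj psiP psi'P hS h r.
    by exists g; apply/(is_canonicalP psiP).
  (* Stated for any relabelling f, to cover the sums over T and over T[x] at once. *)
  have a0 (v2 : 'I_l -> int) (f : symbol v -> symbol v2) :
      \sum_(T \in symbols_of_size v n) (0 : fock v)@_T *: sym (f T) = 0.
    by apply: fsbig1 => T _; rewrite mcoeff0; exact: scale0r.
  rewrite !G_0 //; split=> [|T|].
  - by rewrite (a0 v id).
  - by rewrite mcoeff0 eqxx.
  by rewrite (a0 _ (remove_symbol x)).
rewrite (G_canonical psiP hg).
have [h r] := iffLR (is_canonicalP psiP S g) hg.
(* The equality of weights yields both the range of summation, through the size, and the full column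
   x, through the column counts. *)
have hw T : g@_T != 0 -> wt T = wt S by move=> gT; exact: (bar_integral_homog psiP h r gT).
have hD T : g@_T != 0 -> symbols_of_size v n T.
  by move=> /hw[_ e]; rewrite /symbols_of_size /= e.
split.
- rewrite (fsum_coef id hD); exact (@fm_expand _ _ (malg_freeMod v) g).
- move=> T /hw[/funeqP e _]; apply/col_full; rewrite e; exact/col_full.
rewrite (fsum_coef (remove_symbol x) hD); apply: (G_canonical psi'P).
apply/(is_canonicalP psi'P); exact: (remove_canonical psiP psi'P hS h r).
Qed.
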